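(* Let $n\ge 3$, let $f\in\mathbb{Q}[s_1,s_2]$ be the polynomial with $f(x+y,xy)=x^{n+1}+y^{n+1}$, and let $\mathcal{L}$, $\mathcal{V}^{\mathrm{in}}$, $\mathcal{V}^{\mathrm{out}}$, $\mathcal{W}$ be the matrix factorizations (of a double line, the two trivalent diagrams, and the four-valent diagram) and $\mathcal{C}'(D)_n$ the matrix factorization of a planar diagram $D$, all defined in the context. Then the following hold. (1) Let $D$ be a planar diagram having an outgoing double-line end point. Let $R$ be the polynomial ring over $\mathbb{Q}$ generated by all other boundary parameters of $D$, and let $\omega\in R$ be such that the potential of $\mathcal{C}'(D)_n$ is $f(y,z)-\omega$ when the chosen end point carries parameters $(y,z)$. Write $\mathcal{C}'(D)_n^{(y,z)}$ for the matrix factorization of $D$ with parameters $(y,z)$ at this end point. Then in $\mathrm{HMF}^{gr}_{\mathbb{Q}[y,z]\otimes R,\,f(y,z)-\omega}$ $$\mathcal{C}'(D)_n^{(y',z')}\boxtimes \mathcal{L}(y,z;y',z')\ \simeq\ \mathcal{C}'(D)_n^{(y,z)} .$$ (2) Let $D$ be a planar diagram having an incoming double-line end point. Let $R$ be the polynomial ring over $\mathbb{Q}$ generated by all other boundary parameters of $D$, and let $\omega\in R$ be such that the potential of $\mathcal{C}'(D)_n$ is $\omega-f(y,z)$ when the chosen end point carries parameters $(y,z)$. Then, with the same notation, in $\mathrm{HMF}^{gr}_{\mathbb{Q}[y,z]\otimes R,\,\omega-f(y,z)}$ $$\mathcal{C}'(D)_n^{(y',z')}\boxtimes \mathcal{L}(y',z';y,z)\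 \simeq\ \mathcal{C}'(D)_n^{(y,z)} .$$ (3) In $\mathrm{HMF}^{gr}_{\mathbb{Q},0}$, the matrix factorization of the closed double line satisfies $$\mathcal{L}(y_1,z_1;y_2,z_2)\big|_{(y_1,z_1)=(y_2,z_2)}\ \simeq\ \big(J_{f(y,z)}\{4-2n\}\to 0\to J_{f(y,z)}\{4-2n\}\big),$$ where $J_{f(y,z)}=\mathbb{Q}[y,z]/\langle \partial f/\partial y,\ \partial f/\partial z\rangle$. (4) In $\mathrm{HMF}^{gr}_{\mathbb{Q}[y_1,y_2,z_1,z_2],\,f(y_1,z_1)-f(y_2,z_2)}$ $$\mathcal{V}^{\mathrm{in}}(y_1,z_1;x_3,x_4)\boxtimes\mathcal{V}^{\mathrm{out}}(x_3,x_4;y_2,z_2)\ \simeq\ \mathcal{L}(y_1,z_1;y_2,z_2)\{-1\}\ \oplus\ \mathcal{L}(y_1,z_1;y_2,z_2)\{1\}.$$ (5) In $\mathrm{HMF}^{gr}_{\mathbb{Q}[x_1,x_2,x_3,x_4],\,x_1^{n+1}+x_2^{n+1}-x_3^{n+1}-x_4^{n+1}}$ $$\mathcal{V}^{\mathrm{out}}(x_1,x_2;y_5,z_5)\boxtimes\mathcal{V}^{\mathrm{in}}(y_5,z_5;x_3,x_4)\ \simeq\ \mathcal{W}(x_1,x_2;x_3,x_4).$$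
   Context: **Matrix factorizations.** Let $R$ be a $\mathbb{Z}$-graded polynomial ring over $\mathbb{Q}$ and $\omega\in R$. A ($\mathbb{Z}$-graded) matrix factorization with potential $\omega$ is a pair of free $\mathbb{Z}$-graded $R$-modules $M_0,M_1$ (infinite rank allowed) with $R$-module maps $d_{M_0}:M_0\to M_1$, $d_{M_1}:M_1\to M_0$ such that $d_{M_1}d_{M_0}=\omega\,\mathrm{Id}_{M_0}$ and $d_{M_0}d_{M_1}=\omega\,\mathrm{Id}_{M_1}$; it is written $(M_0\to M_1\to M_0)$. A morphism $\overline f=(f_0,f_1):\overline M\to\overline N$ is a pair of grading-preserving $R$-module maps $f_i:M_i\to N_i$ with $d_{N_0}f_0=f_1d_{M_0}$ and $d_{N_1}f_1=f_0d_{M_1}$. This gives the category $\mathrm{MF}^{gr}_{R,\omega}$. A morphism is null-homotopic if there are $R$-module maps $h_0:M_0\to N_1$, $h_1:M_1\to N_0$ with $f_0=h_1d_{M_0}+d_{N_1}h_0$ and $f_1=h_0d_{M_1}+d_{N_0}h_1$. The category $\mathrm{HMF}^{gr}_{R,\omega}$ has the same objects, and morphisms modulo null-homotopic ones. The shift $\{m\}$ shifts the $\mathbb{Z}$-grading of both modules up by $m$ (so a generator of degree $0$ becomes of degree $m$). **Tensor product.** For $\overline M$ over $R$ with potential $\omega$ and $\overline N$ over $R'$ with potential $\omega'$, tensor products of rings and modules are taken over $R\cap R'$ (the polynomial ring on the common variables), and $\overline M\boxtimes\overline N$ is the matrix factorization over $R\otimes R'$ with potential $\omega+\omega'$ given by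 $$\begin{pmatrix}M_0\otimes N_0\\ M_1\otimes N_1\end{pmatrix}\xrightarrow{\begin{pmatrix}d_{M_0}&-d_{N_1}\\ d_{N_0}&d_{M_1}\end{pmatrix}}\begin{pmatrix}M_1\otimes N_0\\ M_0\otimes N_1\end{pmatrix}\xrightarrow{\begin{pmatrix}d_{M_1}&d_{N_1}\\ -d_{N_0}&d_{M_0}\end{pmatrix}}\begin{pmatrix}M_0\otimes N_0\\ M_1\otimes N_1\end{pmatrix},$$ where each differential acts on its own tensor factor. If the potential lies in a polynomial subring, the factorization may be regarded as one (of possibly infinite rank) over that subring. In (4) and (5), the products are regarded over the ring of boundary parameters named in the category (so $x_3,x_4$, respectively $y_5,z_5$, are internal variables), and likewise in (1), (2) ($y',z'$ are internal, as are any internal variables of $D$). **Koszul factorizations.** For homogeneous $a,b\in R$ and a $\mathbb{Z}$-graded $R$-module $M$, $$K(a;b)_M=\big(M\xrightarrow{\,a\,}M\{\tfrac12(\deg b-\deg a)\}\xrightarrow{\,b\,}M\big),$$ and for sequences, $K\big({}^t(a_1,\dots,a_k);{}^t(b_1,\dots,b_k)\big)_M=\boxtimes_{i=1}^kK(a_i;b_i)_M$, with potential $\sum a_ib_i$. **Gradings.** $\deg x_i=2$, $\deg y_i=2$, $\deg z_i=4$ (primed variables likewise). All fractions below are polynomials. **Elementary factorizations** (with $n\ge3$ and $f(x+y,xy)=x^{n+1}+y^{n+1}$). Single line: $\mathcal{S}(x_1;x_2)=K\big(\tfrac{x_1^{n+1}-x_2^{n+1}}{x_1-x_2};x_1-x_2\big)_{\mathbb{Q}[x_1,x_2]}$.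 Double line: $$\mathcal{L}(y_1,z_1;y_2,z_2)=K\left(\begin{pmatrix}\frac{f(y_1,z_1)-f(y_2,z_1)}{y_1-y_2}\\ \frac{f(y_2,z_1)-f(y_2,z_2)}{z_1-z_2}\end{pmatrix};\begin{pmatrix}y_1-y_2\\ z_1-z_2\end{pmatrix}\right)_{\mathbb{Q}[y_1,y_2,z_1,z_2]},$$ potential $f(y_1,z_1)-f(y_2,z_2)$. Trivalent diagram with two incoming single lines and one outgoing double line: $$\mathcal{V}^{\mathrm{in}}(y_3,z_3;x_1,x_2)=K\left(\begin{pmatrix}\frac{f(y_3,z_3)-f(x_1+x_2,z_3)}{y_3-x_1-x_2}\\ \frac{f(x_1+x_2,z_3)-f(x_1+x_2,x_1x_2)}{z_3-x_1x_2}\end{pmatrix};\begin{pmatrix}y_3-x_1-x_2\\ z_3-x_1x_2\end{pmatrix}\right)_{\mathbb{Q}[x_1,x_2,y_3,z_3]},$$ potential $f(y_3,z_3)-x_1^{n+1}-x_2^{n+1}$. Trivalent diagram with one incoming double line and two outgoing single lines: $$\mathcal{V}^{\mathrm{out}}(x_1,x_2;y_3,z_3)=K\left(\begin{pmatrix}\frac{f(x_1+x_2,x_1x_2)-f(y_3,x_1x_2)}{x_1+x_2-y_3}\\ \frac{f(y_3,x_1x_2)-f(y_3,z_3)}{x_1x_2-z_3}\end{pmatrix};\begin{pmatrix}x_1+x_2-y_3\\ x_1x_2-z_3\end{pmatrix}\right)_{\mathbb{Q}[x_1,x_2,y_3,z_3]}\{-1\},$$ potential $x_1^{n+1}+x_2^{n+1}-f(y_3,z_3)$.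 Four-valent (Khovanov–Rozansky) diagram, outgoing $x_1,x_2$, incoming $x_3,x_4$: $$\mathcal{W}(x_1,x_2;x_3,x_4)=K\left(\begin{pmatrix}\frac{f(x_1+x_2,x_1x_2)-f(x_3+x_4,x_1x_2)}{x_1+x_2-x_3-x_4}\\ \frac{f(x_3+x_4,x_1x_2)-f(x_3+x_4,x_3x_4)}{x_1x_2-x_3x_4}\end{pmatrix};\begin{pmatrix}x_1+x_2-x_3-x_4\\ x_1x_2-x_3x_4\end{pmatrix}\right)_{\mathbb{Q}[x_1,x_2,x_3,x_4]}\{-1\}.$$ **Planar diagrams.** A planar diagram $D$ is an oriented planar diagram obtained from the five elementary diagrams above by disjoint union and by gluing outgoing end points to incoming end points of the same type (single to single, double to double). Each single end point carries one parameter $x$, each double end point a pair $(y,z)$. $\mathcal{C}'(D)_n$ is defined by: the factorizations above for elementary diagrams (up to renaming parameters); $\boxtimes$ for disjoint unions; and for gluing, the tensor product with the parameters of the two glued end points identified (for gluing two end points of the same diagram, the corresponding parameters are set equal). The potential of $\mathcal{C}'(D)_n$ is the sum over outgoing end points of $x^{n+1}$ (single) or $f(y,z)$ (double) minus the same sum over incoming end points, and $\mathcal{C}'(D)_n$ is regarded as a factorization over the polynomial ring in the boundary parameters. In (3), $|_{(y_1,z_1)=(y_2,z_2)}$ means identifying $y_1=y_2$, $z_1=z_2$ in modules and differentials (grading shifts are kept as in $\mathcal{L}(y_1,z_1;y_2,z_2)$), and the result, of potential $0$, is regarded over $\mathbb{Q}$. *)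

(* Defs.v *)
From HB Require Import structures.
From mathcomp Require Import all_boot all_order all_algebra.
From mathcomp Require Import generic_quotient ring_quotient mxtens mpoly.
From Stdlib Require Import ClassicalEpsilon.

Set Implicit Arguments.
Unset Strict Implicit.
Unset Printing Implicit Defensive.

Import GRing.Theory.
Local Open Scope ring_scope.

Declare Scope mf_scope.
Delimit Scope mf_scope with MF.

(* The gradings are recorded by their homogeneous elements only: [homogeneous d p]
   says that [p] is zero or homogeneous of degree [d]. *)
Record gring := Gring {
  gring_sort :> comNzRingType;
  homogeneous : int -> gring_sort -> Prop }.

Record gmod (R : gring) := Gmod {
  gmod_sort :> lmodType R;
  mhomogeneous : int -> gmod_sort -> Prop }.

(* A graded module is graded-free if it has a (possibly infinite) basis [b] of
   homogeneous elements of degrees [dg], the grading being the induced one. *)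
Definition graded_free (R : gring) (M : gmod R) : Prop :=
  exists (I : eqType) (b : I -> M) (dg : I -> int),
    [/\ forall v : M, exists (s : seq I) (c : I -> R),
          v = \sum_(i <- s) c i *: b i,
        forall (s : seq I) (c : I -> R), uniq s ->
          \sum_(i <- s) c i *: b i = 0 -> forall i, i \in s -> c i = 0
      & forall (d : int) (v : M), mhomogeneous d v <->
          exists (s : seq I) (c : I -> R),
            (forall i, homogeneous (d - dg i) (c i)) /\
            v = \sum_(i <- s) c i *: b i].

Definition gmod_shift (R : gring) (m : int) (M : gmod R) : gmod R :=
  @Gmod R M (fun d v => mhomogeneous (d - m) v).

(* The conditions making [M] an object of MF^gr_{R,w} are [is_mf w M] below. *)
Record mf (R : gring) := Mf {
  mod0 : gmod R;
  mod1 : gmod R;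
  md0 : {linear mod0 -> mod1};
  md1 : {linear mod1 -> mod0} }.

Definition is_mf (R : gring) (w : R) (M : mf R) : Prop :=
  [/\ graded_free (mod0 M), graded_free (mod1 M),
      forall v, md1 M (md0 M v) = w *: v
    & forall v, md0 M (md1 M v) = w *: v].

Record mf_hom (R : gring) (M N : mf R) := MfHom {
  hom0 : {linear mod0 M -> mod0 N};
  hom1 : {linear mod1 M -> mod1 N};
  hom0_homog : forall d v, mhomogeneous d v -> mhomogeneous d (hom0 v);
  hom1_homog : forall d v, mhomogeneous d v -> mhomogeneous d (hom1 v);
  hom_md0 : forall v, md0 N (hom0 v) = hom1 (md0 M v);
  hom_md1 : forall v, md1 N (hom1 v) = hom0 (md1 M v) }.

Definition mf_id (R : gring) (M : mf R) : mf_hom M M.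
Proof. by exists idfun idfun. Defined.

Definition mf_comp (R : gring) (M N P : mf R) (g : mf_hom N P) (f : mf_hom M N) :
  mf_hom M P.
Proof.
exists (hom0 g \o hom0 f) (hom1 g \o hom1 f) => [d v hv|d v hv|v|v] /=.
- exact/hom0_homog/hom0_homog.
- exact/hom1_homog/hom1_homog.
- by rewrite hom_md0 hom_md0.
- by rewrite hom_md1 hom_md1.
Defined.

Definition homotopic (R : gring) (M N : mf R) (f g : mf_hom M N) : Prop :=
  exists (h0 : {linear mod0 M -> mod1 N}) (h1 : {linear mod1 M -> mod0 N}),
    (forall v, hom0 f v - hom0 g v = h1 (md0 M v) + md1 N (h0 v)) /\
    (forall v, hom1 f v - hom1 g v = h0 (md1 M v) + md0 N (h1 v)).

(* [M] and [N] are objects of HMF^gr_{R,w}, isomorphic in this category. *)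
Definition HMF_iso (R : gring) (w : R) (M N : mf R) : Prop :=
  [/\ is_mf w M, is_mf w N
    & exists (f : mf_hom M N) (g : mf_hom N M),
        homotopic (mf_comp g f) (mf_id M) /\ homotopic (mf_comp f g) (mf_id N)].

Definition restrict (R S : comNzRingType) (iota : {rmorphism R -> S})
  (V : lmodType S) : Type := V.

Section Restriction.
Variables (R S : comNzRingType) (iota : {rmorphism R -> S}).

Section RestrictLmod.
Variable V : lmodType S.
HB.instance Definition _ := GRing.Zmodule.copy (restrict iota V) V.

Let scale (a : R) (v : restrict iota V) : restrict iota V := iota a *: (v : V).
Fact restrict_scaleA a b v : scale a (scale b v) = scale (a * b) v.
Proof. by rewrite /scale scalerA rmorphM. Qed.
Fact restrict_scale1 : left_id 1 scale.
Proof. by move=> v; rewrite /scale rmorph1 scale1r. Qed.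
Fact restrict_scaleDr : right_distributive scale +%R.
Proof. by move=> a u v; rewrite /scale scalerDr. Qed.
Fact restrict_scaleDl v : {morph scale^~ v : a b / a + b}.
Proof. by move=> a b; rewrite /scale rmorphD scalerDl. Qed.

HB.instance Definition _ := GRing.Zmodule_isLmodule.Build R (restrict iota V)
  restrict_scaleA restrict_scale1 restrict_scaleDr restrict_scaleDl.
End RestrictLmod.

Definition restrict_fun (V W : lmodType S) (f : {linear V -> W}) :
  restrict iota V -> restrict iota W := f.

Fact restrict_fun_linear (V W : lmodType S) (f : {linear V -> W}) :
  linear (restrict_fun f).
Proof. by move=> a u v; rewrite /restrict_fun [LHS]linearP. Qed.

HB.instance Definition _ (V W : lmodType S) (f : {linear V -> W}) :=
  GRing.isLinear.Build R (restrict iota V) (restrict iota W) _ (restrict_fun f)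
    (restrict_fun_linear f).
End Restriction.
Arguments restrict_fun {R S} iota {V W} f _.

Definition gmod_over (R S : gring) (iota : {rmorphism R -> S}) (M : gmod S) :
    gmod R :=
  @Gmod R (restrict iota M) (@mhomogeneous S M).

(* [M] regarded as a factorization over [R]. *)
Definition mf_over (R S : gring) (iota : {rmorphism R -> S}) (M : mf S) : mf R :=
  @Mf R (gmod_over iota (mod0 M)) (gmod_over iota (mod1 M))
    (restrict_fun iota (md0 M)) (restrict_fun iota (md1 M)).

Record gvars := Gvars { gvars_sort :> finType; wt : gvars_sort -> nat }.

Definition gvars_sum (V W : gvars) : gvars :=
  @Gvars (V + W)%type (fun v => match v with inl x => wt x | inr x => wt x end).

(* Variables of [gvars_sum B I] coming from the boundary parameters [B] and from
   the internal variables [I]. *)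
Definition bv (V W : gvars) (p : V) : gvars_sum V W := inl p.
Definition iv (V W : gvars) (j : W) : gvars_sum V W := inr j.

Definition gvars_sum_map (V W V' W' : gvars) (g : V -> V') (h : W -> W')
    (p : gvars_sum V W) : gvars_sum V' W' :=
  match p with inl x => bv _ (g x) | inr y => iv _ (h y) end.

Definition no_var : gvars := @Gvars void (fun=> 0%N).
Definition single_var : gvars := @Gvars unit (fun=> 2%N).
Definition double_var : gvars := @Gvars bool (fun e => if e then 4%N else 2%N).

Definition xvar : single_var := tt.
Definition yvar : double_var := false.
Definition zvar : double_var := true.

Definition wtm (V : gvars) (m : 'X_{1..#|V|}) : nat :=
  (\sum_(i < #|V|) wt (enum_val i) * m i)%N.

Fact wtm0 (V : gvars) : wtm (V := V) 0%MM = 0%N.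
Proof. by rewrite /wtm big1 // => i _; rewrite mnm0E muln0. Qed.

Fact wtmD (V : gvars) (m1 m2 : 'X_{1..#|V|}) :
  wtm (m1 + m2)%MM = (wtm m1 + wtm m2)%N.
Proof.
by rewrite /wtm -big_split; apply: eq_bigr => i _; rewrite mnmDE mulnDr.
Qed.

HB.instance Definition _ (V : gvars) :=
  isMeasure.Build #|V| (@wtm V) (@wtm0 V) (@wtmD V).

Definition polyQ (V : gvars) : gring :=
  @Gring {mpoly rat[#|V|]}
    (fun d p => {in msupp p, forall m, (wtm m)%:Z = d}).

Definition ratG : gring := @Gring rat (fun d c => c = 0 \/ d = 0).

Definition X (V : gvars) (v : V) : polyQ V := 'X_(enum_rank v).

Definition wdeg (V : gvars) (p : polyQ V) : nat := (mmeasure (@wtm V) p).-1.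

Definition constQ (V : gvars) : {rmorphism ratG -> polyQ V} :=
  @mpolyC #|V| rat.

Definition rename (V W : gvars) (s : V -> W) : {rmorphism polyQ V -> polyQ W} :=
  comp_mpoly [tuple X (s (enum_val i)) | i < #|V|].

(* The polynomial p / q, when q divides p. *)
Definition pquo (V : gvars) (p q : polyQ V) : polyQ V :=
  epsilon (inhabits 0) (fun r => r * q = p).

Definition feval (V : gvars) (f : {mpoly rat[2]}) (p q : polyQ V) : polyQ V :=
  f \mPo [tuple p; q].

(* Free modules of finite rank over Q[V], given by the degrees of the vectors of
   a basis, and the matrices of the differentials acting on column vectors. *)
Record fmf (V : gvars) := Fmf {
  rk0 : nat;
  rk1 : nat;
  dg0 : 'I_rk0 -> int;
  dg1 : 'I_rk1 -> int;
  mx0 : 'M[polyQ V]_(rk1, rk0);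
  mx1 : 'M[polyQ V]_(rk0, rk1) }.

Definition free_gmod (V : gvars) (r : nat) (dg : 'I_r -> int) : gmod (polyQ V) :=
  @Gmod (polyQ V) 'cV[polyQ V]_r
    (fun d v => forall i, homogeneous (d - dg i) (v i 0)).

Definition mf_of (V : gvars) (M : fmf V) : mf (polyQ V) :=
  @Mf (polyQ V) (free_gmod V (@dg0 V M)) (free_gmod V (@dg1 V M))
    (mulmx (mx0 M)) (mulmx (mx1 M)).

Definition fmf_shift (V : gvars) (m : int) (M : fmf V) : fmf V :=
  Fmf (fun i => dg0 i + m) (fun i => dg1 i + m) (mx0 M) (mx1 M).

Definition dg_sum r s (dg : 'I_r -> int) (dg' : 'I_s -> int) (k : 'I_(r + s)) :
    int :=
  match split k with inl i => dg i | inr j => dg' j end.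

Definition dg_tens r s (dg : 'I_r -> int) (dg' : 'I_s -> int) (k : 'I_(r * s)) :
    int :=
  dg (mxtens_unindex k).1 + dg' (mxtens_unindex k).2.

Definition fmf_sum (V : gvars) (M N : fmf V) : fmf V :=
  Fmf (dg_sum (@dg0 V M) (@dg0 V N)) (dg_sum (@dg1 V M) (@dg1 V N))
    (block_mx (mx0 M) 0 0 (mx0 N)) (block_mx (mx1 M) 0 0 (mx1 N)).

(* The product of factorizations over Q[V'] and Q[V''] is computed over the ring
   Q[V], V = V' \cup V'', to which both are extended: the tensor product over
   Q[V' \cap V''] of free modules is the tensor product over Q[V] of their
   extensions to Q[V], with basis the products of basis elements. *)
Definition fmf_tens (V : gvars) (M N : fmf V) : fmf V :=
  Fmf (dg_sum (dg_tens (@dg0 V M) (@dg0 V N)) (dg_tens (@dg1 V M) (@dg1 V N)))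
      (dg_sum (dg_tens (@dg1 V M) (@dg0 V N)) (dg_tens (@dg0 V M) (@dg1 V N)))
    (block_mx (mx0 M *t 1%:M) (- (1%:M *t mx1 N))
              (1%:M *t mx0 N) (mx1 M *t 1%:M))
    (block_mx (mx1 M *t 1%:M) (1%:M *t mx1 N)
              (- (1%:M *t mx0 N)) (mx0 M *t 1%:M)).

(* Extension of scalars along the renaming (or identification) [s]. *)
Definition fmf_rename (V W : gvars) (s : V -> W) (M : fmf V) : fmf W :=
  Fmf (@dg0 V M) (@dg1 V M)
    (map_mx (rename s) (mx0 M)) (map_mx (rename s) (mx1 M)).

Definition koszul (V : gvars) (a b : polyQ V) : fmf V :=
  @Fmf V 1 1 (fun=> 0) (fun=> (((wdeg b)%:Z - (wdeg a)%:Z) %/ 2)%Z) a%:M b%:M.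

Notation "M \boxt N" := (fmf_tens M N)
  (at level 40, left associativity) : mf_scope.
Notation "M \oplus N" := (fmf_sum M N)
  (at level 50, left associativity) : mf_scope.
Notation "M {{ m }}" := (fmf_shift m M)
  (at level 30, format "M {{ m }}") : mf_scope.

Local Open Scope mf_scope.

(* The parameters are variables of Q[V]; when they do not exhaust V, these are
   the factorizations over the ring of their parameters extended to Q[V]. *)
Section Elementary.
Variables (n : nat) (f : {mpoly rat[2]}) (V : gvars).

Definition mfS (x1 x2 : V) : fmf V :=
  let x1 := X x1 in let x2 := X x2 in
  koszul (pquo (x1 ^+ n.+1 - x2 ^+ n.+1) (x1 - x2)) (x1 - x2).

Definition mfL (y1 z1 y2 z2 : V) : fmf V :=
  let y1 := X y1 in let z1 := X z1 in let y2 := X y2 in let z2 := X z2 in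
  koszul (pquo (feval f y1 z1 - feval f y2 z1) (y1 - y2)) (y1 - y2) \boxt
  koszul (pquo (feval f y2 z1 - feval f y2 z2) (z1 - z2)) (z1 - z2).

Definition mfVin (y3 z3 x1 x2 : V) : fmf V :=
  let y3 := X y3 in let z3 := X z3 in let x1 := X x1 in let x2 := X x2 in
  koszul (pquo (feval f y3 z3 - feval f (x1 + x2) z3) (y3 - x1 - x2))
    (y3 - x1 - x2) \boxt
  koszul (pquo (feval f (x1 + x2) z3 - feval f (x1 + x2) (x1 * x2))
    (z3 - x1 * x2)) (z3 - x1 * x2).

Definition mfVout (x1 x2 y3 z3 : V) : fmf V :=
  let x1 := X x1 in let x2 := X x2 in let y3 := X y3 in let z3 := X z3 in
  (koszul (pquo (feval f (x1 + x2) (x1 * x2) - feval f y3 (x1 * x2))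
     (x1 + x2 - y3)) (x1 + x2 - y3) \boxt
   koszul (pquo (feval f y3 (x1 * x2) - feval f y3 z3)
     (x1 * x2 - z3)) (x1 * x2 - z3)) {{ -1 }}.

Definition mfW (x1 x2 x3 x4 : V) : fmf V :=
  let x1 := X x1 in let x2 := X x2 in let x3 := X x3 in let x4 := X x4 in
  (koszul (pquo (feval f (x1 + x2) (x1 * x2) - feval f (x3 + x4) (x1 * x2))
     (x1 + x2 - x3 - x4)) (x1 + x2 - x3 - x4) \boxt
   koszul (pquo (feval f (x3 + x4) (x1 * x2) - feval f (x3 + x4) (x3 * x4))
     (x1 * x2 - x3 * x4)) (x1 * x2 - x3 * x4)) {{ -1 }}.
End Elementary.

(* [diagram a b c d] is the type of diagrams with [a] outgoing and [b] incoming
   single end points, [c] outgoing and [d] incoming double end points. Gluing two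
   diagrams together is gluing inside their disjoint union. The factorization of
   a diagram depends only on its gluing pattern: the embedding in the plane is not
   recorded, and non-planar patterns are not excluded. *)
Inductive diagram : nat -> nat -> nat -> nat -> Type :=
| SingleLine : diagram 1 1 0 0
| DoubleLine : diagram 0 0 1 1
| TriIn : diagram 0 2 1 0
| TriOut : diagram 2 0 0 1
| Four : diagram 2 2 0 0
| Union a b c d a' b' c' d' :
    diagram a b c d -> diagram a' b' c' d' ->
    diagram (a + a') (b + b') (c + c') (d + d')
| GlueSingle a b c d (o : 'I_a.+1) (i : 'I_b.+1) :
    diagram a.+1 b.+1 c d -> diagram a b c d
| GlueDouble a b c d (o : 'I_c.+1) (i : 'I_d.+1) :
    diagram a b c.+1 d.+1 -> diagram a b c d.

Definition bvars (a b c d : nat) : gvars :=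
  gvars_sum
    (gvars_sum (@Gvars 'I_a (fun=> 2%N)) (@Gvars 'I_b (fun=> 2%N)))
    (gvars_sum (@Gvars ('I_c * bool)%type (fun p => wt (p.2 : double_var)))
               (@Gvars ('I_d * bool)%type (fun p => wt (p.2 : double_var)))).

Section BoundaryVars.
Variables a b c d : nat.

Definition xout (i : 'I_a) : bvars a b c d := inl (inl i).
Definition xin (i : 'I_b) : bvars a b c d := inl (inr i).
(* The parameters y ([e = yvar]) and z ([e = zvar]) of a double end point. *)
Definition dout (i : 'I_c) (e : bool) : bvars a b c d := inr (inl (i, e)).
Definition din (i : 'I_d) (e : bool) : bvars a b c d := inr (inr (i, e)).

Definition bvars_case (T : Type) (fxout : 'I_a -> T) (fxin : 'I_b -> T)
    (fdout : 'I_c -> bool -> T) (fdin : 'I_d -> bool -> T)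
    (p : bvars a b c d) : T :=
  match p with
  | inl (inl i) => fxout i
  | inl (inr i) => fxin i
  | inr (inl (i, e)) => fdout i e
  | inr (inr (i, e)) => fdin i e
  end.

Definition potential (n : nat) (f : {mpoly rat[2]}) : polyQ (bvars a b c d) :=
  (\sum_(i < a) X (xout i) ^+ n.+1
    + \sum_(i < c) feval f (X (dout i yvar)) (X (dout i zvar)))
  - (\sum_(i < b) X (xin i) ^+ n.+1
    + \sum_(i < d) feval f (X (din i yvar)) (X (din i zvar))).
End BoundaryVars.
Arguments xout {a b c d} i.
Arguments xin {a b c d} i.
Arguments dout {a b c d} i e.
Arguments din {a b c d} i e.

(* A factorization over the boundary parameters [B] and internal variables. *)
Record ifmf (B : gvars) := Ifmf {
  ivars : gvars;
  ifac : fmf (gvars_sum B ivars) }.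

Section Wiring.
Variables a b c d : nat.

Definition union_l a' b' c' d' :
    bvars a b c d -> bvars (a + a') (b + b') (c + c') (d + d') :=
  bvars_case (fun i => xout (lshift a' i)) (fun i => xin (lshift b' i))
    (fun i e => dout (lshift c' i) e) (fun i e => din (lshift d' i) e).

Definition union_r a' b' c' d' :
    bvars a' b' c' d' -> bvars (a + a') (b + b') (c + c') (d + d') :=
  bvars_case (fun i => xout (rshift a i)) (fun i => xin (rshift b i))
    (fun i e => dout (rshift c i) e) (fun i e => din (rshift d i) e).

(* The parameters of the glued end points [o] and [i] become the same new internal
   variable(s), the other end points being renumbered by [unlift]. *)
Definition glue_single (o : 'I_a.+1) (i : 'I_b.+1) (I : gvars)
    (p : gvars_sum (bvars a.+1 b.+1 c d) I) :
    gvars_sum (bvars a b c d) (gvars_sum I single_var) :=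
  match p with
  | inl q => bvars_case
      (fun o' => if unlift o o' is Some k then bv _ (xout k)
                 else iv _ (iv _ xvar))
      (fun i' => if unlift i i' is Some k then bv _ (xin k)
                 else iv _ (iv _ xvar))
      (fun k e => bv _ (dout k e))
      (fun k e => bv _ (din k e)) q
  | inr j => iv _ (bv _ j)
  end.

Definition glue_double (o : 'I_c.+1) (i : 'I_d.+1) (I : gvars)
    (p : gvars_sum (bvars a b c.+1 d.+1) I) :
    gvars_sum (bvars a b c d) (gvars_sum I double_var) :=
  match p with
  | inl q => bvars_case
      (fun k => bv _ (xout k))
      (fun k => bv _ (xin k))
      (fun o' e => if unlift o o' is Some k then bv _ (dout k e)
                   else iv _ (iv _ (e : double_var)))
      (fun i' e => if unlift i i' is Some k then bv _ (din k e)
                   else iv _ (iv _ (e : double_var))) q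
  | inr j => iv _ (bv _ j)
  end.
End Wiring.

Fixpoint Cfac (n : nat) (f : {mpoly rat[2]}) (a b c d : nat)
    (D : diagram a b c d) : ifmf (bvars a b c d) :=
  match D in diagram a b c d return ifmf (bvars a b c d) with
  | SingleLine =>
      @Ifmf (bvars 1 1 0 0) no_var
        (mfS n (bv _ (xout ord0)) (bv _ (xin ord0)))
  | DoubleLine =>
      @Ifmf (bvars 0 0 1 1) no_var
        (mfL f (bv _ (dout ord0 yvar)) (bv _ (dout ord0 zvar))
               (bv _ (din ord0 yvar)) (bv _ (din ord0 zvar)))
  | TriIn =>
      @Ifmf (bvars 0 2 1 0) no_var
        (mfVin f (bv _ (dout ord0 yvar)) (bv _ (dout ord0 zvar))
                 (bv _ (xin ord0)) (bv _ (xin ord_max)))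
  | TriOut =>
      @Ifmf (bvars 2 0 0 1) no_var
        (mfVout f (bv _ (xout ord0)) (bv _ (xout ord_max))
                  (bv _ (din ord0 yvar)) (bv _ (din ord0 zvar)))
  | Four =>
      @Ifmf (bvars 2 2 0 0) no_var
        (mfW f (bv _ (xout ord0)) (bv _ (xout ord_max))
               (bv _ (xin ord0)) (bv _ (xin ord_max)))
  | Union a b c d a' b' c' d' D1 D2 =>
      let C1 := Cfac n f D1 in let C2 := Cfac n f D2 in
      @Ifmf (bvars (a + a') (b + b') (c + c') (d + d'))
        (gvars_sum (ivars C1) (ivars C2))
        (fmf_rename
           (gvars_sum_map (@union_l a b c d a' b' c' d') (@bv _ _))
           (ifac C1) \boxt
         fmf_rename
           (gvars_sum_map (@union_r a b c d a' b' c' d') (@iv _ _))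
           (ifac C2))
  | GlueSingle a b c d o i D =>
      let C := Cfac n f D in
      @Ifmf (bvars a b c d) (gvars_sum (ivars C) single_var)
        (fmf_rename (@glue_single a b c d o i (ivars C)) (ifac C))
  | GlueDouble a b c d o i D =>
      let C := Cfac n f D in
      @Ifmf (bvars a b c d) (gvars_sum (ivars C) double_var)
        (fmf_rename (@glue_double a b c d o i (ivars C)) (ifac C))
  end.

(* A factorization over Q[B,I], regarded over Q[B]. *)
Definition over_boundary (B I : gvars) (M : fmf (gvars_sum B I)) : mf (polyQ B) :=
  mf_over (rename (@bv B I)) (mf_of M).

Section Relabel.
Variables a b c d : nat.

(* The inclusion of the boundary parameters other than those of the end point [o]
   among all the boundary parameters. *)
Definition skip_dout (o : 'I_c.+1) : bvars a b c d -> bvars a b c.+1 d :=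
  bvars_case xout xin (fun k e => dout (lift o k) e) din.

Definition skip_din (i : 'I_d.+1) : bvars a b c d -> bvars a b c d.+1 :=
  bvars_case xout xin dout (fun k e => din (lift i k) e).

(* The parameters (y,z) of the end point [o] are replaced by new internal
   variables (y',z'). *)
Definition prime_dout (o : 'I_c) (I : gvars) (p : gvars_sum (bvars a b c d) I) :
    gvars_sum (bvars a b c d) (gvars_sum I double_var) :=
  match p with
  | inl q => bvars_case
      (fun k => bv _ (xout k)) (fun k => bv _ (xin k))
      (fun k e => if k == o then iv _ (iv _ (e : double_var))
                 else bv _ (dout k e))
      (fun k e => bv _ (din k e)) q
  | inr j => iv _ (bv _ j)
  end.

Definition prime_din (i : 'I_d) (I : gvars) (p : gvars_sum (bvars a b c d) I) :
    gvars_sum (bvars a b c d) (gvars_sum I double_var) :=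
  match p with
  | inl q => bvars_case
      (fun k => bv _ (xout k)) (fun k => bv _ (xin k))
      (fun k e => bv _ (dout k e))
      (fun k e => if k == i then iv _ (iv _ (e : double_var))
                 else bv _ (din k e)) q
  | inr j => iv _ (bv _ j)
  end.
End Relabel.

Section IdealQuotient.
Variables (S : comNzRingType) (u v : S).

Definition ideal2 (p : S) : bool :=
  if excluded_middle_informative (exists r s, p = r * u + s * v) then true
  else false.

Fact ideal2P p : reflect (exists r s, p = r * u + s * v) (p \in ideal2).
Proof.
by rewrite unfold_in; case: excluded_middle_informative => h; constructor.
Qed.

Fact ideal2_zmod_closed : @zmod_closed S ideal2.
Proof.
split=> [|p q /ideal2P[r [s ->]] /ideal2P[r' [s' ->]]]; apply/ideal2P.
  by exists 0, 0; rewrite !mul0r addr0.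
by exists (r - r'), (s - s'); rewrite !mulrBl opprD addrACA.
Qed.

HB.instance Definition _ := GRing.isZmodClosed.Build S ideal2 ideal2_zmod_closed.

Fact ideal2M a p : p \in ideal2 -> a * p \in ideal2.
Proof.
move=> /ideal2P[r [s ->]]; apply/ideal2P; exists (a * r), (a * s).
by rewrite mulrDr !mulrA.
Qed.

Definition ideal2_zmod : zmodClosed S := GRing.ZmodClosed.clone S ideal2 _.

(* S / (u, v), as an S-module. *)
Definition quot2 : Type := Quotient.quot ideal2_zmod.

HB.instance Definition _ := GRing.Zmodule.on quot2.

Definition quot2_pi (p : S) : quot2 :=
  (\pi_(Quotient.quot ideal2_zmod) p)%qT.

Let scale (a : S) (x : quot2) : quot2 :=
  quot2_pi (a * repr (x : Quotient.quot ideal2_zmod)).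

Fact quot2_piP p q : reflect (quot2_pi p = quot2_pi q) (p - q \in ideal2).
Proof. by rewrite (Quotient.idealrBE ideal2_zmod); apply: eqP. Qed.

Fact quot2_piD p q : quot2_pi (p + q) = quot2_pi p + quot2_pi q.
Proof. by rewrite /quot2_pi raddfD. Qed.

Fact quot2_piE (x : quot2) : exists p, x = quot2_pi p.
Proof.
by exists (repr (x : Quotient.quot ideal2_zmod)); rewrite /quot2_pi reprK.
Qed.

Fact quot2_scaleE a p : scale a (quot2_pi p) = quot2_pi (a * p).
Proof.
apply/quot2_piP; rewrite -mulrBr; apply: ideal2M.
by apply/quot2_piP; rewrite /quot2_pi reprK.
Qed.

Fact quot2_scaleA a b x : scale a (scale b x) = scale (a * b) x.
Proof. by have [p ->] := quot2_piE x; rewrite !quot2_scaleE mulrA. Qed.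
Fact quot2_scale1 : left_id 1 scale.
Proof. by move=> x; have [p ->] := quot2_piE x; rewrite quot2_scaleE mul1r. Qed.
Fact quot2_scaleDr : right_distributive scale +%R.
Proof.
move=> a x y; have [p ->] := quot2_piE x; have [q ->] := quot2_piE y.
by rewrite -quot2_piD !quot2_scaleE mulrDr quot2_piD.
Qed.
Fact quot2_scaleDl x : {morph scale^~ x : a b / a + b}.
Proof.
move=> a b; have [p ->] := quot2_piE x.
by rewrite !quot2_scaleE mulrDl quot2_piD.
Qed.

HB.instance Definition _ := GRing.Zmodule_isLmodule.Build S quot2
  quot2_scaleA quot2_scale1 quot2_scaleDr quot2_scaleDl.
End IdealQuotient.

Definition jacobian (f : {mpoly rat[2]}) : gmod (polyQ double_var) :=
  let S := polyQ double_var in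
  let fy : S := feval f^`M(ord0) (X yvar) (X zvar) in
  let fz : S := feval f^`M(ord_max) (X yvar) (X zvar) in
  @Gmod S (quot2 fy fz)
    (fun d x => exists p : S, homogeneous d p /\ x = quot2_pi fy fz p).

Definition zero_gmod (R : gring) : gmod R := @Gmod R 'cV[R]_0 (fun _ _ => True).

(* The factorization (M -> 0 -> M) of potential 0. *)
Definition mf_even (R : gring) (M : gmod R) : mf R :=
  @Mf R M (zero_gmod R) \0 \0.

Definition over_Q (V : gvars) (M : mf (polyQ V)) : mf ratG :=
  mf_over (constQ V) M.

Definition identify (V : gvars) (p : gvars_sum V V) : V :=
  match p with inl x => x | inr x => x end.

(* Main.v *)
(** Factoring out K(a; b) makes a factorization the cone of multiplication by a and
    b, and if b = x - g for a variable x not occurring in g, this cone is homotopy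
    equivalent to its quotient by b, that is, to the substitution of g for x. The
    elementary factorizations are all specializations K(a; u - v) \boxt K(a'; z - w) of
    that of a double line, so gluing a double line or gluing along a double line
    eliminates the two internal variables: this gives (1), (2) and (5).

    For (4), eliminating x4 = y2 - x3 leaves the cone of b = x3 (y2 - x3) - z2. Dividing by
    this polynomial, monic of degree 2 in x3 up to sign, leaves a free module with
    basis 1, x3; modulo b the differentials are those of the double line, whence two
    copies of it.

    For (3), the identification of the ends turns L into the Koszul complex of the partial
    derivatives of f, which are multiples of two consecutive complete symmetric
    polynomials in two variables. These form a regular sequence, by the recursion
    h_(k+2) = s h_(k+1) - t h_k, and over Q the resolution is split by linear maps
    obtained from normal forms with respect to the standard monomials of an ideal. *)

Require Import Defs.
From HB Require Import structures.
From mathcomp Require Import all_boot all_order all_algebra.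
From mathcomp Require Import mxtens mpoly ring zify.
From Stdlib Require Import ClassicalEpsilon FunctionalExtensionality.

Set Implicit Arguments.
Unset Strict Implicit.
Unset Printing Implicit Defensive.

Import GRing.Theory.
Local Open Scope ring_scope.
Local Open Scope mf_scope.

(** * Homotopy equivalences and cones *)

(** Morphisms of HMF preserve degrees, so eliminating a variable takes more than exact division by
    [b]. The map from the quotient back to the cone carries a correction term, a differential
    followed by division by [b]; it respects the grading because both differentials have one common
    degree. This degree is n+1 for every diagram, half the degree of the potential, so degrees and
    potentials are carried together through the induction over diagrams. In the definitions the
    shift of a Koszul factor is read off from the degrees of its two entries, which fails once an
    entry vanishes, as it does when the ends of a double line are identified. Hence the explicit
    shifts 2-(n+1) and 4-(n+1), and divided differences given by recursions that stay valid on the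
    diagonal. Agreement with the definitions then amounts to some polynomials being nonzero.
    Quotients, remainders and normal forms are taken by choice; their uniqueness makes them linear
    and compatible with degrees. Over the boundary ring a factorization has infinite rank in
    general; monomials in the internal variables provide the homogeneous basis. *)

Definition lin_of (R : pzRingType) (U V : lmodType R) (f : U -> V)
    (fL : linear f) : {linear U -> V} :=
  HB.pack f (GRing.isLinear.Build R U V *:%R f fL).

Lemma eq_components (S T : Type) (u v : S * T) : u.1 = v.1 -> u.2 = v.2 -> u = v.
Proof. by case: u v => [a b] [c d] /= -> ->. Qed.

Section Equivalence.
Variable R : gring.
Implicit Types M N P : mf R.

Definition heq M N : Prop :=
  exists (f : mf_hom M N) (g : mf_hom N M),
    homotopic (mf_comp g f) (mf_id M) /\ homotopic (mf_comp f g) (mf_id N).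

Lemma homotopic_comp M N P (f : mf_hom M N) (g : mf_hom N M)
    (f' : mf_hom N P) (g' : mf_hom P N) :
  homotopic (mf_comp g f) (mf_id M) -> homotopic (mf_comp g' f') (mf_id N) ->
  homotopic (mf_comp (mf_comp g g') (mf_comp f' f)) (mf_id M).
Proof.
move=> [h0 [h1 [H0 H1]]] [k0 [k1 [K0 K1]]].
exists (h0 \+ (hom1 g \o k0 \o hom0 f)), (h1 \+ (hom0 g \o k1 \o hom1 f)).
split=> v /=.
  rewrite [md1 M _]raddfD /= addrACA -H0 /= -hom_md0 hom_md1 -raddfD -K0 /=.
  by rewrite raddfB /= [RHS]addrC subrKA.
rewrite [md0 M _]raddfD /= addrACA -H1 /= -hom_md1 hom_md0 -raddfD -K1 /=.
by rewrite raddfB /= [RHS]addrC subrKA.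
Qed.

Lemma heq_trans N M P : heq M N -> heq N P -> heq M P.
Proof.
move=> [f [g [gf fg]]] [f' [g' [gf' fg']]].
exists (mf_comp f' f), (mf_comp g g').
by split; apply: homotopic_comp.
Qed.

(** The maps are strictly inverse, so zero homotopies suffice. Homogeneity is asked as an
    equivalence so that the inverse maps preserve degrees too; their linearity is inherited from
    [f0] and [f1]. *)
Lemma heq_iso M N (f0 : mod0 M -> mod0 N) (f1 : mod1 M -> mod1 N)
    (g0 : mod0 N -> mod0 M) (g1 : mod1 N -> mod1 M) :
  linear f0 -> linear f1 -> cancel f0 g0 -> cancel g0 f0 ->
  cancel f1 g1 -> cancel g1 f1 ->
  (forall d v, mhomogeneous d (f0 v) <-> mhomogeneous d v) ->
  (forall d v, mhomogeneous d (f1 v) <-> mhomogeneous d v) ->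
  (forall v, md0 N (f0 v) = f1 (md0 M v)) ->
  (forall v, md1 N (f1 v) = f0 (md1 M v)) -> heq M N.
Proof.
move=> L0 L1 fK0 gK0 fK1 gK1 h0 h1 E0 E1.
have L0' : linear g0 := can2_linear (f := lin_of L0) fK0 gK0.
have L1' : linear g1 := can2_linear (f := lin_of L1) fK1 gK1.
unshelve eexists.
  exists (lin_of L0) (lin_of L1) => //= d v; [exact: (h0 d v).2|exact: (h1 d v).2].
unshelve eexists.
  exists (lin_of L0') (lin_of L1') => /= [d v hv|d v hv|v|v].
  - by apply/(h0 _ _); rewrite gK0.
  - by apply/(h1 _ _); rewrite gK1.
  - by rewrite -{2}[v]gK0 E0 fK1.
  - by rewrite -{2}[v]gK1 E1 fK0.
by split; exists \0, \0; split=> v /=; rewrite ?(fK0, gK0, fK1, gK1) subrr raddf0 addr0.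
Qed.

Definition gmod_prod (M N : gmod R) (k : int) : gmod R :=
  @Gmod R (M * N)%type
    (fun d v => mhomogeneous d v.1 /\ mhomogeneous (d - k) v.2).

End Equivalence.

Section Cone.
Variables (R : gring) (E : mf R).
Variables (a0 b0 : {linear mod0 E -> mod0 E}) (a1 b1 : {linear mod1 E -> mod1 E}).
Variable k : int.

Definition cone_d0 (v : mod0 E * mod1 E) : mod1 E * mod0 E :=
  (md0 E v.1 - b1 v.2, a0 v.1 + md1 E v.2).
Definition cone_d1 (v : mod1 E * mod0 E) : mod0 E * mod1 E :=
  (md1 E v.1 + b0 v.2, - a1 v.1 + md0 E v.2).

Fact cone_d0_linear : linear cone_d0.
Proof.
move=> c u v; rewrite /cone_d0 /= !linearP; congr (_, _);
  by rewrite /= scalerDr addrACA.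
Qed.

Fact cone_d1_linear : linear cone_d1.
Proof.
move=> c u v; rewrite /cone_d1 /= !linearP; congr (_, _);
  by rewrite /= scalerDr addrACA.
Qed.

(* The tensor product of [E] with the Koszul factorization of [(a; b)], [a] and
   [b] acting on [E] by [a0], [a1] and [b0], [b1]. *)
Definition cone : mf R :=
  @Mf R (gmod_prod (mod0 E) (mod1 E) k) (gmod_prod (mod1 E) (mod0 E) k)
    (lin_of cone_d0_linear) (lin_of cone_d1_linear).

Variables (C : mf R) (w : R) (delta beta : int).
Variables (p0 : mod0 E -> mod0 C) (p1 : mod1 E -> mod1 C).
Variables (s0 : mod0 C -> mod0 E) (s1 : mod1 C -> mod1 E).
Variables (q0 : mod0 E -> mod0 E) (q1 : mod1 E -> mod1 E).

(** Here [C] is the quotient of [E] by [b], with projection [p], section [s] and division [q], all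
    linear over [R] only. Projecting the first component to [C] is a morphism; in the other
    direction [s] fails to commute with the differentials by d s - s d = b q d s and has to be
    corrected. The numbers [delta] and [beta] are the degrees of the differentials and of [b]. *)
Lemma cone_elim :
  linear p0 -> linear p1 -> linear s0 -> linear s1 -> linear q0 -> linear q1 ->
  injective b0 -> injective b1 ->
  (forall x, p0 (b0 x) = 0) -> (forall x, p1 (b1 x) = 0) ->
  cancel s0 p0 -> cancel s1 p1 ->
  (forall x, x = b0 (q0 x) + s0 (p0 x)) ->
  (forall x, x = b1 (q1 x) + s1 (p1 x)) ->
  (forall x, md0 E (b0 x) = b1 (md0 E x)) ->
  (forall x, md1 E (b1 x) = b0 (md1 E x)) ->
  (forall x, a0 (b0 x) = b0 (a0 x)) -> (forall x, a1 (b1 x) = b1 (a1 x)) ->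
  (forall x, md1 E (md0 E x) + b0 (a0 x) = w *: x) ->
  (forall x, md0 E (md1 E x) + b1 (a1 x) = w *: x) ->
  (forall x, md1 C (md0 C x) = w *: x) -> (forall x, md0 C (md1 C x) = w *: x) ->
  (forall x, md0 C (p0 x) = p1 (md0 E x)) ->
  (forall x, md1 C (p1 x) = p0 (md1 E x)) ->
  k = beta - delta ->
  (forall d x, mhomogeneous d x -> mhomogeneous d (- x : mod0 E)) ->
  (forall d x, mhomogeneous d x -> mhomogeneous d (p0 x)) ->
  (forall d x, mhomogeneous d x -> mhomogeneous d (p1 x)) ->
  (forall d x, mhomogeneous d x -> mhomogeneous d (s0 x)) ->
  (forall d x, mhomogeneous d x -> mhomogeneous d (s1 x)) ->
  (forall d x, mhomogeneous d x -> mhomogeneous (d - beta) (q0 x)) ->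
  (forall d x, mhomogeneous d x -> mhomogeneous (d - beta) (q1 x)) ->
  (forall d x, mhomogeneous d x -> mhomogeneous (d + delta) (md0 E x)) ->
  (forall d x, mhomogeneous d x -> mhomogeneous (d + delta) (md1 E x)) ->
  heq cone C.
Proof.
move=> Lp0 Lp1 Ls0 Ls1 Lq0 Lq1 bI0 bI1 pb0 pb1 ps0 ps1 D0 D1 db0 db1 ab0 ab1
  w0 w1 wC0 wC1 dp0 dp1 kE hN hp0 hp1 hs0 hs1 hq0 hq1 hd0 hd1.
have s00 : s0 0 = 0 := raddf0 (lin_of Ls0).
have s10 : s1 0 = 0 := raddf0 (lin_of Ls1).
have sZ0 c x : s0 (c *: x) = c *: s0 x := linearZ_LR (lin_of Ls0) c x.
have sZ1 c x : s1 (c *: x) = c *: s1 x := linearZ_LR (lin_of Ls1) c x.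
have pD0 : {morph p0 : x y / x + y} := raddfD (lin_of Lp0).
have pB1 : {morph p1 : x y / x - y} := raddfB (lin_of Lp1).
have qD0 : {morph q0 : x y / x + y} := raddfD (lin_of Lq0).
have qB0 : {morph q0 : x y / x - y} := raddfB (lin_of Lq0).
have qB1 : {morph q1 : x y / x - y} := raddfB (lin_of Lq1).
have qb0 x : q0 (b0 x) = x.
  apply: bI0; have := D0 (b0 x).
  by rewrite pb0 s00 addr0.
have qb1 x : q1 (b1 x) = x.
  apply: bI1; have := D1 (b1 x).
  by rewrite pb1 s10 addr0.
have sp0 x : s0 (p0 x) = x - b0 (q0 x) by rewrite {2}[x]D0 [b0 _ + _]addrC addrK.
have sp1 x : s1 (p1 x) = x - b1 (q1 x) by rewrite {2}[x]D1 [b1 _ + _]addrC addrK.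
have sd0 x : s1 (md0 C x) = md0 E (s0 x) - b1 (q1 (md0 E (s0 x))).
  by rewrite -{1}[x]ps0 dp0 sp1.
have sd1 x : s0 (md1 C x) = md1 E (s1 x) - b0 (q0 (md1 E (s1 x))).
  by rewrite -{1}[x]ps1 dp1 sp0.
pose f0 (v : mod0 E * mod1 E) := p0 v.1.
pose f1 (v : mod1 E * mod0 E) := p1 v.1.
(* The second component makes up for the defect b q d s of [s]. The signs differ in the two parities
   because [b] enters [cone_d0] with a minus and [cone_d1] with a plus. *)
pose g0 c : mod0 E * mod1 E := (s0 c, q1 (md0 E (s0 c))).
pose g1 c : mod1 E * mod0 E := (s1 c, - q0 (md1 E (s1 c))).
(* As s p differs from the identity by b q, the homotopies are [q] up to sign, composed with the [b]
   entry of the differential. *)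
pose h0 (v : mod0 E * mod1 E) : mod1 E * mod0 E := (0, - q0 v.1).
pose h1 (v : mod1 E * mod0 E) : mod0 E * mod1 E := (0, q1 v.1).
have Lf0 : linear f0 by move=> c u v; rewrite /f0 /= Lp0.
have Lf1 : linear f1 by move=> c u v; rewrite /f1 /= Lp1.
have Lg0 : linear g0.
  by move=> c u v; rewrite /g0 Ls0 linearP Lq1.
have Lg1 : linear g1.
  move=> c u v; rewrite /g1 Ls1 linearP Lq0; congr (_, _) => /=.
  by rewrite scalerN opprD.
have Lh0 : linear h0.
  move=> c u v; rewrite /h0 /= Lq0; congr (_, _) => /=.
    by rewrite scaler0 addr0.
  by rewrite scalerN opprD.
have Lh1 : linear h1.
  move=> c u v; rewrite /h1 /= Lq1; congr (_, _) => /=.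
  by rewrite scaler0 addr0.
unshelve eexists.
  exists (lin_of Lf0 : {linear mod0 cone -> _}) (lin_of Lf1 : {linear mod1 cone -> _}).
  - by move=> d v [hv _]; exact: hp0.
  - by move=> d v [hv _]; exact: hp1.
  - by move=> v /=; rewrite /f0 /f1 /cone_d0 /= pB1 /= pb1 subr0 dp0.
  - by move=> v /=; rewrite /f0 /f1 /cone_d1 /= pD0 /= pb0 addr0 dp1.
unshelve eexists.
  exists (lin_of Lg0 : {linear _ -> mod0 cone}) (lin_of Lg1 : {linear _ -> mod1 cone}).
  - move=> d v hv; split=> /=; first exact: hs0.
    by rewrite kE opprB addrA; apply/hq1/hd0/hs0.
  - move=> d v hv; split=> /=; first exact: hs1.
    by apply: hN; rewrite kE opprB addrA; apply/hq0/hd1/hs1.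
  - move=> c /=; rewrite /g0 /g1 /cone_d0 /= sd0; congr (_, _).
    (* The second components are compared after multiplication by [b], where d d + b a = w on [E]
       and d d = w on [C] can be used. *)
    apply: bI0; rewrite (raddfD b0) raddfN /=.
    rewrite -[in RHS]sd0 -db1.
    have -> : b1 (q1 (md0 E (s0 c))) = md0 E (s0 c) - s1 (md0 C c).
      by rewrite sd0 opprB addrC subrK.
    rewrite raddfB /= addrA [b0 _ + _]addrC w0.
    have -> : b0 (q0 (md1 E (s1 (md0 C c)))) = md1 E (s1 (md0 C c)) - w *: s0 c.
      by rewrite -sZ0 /= -wC0 sd1 opprB addrC subrK.
    by rewrite opprB.
  - move=> c /=; rewrite /g0 /g1 /cone_d1 /= raddfN /= sd1; congr (_, _).
    apply: bI1; rewrite (raddfD b1) !raddfN /=.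
    rewrite -[in RHS]sd1 -db0.
    have -> : b0 (q0 (md1 E (s1 c))) = md1 E (s1 c) - s0 (md1 C c).
      by rewrite sd1 opprB addrC subrK.
    rewrite raddfB /=.
    have -> : b1 (q1 (md0 E (s0 (md1 C c)))) = md0 E (s0 (md1 C c)) - w *: s1 c.
      by rewrite -sZ1 /= -wC1 sd0 opprB addrC subrK.
    by rewrite -(w1 (s1 c)) opprB opprD [RHS]addrC addrA addrAC [- _ - _]addrC.
split.
  exists (lin_of Lh0 : {linear mod0 cone -> mod1 cone}),
    (lin_of Lh1 : {linear mod1 cone -> mod0 cone}).
  split=> -[x y] /=; rewrite /f0 /f1 /g0 /g1 /h0 /h1 /cone_d0 /cone_d1 /=.
    apply: eq_components => /=.
      by rewrite sp0 [x - _]addrC addrK raddfN raddf0 !add0r.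
    rewrite sp0 [md0 E (x - _)]raddfB /= db0 !qB1 !qb1 !raddf0 !raddfN /=.
    by rewrite add0r addrAC.
  apply: eq_components => /=.
    by rewrite sp1 [x - _]addrC addrK raddf0 !add0r.
  rewrite sp1 [md1 E (x - _)]raddfB /= db1 qB0 qD0 !qb0 !raddf0 /=.
  by rewrite add0r !opprD opprK addrAC.
by exists \0, \0; split=> v /=; rewrite /f0 /f1 /g0 /g1 /= ?ps0 ?ps1 subrr raddf0 addr0.
Qed.
End Cone.

(** * Graded polynomial rings *)

Arguments homogeneous : simpl never.
Arguments constQ : simpl never.
Arguments rename : simpl never.

Section Substitution.
Variables V W : gvars.
Implicit Types p q : polyQ V.

Lemma polyQ_ind (P : polyQ V -> Prop) :
  (forall c, P (constQ V c)) -> (forall v, P (X v)) ->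
  (forall p q, P p -> P q -> P (p + q)) ->
  (forall p q, P p -> P q -> P (p * q)) -> forall p, P p.
Proof.
move=> PC PX PD PM; elim/mpolyind=> [|c m p _ _ Pp].
  by have := PC 0; rewrite raddf0.
apply: (PD _ _) => //; rewrite -mul_mpolyC; apply: (PM _ _); first exact: PC.
rewrite mpolyXE_id; elim/big_ind: _ => [|p1 p2|i _]; last 1 first.
- elim: (m i) => [|k IHk]; first by have := PC 1; rewrite rmorph1 expr0.
  rewrite exprS; apply: (PM _ _) => //.
  by have := PX (enum_val i); rewrite /X enum_valK.
- by have := PC 1; rewrite rmorph1.
- exact: PM.
Qed.

Definition subst (phi : V -> polyQ W) : {rmorphism polyQ V -> polyQ W} :=
  comp_mpoly [tuple phi (enum_val i) | i < #|V|].

Lemma substX phi v : subst phi (X v) = phi v.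
Proof.
rewrite /subst /X /= comp_mpolyXU -tnth_nth tnth_mktuple enum_rankK //.
Qed.

Lemma substC phi c : subst phi (constQ V c) = constQ W c.
Proof. exact: comp_mpolyC. Qed.

End Substitution.
Arguments subst : simpl never.

Lemma renameX (V W : gvars) (s : V -> W) v : rename s (X v) = X (s v).
Proof. exact: (substX (fun v => X (s v))). Qed.

Lemma renameC (V W : gvars) (s : V -> W) c : rename s (constQ V c) = constQ W c.
Proof. exact: (substC (fun v => X (s v))). Qed.

Lemma polyQ_rmorph_eq (V : gvars) (S : pzRingType) (f g : {rmorphism polyQ V -> S}) :
  (forall c, f (constQ V c) = g (constQ V c)) ->
  (forall v, f (X v) = g (X v)) -> f =1 g.
Proof.
move=> fgC fgX; elim/polyQ_ind => // p q Hp Hq; rewrite ?rmorphD ?rmorphM /=.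
  by rewrite Hp Hq.
by rewrite Hp Hq.
Qed.

Section Homogeneous.
Variable V : gvars.
Implicit Types (p q : polyQ V) (d e : int).

Lemma homogeneousP d p :
  homogeneous d p <-> p = 0 \/ exists2 k : nat, d = k%:Z & p \is k.-homog for (@wtm V).
Proof.
split=> [hp|[->|[k -> /dhomogP hp] m /hp -> //]]; last first.
  by move=> m; rewrite msupp0.
have [->|/mlead_supp pm] := eqVneq p 0; [by left | right].
exists (wtm (mlead p)); first by rewrite hp.
by apply/dhomogP => m /hp hm; apply/eqP; rewrite -eqz_nat hm -(hp _ pm).
Qed.

Lemma homog0 d : homogeneous d (0 : polyQ V).
Proof. by apply/homogeneousP; left. Qed.

Lemma homogC c : homogeneous 0 (constQ V c).
Proof.
apply/homogeneousP; right; exists 0%N => //; rewrite /constQ /= -alg_mpolyC.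
exact/dhomogZ/dhomog1.
Qed.

Lemma homog1 : homogeneous 0 (1 : polyQ V).
Proof. by have := @homogC 1; rewrite rmorph1. Qed.

Lemma homogX (v : V) : homogeneous (wt v)%:Z (X v).
Proof.
apply/homogeneousP; right; exists (wt v) => //; rewrite dhomogX /= /wtm.
rewrite (bigD1 (enum_rank v)) //= enum_rankK mnm1E eqxx muln1 big1 ?addn0 //.
by move=> i /negPf Ni; rewrite mnm1E eq_sym Ni muln0.
Qed.

Lemma homogD d p q : homogeneous d p -> homogeneous d q -> homogeneous d (p + q).
Proof.
move=> hp hq m /msuppD_le; rewrite mem_cat => /orP[] ?; [exact: hp|exact: hq].
Qed.

Lemma homogN d p : homogeneous d p -> homogeneous d (- p).
Proof. by move=> hp m; rewrite (perm_mem (msuppN _)) => /hp. Qed.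

Lemma homogB d p q : homogeneous d p -> homogeneous d q -> homogeneous d (p - q).
Proof. by move=> hp hq; apply/homogD/homogN. Qed.

Lemma homogM d e p q :
  homogeneous d p -> homogeneous e q -> homogeneous (d + e) (p * q).
Proof.
move=> /homogeneousP[->|[k -> hp]]; first by rewrite mul0r => _; apply: homog0.
move=> /homogeneousP[->|[l -> hq]]; first by rewrite mulr0; apply: homog0.
by apply/homogeneousP; right; exists (k + l)%N => //; apply: dhomogM.
Qed.

Lemma homog_exp d p k : homogeneous d p -> homogeneous (d * k%:Z) (p ^+ k).
Proof.
move=> hp; elim: k => [|k IHk]; first by rewrite mulr0; apply: homog1.
by rewrite exprS intS mulrDr mulr1; apply: homogM.
Qed.

Lemma homog_sum (I : Type) (r : seq I) (P : pred I) (F : I -> polyQ V) d :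
  (forall i, P i -> homogeneous d (F i)) -> homogeneous d (\sum_(i <- r | P i) F i).
Proof.
move=> hF; elim/big_ind: _ => //; [exact: homog0 | exact: homogD].
Qed.

(** Homogeneous components turn elements chosen without regard to degrees into homogeneous ones. *)
Definition hproj d p : polyQ V :=
  if d is Posz k then pihomog (@wtm V) k p else 0.

Fact hproj_additive d : additive (hproj d).
Proof. by case: d => k p q /=; rewrite ?raddfB ?subr0. Qed.

HB.instance Definition _ d :=
  GRing.isAdditive.Build (polyQ V) (polyQ V) (hproj d) (hproj_additive d).

Lemma hprojP d p : homogeneous d (hproj d p).
Proof.
apply/homogeneousP; case: d => k /=; [right|by left].
by exists k => //; apply: pihomogP.
Qed.

Lemma hproj_id d p : homogeneous d p -> hproj d p = p.
Proof.
move=> /homogeneousP[->|[k -> hp]]; first by rewrite raddf0.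
exact: pihomog_dE.
Qed.

Lemma hproj_neq d e p : homogeneous d p -> d != e -> hproj e p = 0.
Proof.
move=> /homogeneousP[->|[k -> hp]]; first by rewrite raddf0.
case: e => l //= kl; apply: pihomog_ne0 hp.
by apply: contraNneq kl => ->.
Qed.

Lemma hprojM d e b p : homogeneous e b -> hproj d (b * p) = b * hproj (d - e) p.
Proof.
move=> hb; rewrite [p]mpolyE mulr_sumr !raddf_sum mulr_sumr /=.
apply: eq_bigr => m _.
have hm : homogeneous (wtm m)%:Z (p@_m *: 'X_[m] : polyQ V).
  by apply/homogeneousP; right; exists (wtm m) => //; apply/dhomogZ; rewrite dhomogX.
have [de|de] := eqVneq (e + (wtm m)%:Z) d.
  by rewrite !hproj_id // -de ?[e + _]addrC ?addrK // addrC; apply: homogM.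
rewrite (hproj_neq (homogM hb hm) de) (hproj_neq hm) ?mulr0 //.
by apply: contraNneq de => ->; rewrite addrC subrK.
Qed.

(** Taking components commutes, up to a shift of degree, with multiplication by the homogeneous [b],
    and [b] can be cancelled. *)
Lemma homog_divl d e b p : b != 0 -> homogeneous e b -> homogeneous d (b * p) ->
  homogeneous (d - e) p.
Proof.
move=> b0 hb hbp; have := hproj_id hbp.
by rewrite (hprojM _ _ hb) => /(mulfI b0) <-; apply: hprojP.
Qed.

Lemma wdegE (k : nat) p : p != 0 -> homogeneous k%:Z p -> wdeg p = k.
Proof.
move=> p0 hp; apply/eqP; rewrite -eqz_nat; apply/eqP.
rewrite -(hp _ (mlead_supp p0)).
have /homogeneousP[p00|[l kl hl]] := hp; first by rewrite p00 eqxx in p0.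
by rewrite (dhomogP _ _ _ hl _ (mlead_supp p0)) -(dhomog_uniq p0 (dhomog_msize hl) hl).
Qed.

End Homogeneous.
Arguments homog0 {V} d.
Arguments homogC {V} c.
Arguments homogX {V} v.
Arguments homog1 {V}.
Arguments hprojP {V} d p.
Arguments homogM {V d e p q}.
Arguments homogD {V d p q}.
Arguments homogN {V d p}.
Arguments homogB {V d p q}.
Arguments homog_exp {V d p}.

Lemma hproj_graded (V W : gvars) (g : {additive polyQ V -> polyQ W}) :
  (forall d p, homogeneous d p -> homogeneous d (g p)) ->
  forall d p, hproj d (g p) = g (hproj d p).
Proof.
move=> hg d p; rewrite [p]mpolyE !raddf_sum /=; apply: eq_bigr => m _.
have hm : homogeneous (wtm m)%:Z (p@_m *: 'X_[m] : polyQ V).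
  by apply/homogeneousP; right; exists (wtm m) => //; apply/dhomogZ; rewrite dhomogX.
have [<-|de] := eqVneq (wtm m)%:Z d; first by rewrite !hproj_id //; apply: hg.
by rewrite (hproj_neq (hg _ _ hm) de) (hproj_neq hm de) raddf0.
Qed.

Lemma homog_subst (V W : gvars) (phi : V -> polyQ W) d p :
  (forall v, homogeneous (wt v)%:Z (phi v)) -> homogeneous d p ->
  homogeneous d (subst phi p).
Proof.
move=> hphi hp; rewrite [p]mpolyE raddf_sum /= big_seq.
apply: homog_sum => m /hp <-; rewrite -mul_mpolyC rmorphM /= comp_mpolyC.
rewrite -[(wtm m)%:Z]add0r; apply: homogM; first exact: homogC.
rewrite comp_mpolyX /wtm (big_morph Posz PoszD (erefl _)).
elim/big_ind2: _ => [|p1 d1 p2 d2 h1 h2|i _]; first exact: homog1.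
  exact: homogM h1 h2.
by rewrite tnth_mktuple PoszM; apply/homog_exp/hphi.
Qed.

Lemma homog_rename (V W : gvars) (s : V -> W) d p :
  (forall v, wt (s v) = wt v) -> homogeneous d p -> homogeneous d (rename s p).
Proof.
move=> hs hp; apply: (homog_subst (phi := fun v => X (s v))) hp => v.
by rewrite -hs; apply: homogX.
Qed.

(** * Graded bases *)

(** The clauses of [graded_free] for [T] as a module over [R] along [iota]. This is what restriction
    of scalars, to the boundary ring or to the rationals, needs in order to keep free modules graded
    free. *)
Definition gbasis (R T : gring) (iota : R -> T) : Prop :=
  exists (K : eqType) (e : K -> T) (dg : K -> int),
    [/\ forall t, exists (s : seq K) (c : K -> R),
          t = \sum_(k <- s) iota (c k) * e k,
        forall (s : seq K) (c : K -> R), uniq s ->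
          \sum_(k <- s) iota (c k) * e k = 0 -> forall k, k \in s -> c k = 0
      & forall d t, homogeneous d t <-> exists (s : seq K) (c : K -> R),
          (forall k, homogeneous (d - dg k) (c k)) /\
          t = \sum_(k <- s) iota (c k) * e k].

(** The products of the basis of [T] over [R] with the standard basis of column vectors form a basis
    over [R]; [f] provides the coordinates over [T]. *)
Lemma graded_free_coord (R T : gring) (iota : R -> T) (M : gmod R) (r : nat)
    (dg : 'I_r -> int) (f : M -> 'cV[T]_r) (g : 'cV[T]_r -> M) :
  additive f -> cancel f g -> cancel g f ->
  (forall c v, f (c *: v) = iota c *: f v) ->
  (forall d v, mhomogeneous d v <-> forall i, homogeneous (d - dg i) (f v i 0)) ->
  gbasis iota -> graded_free M.
Proof.
move=> fA fK gK fZ fH [K [e [dgK [span indep homg]]]].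
pose F : {additive M -> 'cV[T]_r} := HB.pack f (GRing.isAdditive.Build _ _ f fA).
have fS (I : Type) (s : seq I) (G : I -> M) :
  f (\sum_(i <- s) G i) = \sum_(i <- s) f (G i) := raddf_sum F s xpredT G.
pose b (p : 'I_r * K) : M := g (\col_j (if j == p.1 then e p.2 else 0)).
have coord (s : seq ('I_r * K)) c i :
  f (\sum_(p <- s) c p *: b p) i 0
    = \sum_(k <- [seq p.2 | p <- s & p.1 == i]) iota (c (i, k)) * e k.
  rewrite fS summxE big_map big_filter [RHS]big_mkcond.
  apply: eq_bigr => -[j k] _ /=; rewrite fZ gK !mxE eq_sym /=.
  by case: eqP => [->|] //; rewrite mulr0.
(* The predicate [Q] is a condition on single coefficients: empty for spanning, a degree condition
   for the grading. *)
have comb (v : M) (Q : 'I_r -> K -> R -> Prop) :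
    (forall i, exists (s : seq K) (c : K -> R), (forall k, Q i k (c k)) /\
       f v i 0 = \sum_(k <- s) iota (c k) * e k) ->
    exists (s : seq ('I_r * K)) c, (forall p, Q p.1 p.2 (c p)) /\
       v = \sum_(p <- s) c p *: b p.
  move=> H.
  have [sf sfP] := fin_all_exists H.
  have [cf cfP] := fin_all_exists sfP.
  exists [seq (i, k) | i <- index_enum 'I_r, k <- sf i].
  exists (fun p => cf p.1 p.2); split=> [p|]; first by case: (cfP p.1).
  apply: (can_inj fK); apply/colP => i; rewrite coord.
  have [_ ->] := cfP i.
  rewrite big_map big_filter [RHS]big_mkcond big_allpairs_dep /=.
  rewrite (bigD1 i) //= [X in _ + X]big1 ?addr0 => [|j /negPf Nj].
    by apply: eq_bigr => k _; rewrite eqxx.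
  by rewrite big1 // => k _; rewrite Nj.
exists ('I_r * K)%type, b, (fun p => dg p.1 + dgK p.2); split.
- move=> v.
  have [|s [c [_ ->]]] := comb v (fun _ _ _ => True); last by exists s, c.
  by move=> i; have [s [c ->]] := span (f v i 0); exists s, c.
- move=> s c us s0 [i k] ik.
  have := coord s c i; rewrite s0 [f 0](raddf0 F) mxE => /esym/(indep _ _) -> //.
    rewrite map_inj_in_uniq ?filter_uniq // => -[i1 k1] [i2 k2].
    by rewrite !mem_filter /= => /andP[/eqP-> _] /andP[/eqP-> _] ->.
  by apply/mapP; exists (i, k); rewrite // mem_filter eqxx.
- move=> d v; rewrite fH; split=> [hv|[s [c [hc ->]]] i].
    have [|s [c [hc ->]]] :=
        comb v (fun i k c => homogeneous (d - (dg i + dgK k)) c); last first.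
      by exists s, c.
    move=> i; have /homg[s [c [hc ->]]] := hv i.
    by exists s, c; split=> // k; rewrite opprD addrA.
  apply/homg; rewrite coord.
  exists [seq p.2 | p <- s & p.1 == i], (fun k => c (i, k)); split=> // k.
  by rewrite -addrA -opprD; apply: (hc (i, k)).
Qed.

Lemma gbasis_id (V : gvars) : gbasis (@id (polyQ V)).
Proof.
exists unit, (fun=> 1), (fun=> 0); split=> [t|s c us|d t].
- by exists [:: tt], (fun=> t); rewrite big_seq1 mulr1.
- case: s us => [|[] [|[] s]] //= _.
  by rewrite big_seq1 mulr1 => c0 [].
- split=> [ht|[s [c [hc ->]]]].
    by exists [:: tt], (fun=> t); rewrite big_seq1 mulr1 subr0; split.
  by apply: homog_sum => k _; rewrite mulr1 -[d]subr0.
Qed.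

Lemma gbasis_constQ (V : gvars) : gbasis (R := ratG) (constQ V).
Proof.
exists 'X_{1..#|V|}, (fun m => 'X_[m]), (fun m => (wtm m)%:Z).
have E (s : seq 'X_{1..#|V|}) (c : 'X_{1..#|V|} -> rat) :
    \sum_(k <- s) constQ V (c k) * 'X_[k] = \sum_(k <- s) c k *: 'X_[k].
  by apply: eq_bigr => k _; rewrite mul_mpolyC.
split=> [t|s c us|d t].
- by exists (msupp t), (fun m => t@_m); rewrite E -mpolyE.
- rewrite E => s0 k ks; have := congr1 (mcoeff k) s0.
  rewrite raddf_sum mcoeff0 (bigD1_seq k) //= big1 => [|l /negPf Nl].
    by rewrite mcoeffZ mcoeffX eqxx mulr1 addr0.
  by rewrite mcoeffZ mcoeffX Nl mulr0.
- split=> [ht|[s [c [hc ->]]]].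
    exists (msupp t), (fun m => t@_m); rewrite E -mpolyE; split=> // m.
    have [/ht ->|/memN_msupp_eq0 ->] := boolP (m \in msupp t); last by left.
    by right; rewrite subrr.
  apply: homog_sum => m _; have [->|dm] := hc m.
    by rewrite raddf0 mul0r; apply: homog0.
  have -> : d = 0 + (wtm m)%:Z by rewrite -dm subrK.
  apply: (homogM (homogC _)); apply/homogeneousP; right.
  by exists (wtm m); rewrite // dhomogX.
Qed.

Section Extension.
Variables B I : gvars.

Let S : comNzRingType := polyQ B.
Let SI := mpoly #|I| S.
Let T := polyQ (gvars_sum B I).
Let vars (j : 'I_#|I|) : T := X (iv B (enum_val j)).
Let split_var (i : 'I_#|gvars_sum B I|) : SI :=
  match enum_val i with
  | inl p => (X p)%:MP
  | inr j => 'X_(enum_rank j)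
  end.
Let split_const : {rmorphism rat -> SI} :=
  @mpolyC #|I| (polyQ B) \o constQ B.
Let split_poly : {rmorphism T -> SI} :=
  mmap split_const split_var.
Let merge_poly : {rmorphism SI -> T} :=
  mmap (rename (@bv B I)) vars.

Let splitC c : split_poly (constQ _ c) = (constQ B c)%:MP.
Proof. exact: mmapC. Qed.

Let splitX v : split_poly (X v) =
  match v with inl p => (X p)%:MP | inr j => 'X_(enum_rank j) end.
Proof.
by rewrite /split_poly /= mmapX mmap1U /split_var enum_rankK.
Qed.

Let split_rename c : split_poly (rename (@bv B I) c) = c%:MP.
Proof.
apply: (polyQ_rmorph_eq (f := split_poly \o rename (@bv B I))
  (g := @mpolyC #|I| (polyQ B))) => [a|v].
  by rewrite -[LHS]/(split_poly (rename (@bv B I) (constQ B a))) renameC splitC.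
by rewrite -[LHS]/(split_poly (rename (@bv B I) (X v))) renameX splitX.
Qed.

Let split_vars m : split_poly (mmap1 vars m) = 'X_[m].
Proof.
rewrite /mmap1 rmorph_prod mpolyXE_id; apply: eq_bigr => j _.
by rewrite rmorphXn [vars j]/vars splitX /iv enum_valK.
Qed.

Let mergeC p : merge_poly p%:MP = rename (@bv B I) p.
Proof. exact: mmapC. Qed.

Let mergeX j : merge_poly 'X_j = vars j.
Proof. by rewrite /merge_poly /= mmapX mmap1U. Qed.

Let split_polyK : cancel split_poly merge_poly.
Proof.
apply: (polyQ_rmorph_eq (f := merge_poly \o split_poly) (g := idfun)) => [c|v].
  rewrite -[LHS]/(merge_poly (split_poly (constQ _ c))) splitC mergeC.
  exact: renameC.
rewrite -[LHS]/(merge_poly (split_poly (X v))) splitX.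
case: v => [p|j]; first by rewrite mergeC renameX.
by rewrite mergeX /vars enum_rankK.
Qed.

(** The basis consists of the monomials in the internal variables. A polynomial in all variables is
    rewritten by [split_poly] as one in the internal variables over Q[B]; spanning is [split_polyK],
    and independence is comparison of coefficients after [split_poly]. *)
Lemma gbasis_bv : gbasis (rename (@bv B I)).
Proof.
exists 'X_{1..#|I|}, (mmap1 vars), (fun m => (wtm m)%:Z).
have hm m : homogeneous (wtm m)%:Z (mmap1 vars m).
  rewrite /mmap1 /wtm (big_morph Posz PoszD (erefl _)).
  elim/big_ind2: _ => [|p1 d1 p2 d2 h1 h2|j _]; first exact: homog1.
    exact: homogM h1 h2.
  by rewrite PoszM; apply: homog_exp; apply: homogX.
have span t : t = \sum_(m <- msupp (split_poly t))
    rename (@bv B I) (split_poly t)@_m * mmap1 vars m.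
  by rewrite -{1}[t]split_polyK.
split=> [t|s c us s0 k ks|d t].
- by exists (msupp (split_poly t)), (fun m => (split_poly t)@_m).
- have : (split_poly (\sum_(k <- s) rename (@bv B I) (c k) * mmap1 vars k))@_k = 0.
    by rewrite s0 rmorph0 mcoeff0.
  rewrite rmorph_sum raddf_sum (bigD1_seq k) //= big1 => [|l /negPf Nl].
    rewrite rmorphM split_rename split_vars mcoeffCM mcoeffX eqxx.
    by rewrite mulr1 addr0.
  by rewrite rmorphM split_rename split_vars mcoeffCM mcoeffX Nl mulr0.
- split=> [ht|[s [c [hc ->]]]].
    exists (msupp (split_poly t)).
    (* Each coefficient is replaced by its component of the required degree, which leaves the sum
       unchanged because the sum is homogeneous. *)
    exists (fun m => hproj (d - (wtm m)%:Z) (split_poly t)@_m).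
    split=> [m|]; first exact: hprojP.
    rewrite -[LHS](hproj_id ht) {1}[t]span raddf_sum; apply: eq_bigr => m _ /=.
    rewrite mulrC (hprojM _ _ (hm m)) mulrC; congr (_ * _).
    apply: (hproj_graded (g := rename (@bv B I))) => e p hp.
    exact: (homog_rename (s := @bv B I)) hp.
  apply: homog_sum => m _; rewrite -[d](subrK (wtm m)%:Z).
  by apply: homogM (hm m); apply: homog_rename.
Qed.
End Extension.

(** * Factorizations of finite rank *)

Definition fmf_pot (V : gvars) (M : fmf V) (w : polyQ V) : Prop :=
  mx1 M *m mx0 M = w%:M /\ mx0 M *m mx1 M = w%:M.

(** Both differentials have degree [delta], relative to the degrees of the bases. For a Koszul
    factor this symmetry is the effect of the shift by half of deg b - deg a, and [delta] is half
    the degree of the potential. *)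
Definition fmf_homog (V : gvars) (M : fmf V) (delta : int) : Prop :=
  (forall i j, homogeneous (delta + dg0 j - dg1 i) (mx0 M i j)) /\
  (forall i j, homogeneous (delta + dg1 j - dg0 i) (mx1 M i j)).

Definition fmf_map (V W : gvars) (g : {rmorphism polyQ V -> polyQ W}) (M : fmf V) :
    fmf W :=
  Fmf (@dg0 V M) (@dg1 V M) (map_mx g (mx0 M)) (map_mx g (mx1 M)).

Section FmfTheory.
Variable V : gvars.
Implicit Types (M N : fmf V) (w : polyQ V).

Lemma fmf_pot_shift m M w : fmf_pot M w -> fmf_pot (M {{m}}) w.
Proof. by []. Qed.

Lemma fmf_pot_sum M N w : fmf_pot M w -> fmf_pot N w -> fmf_pot (M \oplus N) w.
Proof.
by move=> [M0 M1] [N0 N1]; split;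
  rewrite /= mulmx_block !mulmx0 !mul0mx ?add0r ?addr0 ?M0 ?M1 ?N0 ?N1 -scalar_mx_block.
Qed.

Lemma tens_scalar_mxl r s w : (w%:M : 'M[polyQ V]_r) *t (1%:M : 'M_s) = w%:M.
Proof.
apply/matrixP=> i j; case: (mxtens_indexP i) => a b; case: (mxtens_indexP j) => c d.
rewrite tensmxE !mxE (can_eq (@mxtens_indexK _ _)) xpair_eqE.
by case: eqP; case: eqP => //= _ _; rewrite ?mulr1 ?mulr0 ?mul0r.
Qed.

Lemma tens_scalar_mxr r s w : (1%:M : 'M[polyQ V]_r) *t (w%:M : 'M_s) = w%:M.
Proof.
apply/matrixP=> i j; case: (mxtens_indexP i) => a b; case: (mxtens_indexP j) => c d.
rewrite tensmxE !mxE (can_eq (@mxtens_indexK _ _)) xpair_eqE.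
by case: eqP; case: eqP => //= _ _; rewrite ?mul1r ?mulr0 ?mul0r.
Qed.

Lemma fmf_pot_tens M N w w' :
  fmf_pot M w -> fmf_pot N w' -> fmf_pot (M \boxt N) (w + w').
Proof.
move=> [M0 M1] [N0 N1]; split.
  rewrite /= mulmx_block !mulmxN !mulNmx opprK !tensmx_mul !mulmx1 !mul1mx.
  rewrite M0 M1 N0 N1 !tens_scalar_mxl !tens_scalar_mxr.
  by rewrite !addNr -!raddfD /= [w' + w]addrC -scalar_mx_block.
rewrite /= mulmx_block !mulmxN !mulNmx opprK !tensmx_mul !mulmx1 !mul1mx.
rewrite M0 M1 N0 N1 !tens_scalar_mxl !tens_scalar_mxr.
by rewrite !subrr -!raddfD /= [w' + w]addrC -scalar_mx_block.
Qed.

Lemma dg_sum_lshift r s (f : 'I_r -> int) (g : 'I_s -> int) i :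
  dg_sum f g (lshift s i) = f i.
Proof. by rewrite /dg_sum -[lshift s i]/(unsplit (inl i)) unsplitK. Qed.

Lemma dg_sum_rshift r s (f : 'I_r -> int) (g : 'I_s -> int) i :
  dg_sum f g (rshift r i) = g i.
Proof. by rewrite /dg_sum -[rshift r i]/(unsplit (inr i)) unsplitK. Qed.

Lemma dg_tensE r s (f : 'I_r -> int) (g : 'I_s -> int) i j :
  dg_tens f g (mxtens_index (i, j)) = f i + g j.
Proof. by rewrite /dg_tens mxtens_indexK. Qed.

Lemma homog_scalar_mx r (dg : 'I_r -> int) e w i j :
  homogeneous e w -> homogeneous (e + dg j - dg i) ((w%:M : 'M_r) i j).
Proof.
rewrite mxE; case: eqP => [->|_] hw; last exact: homog0.
by rewrite addrK.
Qed.

Lemma fmf_homog_shift m M delta : fmf_homog M delta -> fmf_homog (M {{m}}) delta.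
Proof.
have E (x y : int) : delta + (x + m) - (y + m) = delta + x - y.
  by rewrite addrA opprD addrACA subrr addr0.
by move=> [h0 h1]; split=> i j /=; rewrite E; [apply: h0 | apply: h1].
Qed.

Lemma fmf_homog_koszul delta k (a b : polyQ V) :
  homogeneous (delta - k) a -> homogeneous (delta + k) b ->
  fmf_homog (@Fmf V 1 1 (fun=> 0) (fun=> k) a%:M b%:M) delta.
Proof.
by move=> ha hb; split=> i j; rewrite !ord1 mxE eqxx /= ?addr0 ?subr0.
Qed.

Lemma fmf_homog_tens M N delta :
  fmf_homog M delta -> fmf_homog N delta -> fmf_homog (M \boxt N) delta.
Proof.
move=> [hM0 hM1] [hN0 hN1].
have Nmx m n (A : 'M[polyQ V]_(m, n)) i j : (- A) i j = - A i j by rewrite mxE.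
have E1 (x y z t : int) : delta + (x + z) - (y + t) = (delta + x - y) + (0 + z - t).
  by ring.
have E2 (x y z t : int) : delta + (x + z) - (y + t) = (0 + x - y) + (delta + z - t).
  by ring.
split=> i j /=.
  case: (split_ordP i) => {}i ->; case: (split_ordP j) => {}j ->;
    rewrite ?dg_sum_lshift ?dg_sum_rshift ?block_mxEul ?block_mxEur ?block_mxEdl
      ?block_mxEdr; case: (mxtens_indexP i) => a b; case: (mxtens_indexP j) => c d;
    rewrite !dg_tensE ?Nmx !tensmxE.
  - rewrite E1; apply: homogM; [exact: hM0 | exact/homog_scalar_mx/homog1].
  - apply: homogN; rewrite E2.
    by apply: homogM; [exact/homog_scalar_mx/homog1 | exact: hN1].
  - rewrite E2.
    by apply: homogM; [exact/homog_scalar_mx/homog1 | exact: hN0].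
  - rewrite E1; apply: homogM; [exact: hM1 | exact/homog_scalar_mx/homog1].
case: (split_ordP i) => {}i ->; case: (split_ordP j) => {}j ->;
  rewrite ?dg_sum_lshift ?dg_sum_rshift ?block_mxEul ?block_mxEur ?block_mxEdl
    ?block_mxEdr; case: (mxtens_indexP i) => a b; case: (mxtens_indexP j) => c d;
  rewrite !dg_tensE ?Nmx !tensmxE.
- rewrite E1; apply: homogM; [exact: hM1 | exact/homog_scalar_mx/homog1].
- rewrite E2.
  by apply: homogM; [exact/homog_scalar_mx/homog1 | exact: hN1].
- apply: homogN; rewrite E2.
  by apply: homogM; [exact/homog_scalar_mx/homog1 | exact: hN0].
- rewrite E1; apply: homogM; [exact: hM0 | exact/homog_scalar_mx/homog1].
Qed.

Lemma fmf_pot_eq M w w' : w = w' -> fmf_pot M w -> fmf_pot M w'.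
Proof. by move=> ->. Qed.

End FmfTheory.

Section FmfMap.
Variables V W : gvars.
Implicit Types (M N : fmf V) (w : polyQ V).

Lemma fmf_pot_map (g : {rmorphism polyQ V -> polyQ W}) M w :
  fmf_pot M w -> fmf_pot (fmf_map g M) (g w).
Proof. by move=> [M0 M1]; split; rewrite /= -map_mxM /= ?M0 ?M1 map_scalar_mx. Qed.

Lemma fmf_homog_map (g : {rmorphism polyQ V -> polyQ W}) M delta :
  (forall d p, homogeneous d p -> homogeneous d (g p)) ->
  fmf_homog M delta -> fmf_homog (fmf_map g M) delta.
Proof. by move=> hg [h0 h1]; split=> i j; rewrite mxE; apply: hg; [apply: h0 | apply: h1]. Qed.

Lemma fmf_map_comp U (g : {rmorphism polyQ V -> polyQ W})
    (h : {rmorphism polyQ W -> polyQ U}) M :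
  fmf_map h (fmf_map g M) = fmf_map (h \o g) M.
Proof.
by rewrite /fmf_map; congr Fmf; apply/matrixP => i j; rewrite !mxE.
Qed.

Lemma fmf_map_tens (g : {rmorphism polyQ V -> polyQ W}) M N :
  fmf_map g (M \boxt N) = fmf_map g M \boxt fmf_map g N.
Proof.
by rewrite /fmf_map /fmf_tens /= !map_block_mx !map_mxN !map_mxT !map_mx1.
Qed.

End FmfMap.

Lemma fmf_map_id V (g : {rmorphism polyQ V -> polyQ V}) M : g =1 id -> fmf_map g M = M.
Proof.
move=> gid; case: M => r0 r1 d0 d1 m0 m1; rewrite /fmf_map /=.
by congr Fmf; apply/matrixP => i j; rewrite mxE gid.
Qed.

(** The shift is an argument and not computed from the entries as in [koszul], so that it survives
    specializations, in particular those making an entry zero. *)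
Definition kos (V : gvars) (k : int) (a b : polyQ V) : fmf V :=
  @Fmf V 1 1 (fun=> 0) (fun=> k) a%:M b%:M.

(* Two-factor Koszul factorizations have ranks [1 * 1 + 1 * 1]; [j0] and [j1]
   are the two basis elements in each parity. *)
Definition j0 : 'I_(1 * 1 + 1 * 1) := lshift (1 * 1) ord0.
Definition j1 : 'I_(1 * 1 + 1 * 1) := rshift (1 * 1) ord0.

Lemma j01P (j : 'I_(1 * 1 + 1 * 1)) : j = j0 \/ j = j1.
Proof.
by case: (split_ordP j) => {}j ->; [left | right]; rewrite [j]ord1.
Qed.

Section Split.
Variable S : comNzRingType.

Definition slice r s (j : 'I_s) (v : 'cV[S]_(r * s)) : 'cV[S]_r :=
  \col_i v (mxtens_index (i, j)) 0.

Lemma sliceD r s (j : 'I_s) (u v : 'cV_(r * s)) : slice j (u + v) = slice j u + slice j v.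
Proof. by apply/colP => i; rewrite !mxE. Qed.

Lemma sliceN r s (j : 'I_s) (u : 'cV_(r * s)) : slice j (- u) = - slice j u.
Proof. by apply/colP => i; rewrite !mxE. Qed.

Lemma slice_tens r s r' s' (A : 'M[S]_(r, r')) (B : 'M[S]_(s, s')) v j :
  slice j ((A *t B) *m v) = \sum_l B j l *: (A *m slice l v).
Proof.
apply/colP => i; rewrite !mxE summxE.
under [RHS]eq_bigr do rewrite !mxE mulr_sumr.
rewrite exchange_big pair_big /=.
rewrite (reindex (@mxtens_index _ _)) /=; last first.
  by exists (@mxtens_unindex _ _) => x _; rewrite ?mxtens_indexK ?mxtens_unindexK.
apply: eq_bigr => -[k l] _; rewrite tensmxE mxE /=; ring.
Qed.

Lemma sum_j01 (U : nmodType) (F : 'I_(1 * 1 + 1 * 1) -> U) :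
  \sum_l F l = F j0 + F j1.
Proof. by rewrite big_split_ord /= !big_ord1. Qed.

Lemma slice_tens1 r r' s (A : 'M[S]_(r, r')) (v : 'cV_(r' * s)) j :
  slice j ((A *t 1%:M) *m v) = A *m slice j v.
Proof.
rewrite slice_tens (bigD1 j) //= mxE eqxx scale1r big1 ?addr0 // => l.
by rewrite mxE eq_sym => /negPf ->; rewrite scale0r.
Qed.

Lemma slice_tensK r (B : 'M[S]_(1 * 1 + 1 * 1)) (v : 'cV_(r * _)) j :
  slice j ((1%:M *t B) *m v) = B j j0 *: slice j0 v + B j j1 *: slice j1 v.
Proof. by rewrite slice_tens sum_j01 !mul1mx. Qed.

Variables r r' : nat.
Local Notation s := (1 * 1 + 1 * 1)%N.

(** The iterated cone attaches the second Koszul factor first and the first one on top of it. With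
    odd generators e1 and e2, the four components belong to 1, e2, e1 and e1 e2; the minus sign is
    the reordering e1 e2 = - e2 e1. *)
Definition tens_split (v : 'cV[S]_(r * s + r' * s)) :
    ('cV[S]_r * 'cV[S]_r') * ('cV[S]_r' * 'cV[S]_r) :=
  ((slice j0 (usubmx v), slice j1 (dsubmx v)),
   (slice j0 (dsubmx v), - slice j1 (usubmx v))).

Lemma tens_split_linear : linear tens_split.
Proof.
move=> c u v; rewrite /tens_split.
by congr (_, _, (_, _)); apply/colP => i; rewrite !mxE //=; ring.
Qed.

Let unslice q (x t : 'cV[S]_q) : 'cV[S]_(q * s) :=
  \col_k (if (mxtens_unindex k).2 == j0 then x else t) (mxtens_unindex k).1 0.

Definition tens_join (w : ('cV[S]_r * 'cV[S]_r') * ('cV[S]_r' * 'cV[S]_r)) :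
    'cV[S]_(r * s + r' * s) :=
  col_mx (unslice w.1.1 (- w.2.2)) (unslice w.2.1 w.1.2).

Let slice_unslice q (x t : 'cV[S]_q) :
  slice j0 (unslice x t) = x /\ slice j1 (unslice x t) = t.
Proof. by split; apply/colP => i; rewrite !mxE mxtens_indexK. Qed.

Let unslice_slice q (v : 'cV[S]_(q * s)) :
  unslice (slice j0 v) (slice j1 v) = v.
Proof.
apply/colP => k; rewrite mxE; case: (mxtens_indexP k) => i j.
by rewrite mxtens_indexK /=; case: (j01P j) => ->; rewrite mxE.
Qed.

Lemma tens_splitK : cancel tens_split tens_join.
Proof.
by move=> v; rewrite /tens_join /tens_split /= opprK !unslice_slice vsubmxK.
Qed.

Lemma tens_joinK : cancel tens_join tens_split.
Proof.
move=> [[x y] [z t]]; rewrite /tens_join /tens_split /= col_mxKu col_mxKd.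
have [-> ->] := slice_unslice x (- t); have [-> ->] := slice_unslice z y.
by rewrite opprK.
Qed.

Variables (D0 : 'M[S]_(r', r)) (D1 : 'M[S]_(r, r')) (K0 K1 : 'M[S]_s).
Variables (a1 b1 a2 b2 : S).
Hypotheses (HK0 : [/\ K0 j0 j0 = a1, K0 j0 j1 = - b2, K0 j1 j0 = a2 & K0 j1 j1 = b1])
  (HK1 : [/\ K1 j0 j0 = b1, K1 j0 j1 = b2, K1 j1 j0 = - a2 & K1 j1 j1 = a1]).

Lemma mul_tens_split v :
  let x := (tens_split v).1.1 in let y := (tens_split v).1.2 in
  let z := (tens_split v).2.1 in let t := (tens_split v).2.2 in
  let Dv : 'cV_(r' * s + r * s) :=
    block_mx (D0 *t 1%:M) (- (1%:M *t K1)) (1%:M *t K0) (D1 *t 1%:M) *m v in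
  [/\ slice j0 (usubmx Dv) = D0 *m x - b2 *: y - b1 *: z,
      slice j1 (dsubmx Dv) = a2 *: x + D1 *m y - b1 *: t,
      slice j0 (dsubmx Dv) = a1 *: x + (D1 *m z + b2 *: t)
    & - slice j1 (usubmx Dv) = a1 *: y + (- (a2 *: z) + D0 *m t)].
Proof.
have [E1 E2 E3 E4] := HK0; have [F1 F2 F3 F4] := HK1.
move=> x y z t; rewrite -{1}[v]vsubmxK mul_block_col mulNmx => Dv.
split; rewrite /Dv ?col_mxKu ?col_mxKd !sliceD ?sliceN slice_tens1 slice_tensK;
  rewrite ?(E1, E2, E3, E4, F1, F2, F3, F4) /x /y /z /t /= ?mulmxN ?scalerN ?opprK.
- by rewrite addrAC -addrA -opprD.
- by rewrite addrAC.
- by rewrite scaleNr addrAC addrA.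
- by rewrite scaleNr opprD opprK addrC [- _ + a1 *: _]addrC addrA.
Qed.

Lemma mul_tens_split' v :
  let x := (tens_split v).1.1 in let y := (tens_split v).1.2 in
  let z := (tens_split v).2.1 in let t := (tens_split v).2.2 in
  let Dv : 'cV_(r' * s + r * s) :=
    block_mx (D0 *t 1%:M) (1%:M *t K1) (- (1%:M *t K0)) (D1 *t 1%:M) *m v in
  [/\ slice j0 (usubmx Dv) = D0 *m x + b2 *: y + b1 *: z,
      slice j1 (dsubmx Dv) = - (a2 *: x) + D1 *m y + b1 *: t,
      slice j0 (dsubmx Dv) = - (a1 *: x) + (D1 *m z - b2 *: t)
    & - slice j1 (usubmx Dv) = - (a1 *: y) + (a2 *: z + D0 *m t)].
Proof.
have [E1 E2 E3 E4] := HK0; have [F1 F2 F3 F4] := HK1.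
move=> x y z t; rewrite -{1}[v]vsubmxK mul_block_col mulNmx => Dv.
split; rewrite /Dv ?col_mxKu ?col_mxKd !sliceD ?sliceN slice_tens1 slice_tensK;
  rewrite ?(E1, E2, E3, E4, F1, F2, F3, F4) /x /y /z /t /= ?mulmxN ?scalerN ?opprK.
- by rewrite -addrA [b1 *: _ + _]addrC.
- by rewrite opprD addrAC.
- by rewrite scaleNr opprD opprK addrAC addrA.
- by rewrite scaleNr !opprD opprK addrC [_ - _]addrC addrA.
Qed.

End Split.

Lemma homog_tens_split (V : gvars) r r' (dg : 'I_r -> int) (dg' : 'I_r' -> int)
    (m k1 k2 d : int) (e0 e1 : 'I_(1 * 1 + 1 * 1) -> int)
    (v : 'cV[polyQ V]_(r * (1 * 1 + 1 * 1) + r' * (1 * 1 + 1 * 1))) :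
  [/\ e0 j0 = m, e0 j1 = k1 + k2 + m, e1 j0 = k1 + m & e1 j1 = k2 + m] ->
  (((forall i, homogeneous (d - (dg i + m)) ((tens_split v).1.1 i 0)) /\
    (forall i, homogeneous (d - k2 - (dg' i + m)) ((tens_split v).1.2 i 0))) /\
   ((forall i, homogeneous (d - k1 - (dg' i + m)) ((tens_split v).2.1 i 0)) /\
    (forall i, homogeneous (d - k1 - k2 - (dg i + m)) ((tens_split v).2.2 i 0)))) <->
  (forall k, homogeneous (d - dg_sum (dg_tens dg e0) (dg_tens dg' e1) k) (v k 0)).
Proof.
move=> [E00 E01 E10 E11]; rewrite /tens_split /=; split.
  move=> [[H1 H2] [H3 H4]] k; case: (split_ordP k) => {}k ->;
    case: (mxtens_indexP k) => i j; rewrite ?dg_sum_lshift ?dg_sum_rshift dg_tensE;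
    case: (j01P j) => ->.
  - by have := H1 i; rewrite !mxE E00.
  - have := H4 i; rewrite !mxE E01 => /homogN; rewrite opprK.
    by congr homogeneous; ring.
  - have := H3 i; rewrite !mxE E10; by congr homogeneous; ring.
  - have := H2 i; rewrite !mxE E11; by congr homogeneous; ring.
move=> H; split; split=> i; rewrite !mxE.
- by have := H (lshift _ (mxtens_index (i, j0))); rewrite dg_sum_lshift dg_tensE E00.
- have := H (rshift _ (mxtens_index (i, j1))); rewrite dg_sum_rshift dg_tensE E11.
  by congr homogeneous; ring.
- have := H (rshift _ (mxtens_index (i, j0))); rewrite dg_sum_rshift dg_tensE E10.
  by congr homogeneous; ring.
- have := H (lshift _ (mxtens_index (i, j1))); rewrite dg_sum_lshift dg_tensE E01.
  by move=> /homogN; congr homogeneous; ring.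
Qed.

Lemma tens_scalar11 (S : comNzRingType) (a b : S) i j :
  ((a%:M : 'M_1) *t (b%:M : 'M_1)) i j = a * b.
Proof. by rewrite mxE !ord1 !mxE. Qed.

Lemma kos2_mx0 (V : gvars) k1 (a1 b1 : polyQ V) k2 a2 b2 (K := kos k1 a1 b1 \boxt kos k2 a2 b2) :
  [/\ mx0 K j0 j0 = a1, mx0 K j0 j1 = - b2, mx0 K j1 j0 = a2 & mx0 K j1 j1 = b1].
Proof.
split; rewrite /K /j0 /j1.
- by rewrite [LHS]block_mxEul tens_scalar11 mulr1.
- by rewrite [LHS]block_mxEur [LHS]mxE tens_scalar11 mul1r.
- by rewrite [LHS]block_mxEdl tens_scalar11 mul1r.
- by rewrite [LHS]block_mxEdr tens_scalar11 mulr1.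
Qed.

Lemma kos2_mx1 (V : gvars) k1 (a1 b1 : polyQ V) k2 a2 b2 (K := kos k1 a1 b1 \boxt kos k2 a2 b2) :
  [/\ mx1 K j0 j0 = b1, mx1 K j0 j1 = b2, mx1 K j1 j0 = - a2 & mx1 K j1 j1 = a1].
Proof.
split; rewrite /K /j0 /j1.
- by rewrite [LHS]block_mxEul tens_scalar11 mulr1.
- by rewrite [LHS]block_mxEur tens_scalar11 mul1r.
- by rewrite [LHS]block_mxEdl [LHS]mxE tens_scalar11 mul1r.
- by rewrite [LHS]block_mxEdr tens_scalar11 mulr1.
Qed.

Section Over.
Variables (R : gring) (V : gvars) (iota : {rmorphism R -> polyQ V}).

Definition mfo (M : fmf V) : mf R := mf_over iota (mf_of M).

Section Mul.
Variables (r : nat) (p : polyQ V).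
Let mulv (v : restrict iota 'cV[polyQ V]_r) : restrict iota 'cV[polyQ V]_r :=
  p *: (v : 'cV[polyQ V]_r).
Fact mulv_linear : linear mulv.
Proof.
move=> c u v; rewrite /mulv; apply/colP => i; rewrite !mxE; ring.
Qed.
Definition mulp : {linear restrict iota 'cV[polyQ V]_r -> restrict iota 'cV[polyQ V]_r} :=
  lin_of mulv_linear.
End Mul.

Section Mul2.
Variables (r s : nat) (p : polyQ V).
Local Notation U := (restrict iota 'cV[polyQ V]_r * restrict iota 'cV[polyQ V]_s)%type.
Let mulv2 (v : U) : U := (mulp r p v.1, mulp s p v.2).
Fact mulv2_linear : linear mulv2.
Proof. by move=> c u v; rewrite /mulv2 !linearP. Qed.
Definition mulp2 : {linear U -> U} := lin_of mulv2_linear.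
End Mul2.

Definition kcone (N : fmf V) (k : int) (a b : polyQ V) : mf R :=
  @cone R (mfo N) (mulp _ a) (mulp _ b) (mulp _ a) (mulp _ b) k.

(** The Koszul factor to be eliminated first is the outer cone. *)
Definition kcone2 (N : fmf V) (k1 : int) (a1 b1 : polyQ V)
    (k2 : int) (a2 b2 : polyQ V) : mf R :=
  @cone R (kcone N k2 a2 b2) (mulp2 _ _ a1) (mulp2 _ _ b1) (mulp2 _ _ a1)
    (mulp2 _ _ b1) k1.

Lemma heq_kcone2 (N : fmf V) m k1 a1 b1 k2 a2 b2 :
  heq (mfo (N \boxt ((kos k1 a1 b1 \boxt kos k2 a2 b2) {{m}})))
    (kcone2 (N {{m}}) k1 a1 b1 k2 a2 b2).
Proof.
set K := kos k1 a1 b1 \boxt kos k2 a2 b2.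
have dgK : [/\ @dg0 _ (K {{m}}) j0 = m, @dg0 _ (K {{m}}) j1 = k1 + k2 + m,
    @dg1 _ (K {{m}}) j0 = k1 + m & @dg1 _ (K {{m}}) j1 = k2 + m].
  by rewrite /= /j0 /j1 !dg_sum_lshift !dg_sum_rshift /dg_tens !add0r !addr0.
pose T := polyQ V.
set P := mfo _; set Q := kcone2 _ _ _ _ _ _ _.
pose f0 : mod0 P -> mod0 Q := @tens_split T (rk0 N) (rk1 N).
pose f1 : mod1 P -> mod1 Q := @tens_split T (rk1 N) (rk0 N).
pose g0 : mod0 Q -> mod0 P := @tens_join T (rk0 N) (rk1 N).
pose g1 : mod1 Q -> mod1 P := @tens_join T (rk1 N) (rk0 N).
apply: (@heq_iso R P Q f0 f1 g0 g1).
- by move=> c; exact: (tens_split_linear (iota c)).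
- by move=> c; exact: (tens_split_linear (iota c)).
- exact: tens_splitK.
- exact: tens_joinK.
- exact: tens_splitK.
- exact: tens_joinK.
- move=> d v; exact: (homog_tens_split _ _ _ _ dgK).
- move=> d v; exact: (homog_tens_split _ _ _ _ dgK).
- move=> v; have [] := mul_tens_split (mx0 N) (mx1 N) (kos2_mx0 k1 a1 b1 k2 a2 b2)
    (kos2_mx1 k1 a1 b1 k2 a2 b2) v.
  move=> H1 H2 H3 H4.
  exact: (esym (f_equal2 pair (f_equal2 pair H1 H2) (f_equal2 pair H3 H4))).
- move=> v; have [] := mul_tens_split' (mx1 N) (mx0 N) (kos2_mx0 k1 a1 b1 k2 a2 b2)
    (kos2_mx1 k1 a1 b1 k2 a2 b2) v.
  move=> H1 H2 H3 H4.
  exact: (esym (f_equal2 pair (f_equal2 pair H1 H2) (f_equal2 pair H3 H4))).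
Qed.
End Over.

(** * Elimination of variables *)

(* [polyQ V'] is the quotient of [polyQ V] by the regular element [b], split by a
   ring morphism [sec]. *)
Record elim (V V' : gvars) (ev : {rmorphism polyQ V -> polyQ V'})
    (sec : {rmorphism polyQ V' -> polyQ V}) (b : polyQ V) (beta : int) : Prop := Elim {
  elim_neq0 : b != 0;
  elim_homog : homogeneous beta b;
  elim_ev : ev b = 0;
  elim_secK : cancel sec ev;
  elim_div : forall t, exists u, t = b * u + sec (ev t);
  elim_evH : forall d t, homogeneous d t -> homogeneous d (ev t);
  elim_secH : forall d t, homogeneous d t -> homogeneous d (sec t) }.

Section ConeAlgebra.
Variables (S : comNzRingType) (r : nat) (w a b : S).
Implicit Types x z : 'cV[S]_r.

Lemma cone_algD x z : w *: x - b *: z + b *: (a *: x + z) = (w + a * b) *: x.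
Proof. by apply/colP => i; rewrite !mxE; ring. Qed.

Lemma cone_algB x z : - (a *: (z - b *: x)) + (a *: z + w *: x) = (w + a * b) *: x.
Proof. by apply/colP => i; rewrite !mxE; ring. Qed.

Lemma cone_algDB x z : w *: x + b *: z - b *: (- (a *: x) + z) = (w + a * b) *: x.
Proof. by apply/colP => i; rewrite !mxE; ring. Qed.

Lemma cone_algBD x z : a *: (z + b *: x) + (- (a *: z) + w *: x) = (w + a * b) *: x.
Proof. by apply/colP => i; rewrite !mxE; ring. Qed.

Lemma cone_scale m n (A : 'M[S]_(m, n)) (x : 'cV_n) (y : 'cV_m) :
  A *m (b *: x) + a *: (b *: y) = b *: (A *m x + a *: y).
Proof. by rewrite -scalemxAr scalerDr !scalerA mulrC. Qed.

Lemma cone_scaleN m n (A : 'M[S]_(m, n)) (x : 'cV_n) (y : 'cV_m) :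
  A *m (b *: x) - a *: (b *: y) = b *: (A *m x - a *: y).
Proof. by rewrite -scalemxAr scalerBr !scalerA mulrC. Qed.

Lemma cone_scale' m n (A : 'M[S]_(m, n)) (x : 'cV_n) (y : 'cV_m) :
  a *: (b *: y) + A *m (b *: x) = b *: (a *: y + A *m x).
Proof. by rewrite addrC cone_scale addrC. Qed.

Lemma cone_scaleN' m n (A : 'M[S]_(m, n)) (x : 'cV_n) (y : 'cV_m) :
  - (a *: (b *: y)) + A *m (b *: x) = b *: (- (a *: y) + A *m x).
Proof. by rewrite addrC cone_scaleN addrC. Qed.

End ConeAlgebra.

Lemma mulpC (R : gring) (V : gvars) (iota : {rmorphism R -> polyQ V}) r p p'
    (x : restrict iota 'cV[polyQ V]_r) :
  mulp iota r p (mulp iota r p' x) = mulp iota r p' (mulp iota r p x).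
Proof. by rewrite /= !scalerA mulrC. Qed.

Section KconeSquare.
Variables (R : gring) (V : gvars) (iota : {rmorphism R -> polyQ V}).
Variables (N : fmf V) (k : int) (a b w0 u : polyQ V).
Hypotheses (Nw : fmf_pot N w0) (uE : w0 + a * b = u).

Let mul00 (x : 'cV_(rk0 N)) : mx1 N *m (mx0 N *m x) = w0 *: x.
Proof. by rewrite mulmxA; case: Nw => -> _; rewrite mul_scalar_mx. Qed.
Let mul11 (x : 'cV_(rk1 N)) : mx0 N *m (mx1 N *m x) = w0 *: x.
Proof. by rewrite mulmxA; case: Nw => _ ->; rewrite mul_scalar_mx. Qed.

Lemma kcone_sq0 (v : mod0 (kcone iota N k a b)) :
  md1 (kcone iota N k a b) (md0 (kcone iota N k a b) v)
    = ((u *: (v.1 : 'cV_(rk0 N)), u *: (v.2 : 'cV_(rk1 N))) : mod0 (kcone iota N k a b)).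
Proof.
case: v => x y; rewrite -uE /= /cone_d0 /cone_d1 /=.
rewrite /restrict_fun /mulp /=; congr (_, _).
  rewrite mulmxBr mul00 -scalemxAr; move: (mx1 N *m y) => z.
  exact: cone_algD.
rewrite mulmxDr mul11 -scalemxAr; move: (mx0 N *m x) => z.
exact: cone_algB.
Qed.

Lemma kcone_sq1 (v : mod1 (kcone iota N k a b)) :
  md0 (kcone iota N k a b) (md1 (kcone iota N k a b) v)
    = ((u *: (v.1 : 'cV_(rk1 N)), u *: (v.2 : 'cV_(rk0 N))) : mod1 (kcone iota N k a b)).
Proof.
case: v => x y; rewrite -uE /= /cone_d0 /cone_d1 /=.
rewrite /restrict_fun /mulp /=; congr (_, _).
  rewrite mulmxDr mul11 -scalemxAr; move: (mx0 N *m y) => z.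
  exact: cone_algDB.
rewrite mulmxDr mul00 mulmxN -scalemxAr; move: (mx1 N *m x) => z.
exact: cone_algBD.
Qed.
End KconeSquare.

Section Elimination.
Variables (R : gring) (V V' : gvars).
Variables (iota : {rmorphism R -> polyQ V}) (iota' : {rmorphism R -> polyQ V'}).
Variables (ev : {rmorphism polyQ V -> polyQ V'}) (sec : {rmorphism polyQ V' -> polyQ V}).
Variables (b : polyQ V) (beta : int).
Hypothesis evb : elim ev sec b beta.
Hypotheses (evi : forall c, ev (iota c) = iota' c) (seci : forall c, sec (iota' c) = iota c).

Let q (t : polyQ V) : polyQ V :=
  epsilon (inhabits 0) (fun u => t = b * u + sec (ev t)).

Let qP t : t = b * q t + sec (ev t).
Proof. exact: (epsilon_spec (inhabits 0) _ (elim_div evb t)). Qed.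

Let bI : injective ( *%R b) := mulfI (elim_neq0 evb).

(** Since [b] can be cancelled, the quotient is determined by the remainder [sec (ev t)]. It is thus
    additive, and compatible with the scalars of [R], which [ev] and [sec] exchange. *)
Let q_lin c t t' : q (iota c * t + t') = iota c * q t + q t'.
Proof.
apply: bI; apply: (@addIr _ (sec (ev (iota c * t + t')))); rewrite -qP.
rewrite rmorphD rmorphM evi rmorphD rmorphM seci {1}[t]qP {1}[t']qP; ring.
Qed.

Let qH d t : homogeneous d t -> homogeneous (d - beta) (q t).
Proof.
move=> ht; apply: homog_divl (elim_neq0 evb) (elim_homog evb) _.
have -> : b * q t = t - sec (ev t) by rewrite {2}[t]qP addrK.
by apply: homogB => //; apply/(elim_secH evb)/(elim_evH evb).
Qed.

Section Vector.
Variable r : nat.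
Implicit Types x : restrict iota 'cV[polyQ V]_r.
Implicit Types y : restrict iota' 'cV[polyQ V']_r.

Definition evv x : restrict iota' 'cV[polyQ V']_r := map_mx ev x.
Definition secv y : restrict iota 'cV[polyQ V]_r := map_mx sec y.
Definition quov x : restrict iota 'cV[polyQ V]_r := map_mx q x.

Lemma evv_linear : linear evv.
Proof. by move=> c u v; apply/colP => i; rewrite !mxE rmorphD rmorphM /= evi. Qed.
Lemma secv_linear : linear secv.
Proof. by move=> c u v; apply/colP => i; rewrite !mxE rmorphD rmorphM /= seci. Qed.
Lemma quov_linear : linear quov.
Proof. by move=> c u v; apply/colP => i; rewrite !mxE q_lin. Qed.
Lemma evv_mul (x : 'cV_r) : evv (b *: x) = 0.
Proof. by apply/colP => i; rewrite !mxE rmorphM /= (elim_ev evb) mul0r. Qed.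
Lemma secvK : cancel secv evv.
Proof. by move=> y; apply/colP => i; rewrite !mxE (elim_secK evb). Qed.
Lemma quovP x : x = b *: (quov x : 'cV_r) + secv (evv x).
Proof. by apply/colP => i; rewrite !mxE -qP. Qed.
Lemma scalev_inj : injective ( *:%R b : 'cV[polyQ V]_r -> _).
Proof. by move=> u v uv; apply/colP => i; apply: bI; have /colP/(_ i) := uv; rewrite !mxE. Qed.
End Vector.

Variables (N : fmf V) (delta : int) (w0 : polyQ V).
Hypotheses (Nw : fmf_pot N w0) (Nh : fmf_homog N delta).
Variables (k : int) (a : polyQ V) (w : R).
Hypothesis kE : k = beta - delta.

Lemma fmf_mul_homog0 d (x : 'cV[polyQ V]_(rk0 N)) :
  (forall i, homogeneous (d - dg0 i) (x i 0)) ->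
  forall i, homogeneous (d + delta - dg1 i) ((mx0 N *m x) i 0).
Proof.
move=> hx i; rewrite mxE; apply: homog_sum => j _.
have -> : d + delta - dg1 i = (delta + dg0 j - dg1 i) + (d - dg0 j) by ring.
by apply: homogM; [case: Nh => + _; apply | apply: hx].
Qed.

Lemma fmf_mul_homog1 d (x : 'cV[polyQ V]_(rk1 N)) :
  (forall i, homogeneous (d - dg1 i) (x i 0)) ->
  forall i, homogeneous (d + delta - dg0 i) ((mx1 N *m x) i 0).
Proof.
move=> hx i; rewrite mxE; apply: homog_sum => j _.
have -> : d + delta - dg0 i = (delta + dg1 j - dg0 i) + (d - dg1 j) by ring.
by apply: homogM; [case: Nh => _; apply | apply: hx].
Qed.

Lemma kcone_elim : w0 + a * b = iota w ->
  heq (kcone iota N k a b) (mfo iota' (fmf_map ev N)).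
Proof.
move=> wE; have [N0 N1] := Nw.
have evw : ev w0 = iota' w.
  by rewrite -evi -wE rmorphD rmorphM (elim_ev evb) mulr0 addr0.
have [C0 C1] := fmf_pot_map ev Nw.
have alg r (x : 'cV[polyQ V]_r) : w0 *: x + b *: (a *: x) = iota w *: x.
  by rewrite scalerA -scalerDl [b * a]mulrC wE.
apply: (@cone_elim R (mfo iota N) _ _ _ _ k (mfo iota' (fmf_map ev N)) w delta beta
  (@evv _) (@evv _) (@secv _) (@secv _) (@quov _) (@quov _)).
- exact: evv_linear.
- exact: evv_linear.
- exact: secv_linear.
- exact: secv_linear.
- exact: quov_linear.
- exact: quov_linear.
- exact: scalev_inj.
- exact: scalev_inj.
- exact: evv_mul.
- exact: evv_mul.
- exact: secvK.
- exact: secvK.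
- exact: quovP.
- exact: quovP.
- by move=> x; exact: (esym (scalemxAr _ _ _)).
- by move=> x; exact: (esym (scalemxAr _ _ _)).
- by move=> x; exact: (mulpC a b x).
- by move=> x; exact: (mulpC a b x).
- move=> x /=; rewrite /restrict_fun /= mulmxA N0 mul_scalar_mx.
  exact: alg.
- move=> x /=; rewrite /restrict_fun /= mulmxA N1 mul_scalar_mx.
  exact: alg.
- by move=> x /=; rewrite /restrict_fun /= mulmxA C0 mul_scalar_mx evw.
- by move=> x /=; rewrite /restrict_fun /= mulmxA C1 mul_scalar_mx evw.
- by move=> x; rewrite /= /restrict_fun /evv map_mxM.
- by move=> x; rewrite /= /restrict_fun /evv map_mxM.
- exact: kE.
- by move=> d x hx i; rewrite mxE; apply/homogN/hx.
- by move=> d x hx i; rewrite mxE; apply/(elim_evH evb)/hx.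
- by move=> d x hx i; rewrite mxE; apply/(elim_evH evb)/hx.
- by move=> d x hx i; rewrite mxE; apply/(elim_secH evb)/hx.
- by move=> d x hx i; rewrite mxE; apply/(elim_secH evb)/hx.
- by move=> d x hx i; rewrite mxE addrAC; apply/qH/hx.
- by move=> d x hx i; rewrite mxE addrAC; apply/qH/hx.
- exact: fmf_mul_homog0.
- exact: fmf_mul_homog1.
Qed.

Variables (k2 : int) (a2 b2 : polyQ V).
Hypotheses (a2H : homogeneous (delta - k2) a2) (b2H : homogeneous (delta + k2) b2).

(** Here [cone_elim] is used with a cone as [E]: projection, section and division act on both
    components, and the inner Koszul factor survives with its entries specialized by [ev]. *)
Lemma kcone2_elim : w0 + a2 * b2 + a * b = iota w ->
  heq (kcone2 iota N k a b k2 a2 b2) (kcone iota' (fmf_map ev N) k2 (ev a2) (ev b2)).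
Proof.
move=> wE; have [N0 N1] := Nw.
have evw : ev w0 + ev a2 * ev b2 = iota' w.
  by rewrite -evi -wE !rmorphD !rmorphM (elim_ev evb) mulr0 addr0.
have Cw := fmf_pot_map ev Nw.
have alg r (x : 'cV[polyQ V]_r) : (w0 + a2 * b2) *: x + b *: (a *: x) = iota w *: x.
  by rewrite scalerA -scalerDl [b * a]mulrC wE.
pose E := kcone iota N k2 a2 b2.
pose C := kcone iota' (fmf_map ev N) k2 (ev a2) (ev b2).
pose p0 (x : mod0 E) : mod0 C := (evv x.1, evv x.2).
pose p1 (x : mod1 E) : mod1 C := (evv x.1, evv x.2).
pose s0 (x : mod0 C) : mod0 E := (secv x.1, secv x.2).
pose s1 (x : mod1 C) : mod1 E := (secv x.1, secv x.2).
pose q0 (x : mod0 E) : mod0 E := (quov x.1, quov x.2).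
pose q1 (x : mod1 E) : mod1 E := (quov x.1, quov x.2).
apply: (@cone_elim R E _ _ _ _ k C w delta beta p0 p1 s0 s1 q0 q1).
- by move=> c [x y] [x' y']; rewrite /p0 /= !evv_linear.
- by move=> c [x y] [x' y']; rewrite /p1 /= !evv_linear.
- by move=> c [x y] [x' y']; rewrite /s0 /= !secv_linear.
- by move=> c [x y] [x' y']; rewrite /s1 /= !secv_linear.
- by move=> c [x y] [x' y']; rewrite /q0 /= !quov_linear.
- by move=> c [x y] [x' y']; rewrite /q1 /= !quov_linear.
- by move=> [x y] [x' y'] [/scalev_inj-> /scalev_inj->].
- by move=> [x y] [x' y'] [/scalev_inj-> /scalev_inj->].
- by move=> x; rewrite /p0 !evv_mul.
- by move=> x; rewrite /p1 !evv_mul.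
- by move=> [x y]; rewrite /p0 /s0 !secvK.
- by move=> [x y]; rewrite /p1 /s1 !secvK.
- by move=> [x y]; exact: (f_equal2 pair (quovP x) (quovP y)).
- by move=> [x y]; exact: (f_equal2 pair (quovP x) (quovP y)).
- move=> [x y]; exact: (f_equal2 pair (cone_scaleN _ _ (mx0 N) x y) (cone_scale' _ _ (mx1 N) y x)).
- move=> [x y]; exact: (f_equal2 pair (cone_scale _ _ (mx1 N) x y) (cone_scaleN' _ _ (mx0 N) y x)).
- by move=> [x y]; exact: (f_equal2 pair (mulpC a b x) (mulpC a b y)).
- by move=> [x y]; exact: (f_equal2 pair (mulpC a b x) (mulpC a b y)).
- move=> v; rewrite (kcone_sq0 Nw (erefl _)); case: v => x y.
  exact: (f_equal2 pair (alg _ x) (alg _ y)).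
- move=> v; rewrite (kcone_sq1 Nw (erefl _)); case: v => x y.
  exact: (f_equal2 pair (alg _ x) (alg _ y)).
- by move=> v; rewrite (kcone_sq0 Cw evw); case: v.
- by move=> v; rewrite (kcone_sq1 Cw evw); case: v.
- move=> [x y]; refine (eq_components _ _); rewrite /= /restrict_fun /=.
    by rewrite /evv map_mxB map_mxM map_mxZ.
  by rewrite /evv map_mxD map_mxM map_mxZ.
- move=> [x y]; refine (eq_components _ _); rewrite /= /restrict_fun /=.
    by rewrite /evv map_mxD map_mxM map_mxZ.
  by rewrite /evv map_mxD map_mxM map_mxN map_mxZ.
- exact: kE.
- by move=> d [x y] [hx hy]; split=> i; rewrite mxE; apply: homogN; [apply: hx | apply: hy].
- by move=> d [x y] [hx hy]; split=> i; rewrite mxE; apply: (elim_evH evb); [apply: hx | apply: hy].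
- by move=> d [x y] [hx hy]; split=> i; rewrite mxE; apply: (elim_evH evb); [apply: hx | apply: hy].
- by move=> d [x y] [hx hy]; split=> i; rewrite mxE; apply: (elim_secH evb);
    [apply: hx | apply: hy].
- by move=> d [x y] [hx hy]; split=> i; rewrite mxE; apply: (elim_secH evb);
    [apply: hx | apply: hy].
- move=> d [x y] [hx hy]; split=> i; rewrite mxE.
    by rewrite addrAC; apply: qH; apply: hx.
  have -> z : d - beta - k2 - z = d - k2 - z - beta by ring.
  by apply: qH; apply: hy.
- move=> d [x y] [hx hy]; split=> i; rewrite mxE.
    by rewrite addrAC; apply: qH; apply: hx.
  have -> z : d - beta - k2 - z = d - k2 - z - beta by ring.
  by apply: qH; apply: hy.
- move=> d [x y] [hx hy]; split=> i /=.
    rewrite mxE; apply: homogD; first exact: fmf_mul_homog0.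
    rewrite !mxE; apply: homogN.
    have -> : d + delta - dg1 i = (delta + k2) + (d - k2 - dg1 i) by ring.
    exact: homogM b2H (hy i).
  rewrite mxE; apply: homogD.
    rewrite !mxE.
    have -> : d + delta - k2 - dg0 i = (delta - k2) + (d - dg0 i) by ring.
    exact: homogM a2H (hx i).
  by rewrite [d + delta - k2]addrAC; apply: fmf_mul_homog1.
- move=> d [x y] [hx hy]; split=> i /=.
    rewrite mxE; apply: homogD; first exact: fmf_mul_homog1.
    rewrite !mxE.
    have -> : d + delta - dg0 i = (delta + k2) + (d - k2 - dg0 i) by ring.
    exact: homogM b2H (hy i).
  rewrite mxE; apply: homogD.
    rewrite !mxE; apply: homogN.
    have -> : d + delta - k2 - dg1 i = (delta - k2) + (d - dg1 i) by ring.
    exact: homogM a2H (hx i).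
  by rewrite [d + delta - k2]addrAC; apply: fmf_mul_homog0.
Qed.

End Elimination.

(** The second element has to be suitable for elimination only after the first substitution, whence
    [ev1 b2]. *)
Lemma elim_pair (R : gring) (V V1 V2 : gvars) (iota : {rmorphism R -> polyQ V})
    (iota1 : {rmorphism R -> polyQ V1}) (iota2 : {rmorphism R -> polyQ V2})
    (ev1 : {rmorphism polyQ V -> polyQ V1}) (sec1 : {rmorphism polyQ V1 -> polyQ V})
    (ev2 : {rmorphism polyQ V1 -> polyQ V2}) (sec2 : {rmorphism polyQ V2 -> polyQ V1})
    (N : fmf V) (delta beta1 beta2 m k1 k2 : int) (w0 a1 b1 a2 b2 : polyQ V) (w : R) :
  elim ev1 sec1 b1 beta1 -> elim ev2 sec2 (ev1 b2) beta2 ->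
  (forall c, ev1 (iota c) = iota1 c) -> (forall c, sec1 (iota1 c) = iota c) ->
  (forall c, ev2 (iota1 c) = iota2 c) -> (forall c, sec2 (iota2 c) = iota1 c) ->
  fmf_pot N w0 -> fmf_homog N delta -> w0 + a1 * b1 + a2 * b2 = iota w ->
  k1 = beta1 - delta -> k2 = beta2 - delta ->
  homogeneous (delta - k2) a2 -> homogeneous (delta + k2) b2 ->
  heq (mfo iota (N \boxt ((kos k1 a1 b1 \boxt kos k2 a2 b2) {{m}})))
    (mfo iota2 (fmf_map ev2 (fmf_map ev1 (N {{m}})))).
Proof.
move=> e1 e2 evi1 seci1 evi2 seci2 Nw Nh wE k1E k2E a2H b2H.
have wE' : w0 + a2 * b2 + a1 * b1 = iota w by rewrite addrAC.
apply: heq_trans (heq_kcone2 iota N m k1 a1 b1 k2 a2 b2) _.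
apply: heq_trans (kcone2_elim e1 evi1 seci1 (N := N {{m}}) _ _ k1E a2H b2H wE') _.
- exact: Nw.
- exact: fmf_homog_shift.
apply: (kcone_elim (w := w) e2 evi2 seci2 _ _ k2E) => [||].
- exact: (fmf_pot_map ev1 (M := N {{m}}) Nw).
- by apply: (fmf_homog_map (elim_evH e1)); apply: fmf_homog_shift.
rewrite -evi1 -wE' !rmorphD !rmorphM (elim_ev e1) mulr0 addr0 //.
Qed.

Section ElimVar.
Variables (V V' : gvars) (inc : V' -> V) (phi : V -> polyQ V') (v0 : V) (b : polyQ V).
Hypotheses (wt_inc : forall v, wt (inc v) = wt v) (phi_inc : forall v, phi (inc v) = X v).
Hypotheses (phi_homog : homogeneous (wt v0)%:Z (phi v0)).
Hypotheses (v0P : forall v, v = v0 \/ exists v', v = inc v') (inc_v0 : forall v, inc v != v0).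
Hypothesis bE : b = X v0 - rename inc (phi v0) \/ b = rename inc (phi v0) - X v0.

Lemma substK_rename : cancel (rename inc) (subst phi).
Proof.
apply: (polyQ_rmorph_eq (f := subst phi \o rename inc) (g := idfun)) => [c|v].
  by rewrite -[LHS]/(subst phi (rename inc (constQ V' c))) renameC substC.
by rewrite -[LHS]/(subst phi (rename inc (X v))) renameX substX phi_inc.
Qed.

(** The substitution of x + 1 for x = [X v0] fixes every polynomial in the other variables but moves
    x. *)
Lemma var_neq_rename (g : polyQ V') : X v0 != rename inc g.
Proof.
apply/eqP => E.
pose psi v : polyQ V := if v == v0 then X v0 + 1 else X v.
have : subst psi (rename inc g) = rename inc g.
  apply: (polyQ_rmorph_eq (f := subst psi \o rename inc) (g := rename inc)) => [c|v].
    by rewrite -[LHS]/(subst psi (rename inc (constQ V' c))) renameC substC.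
  rewrite -[LHS]/(subst psi (rename inc (X v))) renameX substX /psi.
  by rewrite (negPf (inc_v0 v)).
rewrite -E substX /psi eqxx => /eqP; rewrite -subr_eq0 addrAC subrr add0r.
by rewrite oner_eq0.
Qed.

Lemma elim_var : elim (subst phi) (rename inc) b (wt v0)%:Z.
Proof.
have hX := homogX v0.
have hphi v : homogeneous (wt v)%:Z (phi v).
  have [->|[v' ->]] := v0P v; first by [].
  by rewrite phi_inc wt_inc; apply: homogX.
have hr : homogeneous (wt v0)%:Z (rename inc (phi v0)) by apply: homog_rename.
have N0 := var_neq_rename (phi v0).
split.
- by case: bE => ->; rewrite subr_eq0 // eq_sym.
- by case: bE => ->; apply: homogB.
- by case: bE => ->; rewrite rmorphB substK_rename substX subrr.
- exact: substK_rename.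
(* The polynomials congruent modulo [b] to the result of the substitution are closed under sums and
   products, so constants and variables suffice. *)
- elim/polyQ_ind => [c|v|p q [u pE] [u' qE]|p q [u pE] [u' qE]].
  + by exists 0; rewrite mulr0 add0r substC renameC.
  + have [->|[v' ->]] := v0P v; rewrite substX.
      case: bE => ->; [exists 1; rewrite mulr1 | exists (-1); rewrite mulrN1 opprB].
        by rewrite subrK.
      by rewrite subrK.
    by exists 0; rewrite mulr0 add0r phi_inc renameX.
  + by exists (u + u'); rewrite !rmorphD mulrDr addrACA -pE -qE.
  + exists (u * q + rename inc (subst phi p) * u').
    rewrite !rmorphM mulrDr [b * (rename _ _ * _)]mulrCA mulrA -addrA -mulrDr -qE.
    by rewrite -mulrDl -pE.
- by move=> d t; apply: homog_subst.
- by move=> d t; apply: homog_rename.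
Qed.
End ElimVar.

(** * Power sums and their divided differences *)

(** Newton's recursion for x^k + y^k in terms of s = x + y and t = x y, which makes sense for any s
    and t of a commutative ring. For k = n+1 this is f(s, t). *)
Fixpoint pw_rec (S : comNzRingType) (s t : S) k : S :=
  if k is k1.+1 then
    if k1 is k2.+1 then s * pw_rec s t k1 - t * pw_rec s t k2 else s
  else 2%:R.

(* Locked: conversion must not unfold power sums of polynomials. *)
HB.lock Definition pw (S : comNzRingType) (s t : S) (k : nat) : S := pw_rec s t k.

Section PowerSums.
Variable S : comNzRingType.
Implicit Types s t x y : S.

Lemma pw0 s t : pw s t 0 = 2%:R. Proof. by rewrite pw.unlock. Qed.

Lemma pw1 s t : pw s t 1 = s. Proof. by rewrite pw.unlock. Qed.

Lemma pwSS s t k : pw s t k.+2 = s * pw s t k.+1 - t * pw s t k.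
Proof. by rewrite pw.unlock. Qed.

Lemma pw_sum x y k : pw (x + y) (x * y) k = x ^+ k + y ^+ k.
Proof.
suff [] : pw (x + y) (x * y) k = x ^+ k + y ^+ k /\
          pw (x + y) (x * y) k.+1 = x ^+ k.+1 + y ^+ k.+1 by [].
elim: k => [|k [IH1 IH2]]; first by rewrite pw0 pw1 !expr0 !expr1.
by split=> //; rewrite pwSS IH1 IH2 !exprS; ring.
Qed.
End PowerSums.

Lemma pw_rmorph (S T : comNzRingType) (g : {rmorphism S -> T}) s t k :
  g (pw s t k) = pw (g s) (g t) k.
Proof.
suff [] : g (pw s t k) = pw (g s) (g t) k /\ g (pw s t k.+1) = pw (g s) (g t) k.+1 by [].
elim: k => [|k [IH1 IH2]]; first by rewrite !pw0 !pw1 rmorph_nat.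
by split=> //; rewrite !pwSS rmorphB !rmorphM IH1 IH2.
Qed.

Lemma homog_pw (V : gvars) (p q : polyQ V) k :
  homogeneous 2 p -> homogeneous 4 q -> homogeneous (2 * k)%N%:Z (pw p q k).
Proof.
move=> hp hq.
suff [] : homogeneous (2 * k)%N%:Z (pw p q k) /\
          homogeneous (2 * k.+1)%N%:Z (pw p q k.+1) by [].
elim: k => [|k [IH1 IH2]].
  rewrite pw0 pw1; split; last exact: hp.
  by have := @homogC V 2%:R; rewrite rmorph_nat.
split=> //; rewrite pwSS; apply: homogB.
  have -> : (2 * k.+2)%N%:Z = 2 + (2 * k.+1)%N%:Z by lia.
  exact: homogM.
have -> : (2 * k.+2)%N%:Z = 4 + (2 * k)%N%:Z by lia.
exact: homogM.
Qed.

(** Substitution of the elementary symmetric polynomials is injective, so the property defining [f]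
    determines it, and the recursive power sum has this property. *)
Lemma power_sum_poly (f : {mpoly rat[2]}) k :
  f \mPo [tuple 'X_ord0 + 'X_ord_max; 'X_ord0 * 'X_ord_max]
    = 'X_ord0 ^+ k + 'X_ord_max ^+ k :> {mpoly rat[2]} ->
  f = pw ('X_ord0 : {mpoly rat[2]}) 'X_ord_max k.
Proof.
move=> hf; apply: msym_fundamental_un.
set T := (X in f \mPo X); rewrite -/T.
suff -> : T = [tuple 'X_ord0 + 'X_ord_max; 'X_ord0 * 'X_ord_max].
  rewrite hf (pw_rmorph (comp_mpoly _)) /= !comp_mpolyXU /=.
  by rewrite pw_sum.
apply: eq_from_tnth => i; rewrite tnth_mktuple.
have E : ord_max = lift ord0 ord0 :> 'I_2 by apply: val_inj.
case: (unliftP ord0 i) => [j ->|->].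
  rewrite [j]ord1 -E [LHS](mesymnnE 2 rat) !big_ord_recl big_ord0 mulr1 -E.
  by rewrite E (tnth_nth 0).
by rewrite mesym1E !big_ord_recl big_ord0 addr0 -E (tnth_nth 0).
Qed.

(** The divided difference of the power sum in its first argument, obtained by differencing the
    recursion of [pw]; [dpw1_rec] is the one in the second argument. Unlike quotients, these commute
    with all ring morphisms and specialize to partial derivatives when the two arguments
    coincide. *)
Fixpoint dpw0_rec (S : comNzRingType) (s s' t : S) k : S :=
  if k is k1.+1 then
    if k1 is k2.+1 then
      pw s t k1 + s' * dpw0_rec s s' t k1 - t * dpw0_rec s s' t k2
    else 1
  else 0.

HB.lock Definition dpw0 (S : comNzRingType) (s s' t : S) (k : nat) : S :=
  dpw0_rec s s' t k.

Fixpoint dpw1_rec (S : comNzRingType) (s t t' : S) k : S :=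
  if k is k1.+1 then
    if k1 is k2.+1 then
      s * dpw1_rec s t t' k1 - pw s t k2 - t' * dpw1_rec s t t' k2
    else 0
  else 0.

HB.lock Definition dpw1 (S : comNzRingType) (s t t' : S) (k : nat) : S :=
  dpw1_rec s t t' k.

Section DividedDifferences.
Variable S : comNzRingType.
Implicit Types s t : S.

Lemma dpw00 s s' t : dpw0 s s' t 0 = 0. Proof. by rewrite dpw0.unlock. Qed.
Lemma dpw01 s s' t : dpw0 s s' t 1 = 1. Proof. by rewrite dpw0.unlock. Qed.
Lemma dpw0SS s s' t k :
  dpw0 s s' t k.+2 = pw s t k.+1 + s' * dpw0 s s' t k.+1 - t * dpw0 s s' t k.
Proof. by rewrite dpw0.unlock. Qed.

Lemma dpw10 s t t' : dpw1 s t t' 0 = 0. Proof. by rewrite dpw1.unlock. Qed.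
Lemma dpw11 s t t' : dpw1 s t t' 1 = 0. Proof. by rewrite dpw1.unlock. Qed.
Lemma dpw1SS s t t' k :
  dpw1 s t t' k.+2 = s * dpw1 s t t' k.+1 - pw s t k - t' * dpw1 s t t' k.
Proof. by rewrite dpw1.unlock. Qed.

Lemma dpw0P s s' t k : dpw0 s s' t k * (s - s') = pw s t k - pw s' t k.
Proof.
suff [] : dpw0 s s' t k * (s - s') = pw s t k - pw s' t k /\
    dpw0 s s' t k.+1 * (s - s') = pw s t k.+1 - pw s' t k.+1 by [].
elim: k => [|k [IH1 IH2]]; first by rewrite dpw00 dpw01 !pw0 !pw1 mul0r mul1r subrr.
split=> //; rewrite dpw0SS !pwSS.
transitivity (pw s t k.+1 * (s - s') + s' * (dpw0 s s' t k.+1 * (s - s'))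
  - t * (dpw0 s s' t k * (s - s'))); first by ring.
by rewrite IH1 IH2; ring.
Qed.

Lemma dpw1P s t t' k : dpw1 s t t' k * (t - t') = pw s t k - pw s t' k.
Proof.
suff [] : dpw1 s t t' k * (t - t') = pw s t k - pw s t' k /\
    dpw1 s t t' k.+1 * (t - t') = pw s t k.+1 - pw s t' k.+1 by [].
elim: k => [|k [IH1 IH2]]; first by rewrite dpw10 dpw11 !pw0 !pw1 !mul0r !subrr.
split=> //; rewrite dpw1SS !pwSS.
transitivity (s * (dpw1 s t t' k.+1 * (t - t')) - pw s t k * (t - t')
  - t' * (dpw1 s t t' k * (t - t'))); first by ring.
by rewrite IH1 IH2; ring.
Qed.
Lemma dpwP s s' t t' k :
  dpw0 s s' t k * (s - s') + dpw1 s' t t' k * (t - t') = pw s t k - pw s' t' k.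
Proof. by rewrite dpw0P dpw1P addrA subrK. Qed.
End DividedDifferences.

Lemma dpw0_rmorph (S T : comNzRingType) (g : {rmorphism S -> T}) s s' t k :
  g (dpw0 s s' t k) = dpw0 (g s) (g s') (g t) k.
Proof.
suff [] : g (dpw0 s s' t k) = dpw0 (g s) (g s') (g t) k /\
  g (dpw0 s s' t k.+1) = dpw0 (g s) (g s') (g t) k.+1 by [].
elim: k => [|k [IH1 IH2]]; first by rewrite !dpw00 !dpw01 rmorph0 rmorph1.
by split=> //; rewrite !dpw0SS rmorphB rmorphD !rmorphM IH1 IH2 pw_rmorph.
Qed.

Lemma dpw1_rmorph (S T : comNzRingType) (g : {rmorphism S -> T}) s t t' k :
  g (dpw1 s t t' k) = dpw1 (g s) (g t) (g t') k.
Proof.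
suff [] : g (dpw1 s t t' k) = dpw1 (g s) (g t) (g t') k /\
  g (dpw1 s t t' k.+1) = dpw1 (g s) (g t) (g t') k.+1 by [].
elim: k => [|k [IH1 IH2]]; first by rewrite !dpw10 !dpw11 rmorph0.
by split=> //; rewrite !dpw1SS 2!rmorphB !rmorphM IH1 IH2 pw_rmorph.
Qed.

(** * The generic double line and its specializations *)

Section GenericLine.
Variables (n : nat) (V : gvars).
Implicit Types u v z w : polyQ V.

(* All the two-factor elementary factorizations are shifts of [line u v z w], which
   is L(y1,z1;y2,z2) with (y1,y2,z1,z2) specialized to (u,v,z,w). *)
Definition line u v z w : fmf V :=
  kos (2 - n.+1%:Z) (dpw0 u v z n.+1) (u - v) \boxt
  kos (4 - n.+1%:Z) (dpw1 v z w n.+1) (z - w).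

Lemma line_pot u v z w : fmf_pot (line u v z w) (pw u z n.+1 - pw v w n.+1).
Proof.
apply: (fmf_pot_eq (dpwP u v z w n.+1)).
by apply: fmf_pot_tens; split; rewrite /= -scalar_mxM // mulrC.
Qed.

(** The quotient chosen by [pquo] is [r] because [q] is nonzero. As [r] has degree 2(n+1) - e, the
    shift is half of e - (2(n+1) - e), that is e - (n+1). Nonzero entries are what makes [wdeg]
    their degree. *)
Lemma koszulE (p q r : polyQ V) (e : nat) :
  r * q = p -> p != 0 -> homogeneous (2 * n.+1)%N%:Z p -> homogeneous e%:Z q ->
  koszul (pquo p q) q = kos (e%:Z - n.+1%:Z) r q.
Proof.
move=> rq p0 hp hq.
have q0 : q != 0 by apply: contraNneq p0 => q0; rewrite -rq q0 mulr0.
have -> : pquo p q = r.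
  apply: (mulIf q0); rewrite rq.
  by apply: (epsilon_spec (inhabits 0) (fun r => r * q = p)); exists r.
have r0 : r != 0 by apply: contraNneq p0 => r0; rewrite -rq r0 mul0r.
have hr : homogeneous ((2 * n.+1)%N%:Z - e%:Z) r.
  by apply: (homog_divl q0 hq); rewrite mulrC rq.
have [re|[k kE hk]] := (homogeneousP _ _).1 hr; first by rewrite re eqxx in r0.
rewrite kE in hr; rewrite /koszul (wdegE q0 hq) (wdegE r0 hr) /kos -kE.
congr Fmf.
have -> : e%:Z - ((2 * n.+1)%N%:Z - e%:Z) = (e%:Z - n.+1%:Z) * 2 by lia.
by rewrite mulzK.
Qed.

(** The degree results from dividing the homogeneous identity [dpw0P] by u - v, whence [u != v]; on
    the diagonal it will be obtained by specialization. *)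
Lemma homog_dpw0 k u v z : u != v ->
  homogeneous 2 u -> homogeneous 2 v -> homogeneous 4 z ->
  homogeneous ((2 * k)%N%:Z - 2) (dpw0 u v z k).
Proof.
move=> uv hu hv hz.
apply: (@homog_divl _ _ _ (u - v)); [by rewrite subr_eq0 | exact: homogB |].
have := homogB (homog_pw (k := k) hu hz) (homog_pw (k := k) hv hz).
by rewrite -(dpw0P u v z k) mulrC.
Qed.

Lemma homog_dpw1 k v z w : z != w ->
  homogeneous 2 v -> homogeneous 4 z -> homogeneous 4 w ->
  homogeneous ((2 * k)%N%:Z - 4) (dpw1 v z w k).
Proof.
move=> zw hv hz hw.
apply: (@homog_divl _ _ _ (z - w)); [by rewrite subr_eq0 | exact: homogB |].
have := homogB (homog_pw (k := k) hv hz) (homog_pw (k := k) hv hw).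
by rewrite -(dpw1P v z w k) mulrC.
Qed.

Lemma line_homog u v z w :
  u != v -> z != w -> homogeneous 2 u -> homogeneous 2 v ->
  homogeneous 4 z -> homogeneous 4 w -> fmf_homog (line u v z w) n.+1%:Z.
Proof.
move=> uv zw hu hv hz hw; apply: fmf_homog_tens; apply: fmf_homog_koszul.
- have -> : n.+1%:Z - (2 - n.+1%:Z) = (2 * n.+1)%N%:Z - 2 by lia.
  exact: homog_dpw0.
- by rewrite addrC subrK; apply: homogB.
- have -> : n.+1%:Z - (4 - n.+1%:Z) = (2 * n.+1)%N%:Z - 4 by lia.
  exact: homog_dpw1.
- by rewrite addrC subrK; apply: homogB.
Qed.

Definition point (p : V -> rat) : {rmorphism polyQ V -> rat} :=
  meval (fun i => p (enum_val i)).

Lemma pointX p (x : V) : point p (X x) = p x.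
Proof. by rewrite /point /X /= mevalXU enum_rankK. Qed.

Hypothesis n_ge : (1 <= n)%N.
Variable f : {mpoly rat[2]}.
Hypothesis fE : f = pw ('X_ord0 : {mpoly rat[2]}) 'X_ord_max n.+1.

Lemma fevalE (p q : polyQ V) : feval f p q = pw p q n.+1.
Proof.
by rewrite /feval fE (pw_rmorph (comp_mpoly _)) /= !comp_mpolyXU.
Qed.

Let pw10 : pw 1 0 n.+1 = 1 :> rat.
Proof. by have := @pw_sum rat 1 0 n.+1; rewrite addr0 mulr0 expr1n expr0n addr0. Qed.

Let pw00 : pw 0 0 n.+1 = 0 :> rat.
Proof. by have := @pw_sum rat 0 0 n.+1; rewrite addr0 mulr0 expr0n addr0. Qed.

(** The roots with sum 1 and product -2 are 2 and -1, so the value is 2^(n+1) + (-1)^(n+1), which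
    differs from 1 once n is positive. *)
Let pw12 : pw 1 (-2%:R) n.+1 != 1 :> rat.
Proof.
have := @pw_sum rat 2%:R (-1) n.+1.
rewrite mulrN1; have -> : 2%:R - 1 = 1 :> rat by [].
move=> ->; rewrite -signr_odd -natrX; case: (odd _).
  rewrite expr1 subr_eq -[1 + 1]/(2%:R) Num.Theory.eqr_nat -{2}[2%N]expn1 eqn_exp2l //.
  by rewrite eqSS -lt0n.
by rewrite expr0 -subr_eq0 addrK Num.Theory.pnatr_eq0 expn_eq0.
Qed.

(** The rational points [e1] and [e2] show that the two numerators are nonzero: f is 1 at (1, 0) and
    0 at (0, 0), and it differs at (1, -2) and (1, 0). *)
Lemma lineE u v z w (e1 e2 : {rmorphism polyQ V -> rat}) :
  [/\ e1 u = 1, e1 v = 0 & e1 z = 0] -> [/\ e2 v = 1, e2 z = -2%:R & e2 w = 0] ->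
  homogeneous 2 u -> homogeneous 2 v -> homogeneous 4 z -> homogeneous 4 w ->
  koszul (pquo (feval f u z - feval f v z) (u - v)) (u - v) \boxt
  koszul (pquo (feval f v z - feval f v w) (z - w)) (z - w) = line u v z w.
Proof.
move=> [e1u e1v e1z] [e2v e2z e2w] hu hv hz hw.
have huz := homog_pw (k := n.+1) hu hz; have hvz := homog_pw (k := n.+1) hv hz.
have hvw := homog_pw (k := n.+1) hv hw.
rewrite !fevalE /line.
apply: (f_equal2 (@fmf_tens V)).
  apply: (koszulE (dpw0P u v z n.+1) _ (homogB huz hvz) (homogB hu hv)).
  apply/eqP => /subr0_eq/(congr1 e1)/eqP.
  rewrite (pw_rmorph e1 u z n.+1) (pw_rmorph e1 v z n.+1) e1u e1v e1z.
  by rewrite pw10 pw00 oner_eq0.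
apply: (koszulE (dpw1P v z w n.+1) _ (homogB hvz hvw) (homogB hz hw)).
apply: contraNneq pw12 => /subr0_eq/(congr1 e2).
rewrite (pw_rmorph e2 v z n.+1) (pw_rmorph e2 v w n.+1) e2v e2z e2w.
by rewrite pw10 => ->.
Qed.

Lemma line_neq u v z w (e1 e2 : {rmorphism polyQ V -> rat}) :
  [/\ e1 u = 1, e1 v = 0 & e1 z = 0] -> [/\ e2 v = 1, e2 z = -2%:R & e2 w = 0] ->
  u != v /\ z != w.
Proof.
move=> [e1u e1v _] [_ e2z e2w]; split; apply/eqP.
  by move=> /(congr1 e1)/eqP; rewrite e1u e1v oner_eq0.
by move=> /(congr1 e2)/eqP; rewrite e2z e2w.
Qed.
End GenericLine.

Lemma line_map n (V W : gvars) (g : {rmorphism polyQ V -> polyQ W}) u v z w :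
  fmf_map g (line n u v z w) = line n (g u) (g v) (g z) (g w).
Proof.
rewrite /line fmf_map_tens /fmf_map /kos /= !map_scalar_mx.
rewrite (dpw0_rmorph g u v z n.+1) (dpw1_rmorph g v z w n.+1).
by rewrite (rmorphB g u v) (rmorphB g z w).
Qed.

Lemma graded_free_mf_of (V : gvars) r (dg : 'I_r -> int) : graded_free (free_gmod V dg).
Proof.
apply: (@graded_free_coord (polyQ V) (polyQ V) id (free_gmod V dg) r dg id id) => //.
exact: gbasis_id.
Qed.

Lemma graded_free_over (R : gring) (V : gvars) (iota : {rmorphism R -> polyQ V}) r
    (dg : 'I_r -> int) :
  gbasis iota -> graded_free (gmod_over iota (free_gmod V dg)).
Proof.
move=> B.
by apply: (@graded_free_coord R (polyQ V) iota (gmod_over iota (free_gmod V dg)) r dg id id).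
Qed.

Lemma is_mf_mf_of (V : gvars) (M : fmf V) w : fmf_pot M w -> is_mf w (mf_of M).
Proof.
move=> [M0 M1]; split; try exact: graded_free_mf_of.
- by move=> v; rewrite /= mulmxA M0 mul_scalar_mx.
- by move=> v; rewrite /= mulmxA M1 mul_scalar_mx.
Qed.

Lemma is_mf_mfo (R : gring) (V : gvars) (iota : {rmorphism R -> polyQ V})
    (M : fmf V) w :
  gbasis iota -> fmf_pot M (iota w) -> is_mf w (mfo iota M).
Proof.
move=> B [M0 M1]; split; try exact: graded_free_over.
- by move=> v; rewrite /= /restrict_fun /= mulmxA M0 mul_scalar_mx.
- by move=> v; rewrite /= /restrict_fun /= mulmxA M1 mul_scalar_mx.
Qed.

Section Elementary.
Variables (n : nat) (f : {mpoly rat[2]}) (V : gvars).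
Hypothesis n_ge : (1 <= n)%N.
Hypothesis fE : f = pw ('X_ord0 : {mpoly rat[2]}) 'X_ord_max n.+1.

(* The degrees [wdeg] of the divided differences are meaningful because the latter are
   nonzero, which is seen by evaluation at rational points. *)
Let ev (s : seq (V * rat)) : {rmorphism polyQ V -> rat} :=
  point (fun v => nth 0 (unzip2 s) (index v (unzip1 s))).

Let uniq4_neq (a b c d : V) : uniq [:: a; b; c; d] ->
  (((a == b) = false) * ((a == c) = false) * ((a == d) = false)
   * ((b == a) = false) * ((b == c) = false) * ((b == d) = false)
   * ((c == a) = false) * ((c == b) = false) * ((c == d) = false)
   * ((d == a) = false) * ((d == b) = false) * ((d == c) = false))%type.
Proof.
rewrite /= !inE !negb_or => /and4P[/and3P[/negPf n1 /negPf n2 /negPf n3]].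
by move=> /andP[/negPf n4 /negPf n5] /negPf n6 _; do !split=> //; rewrite eq_sym.
Qed.

Let homogXX (x1 x2 : V) : wt x1 = 2%N -> wt x2 = 2%N ->
  homogeneous 2 (X x1 + X x2) /\ homogeneous 4 (X x1 * X x2).
Proof.
move=> w1 w2; have := homogX x1; have := homogX x2; rewrite w1 w2 => h2 h1.
by split; [apply: homogD | apply: homogM h1 h2].
Qed.

Let homogXw (x : V) k : wt x = k -> homogeneous k%:Z (X x).
Proof. by move=> <-; apply: homogX. Qed.

Lemma mfL_line (y1 z1 y2 z2 : V) :
  uniq [:: y1; z1; y2; z2] -> wt y1 = 2%N -> wt z1 = 4%N -> wt y2 = 2%N -> wt z2 = 4%N ->
  mfL f y1 z1 y2 z2 = line n (X y1) (X y2) (X z1) (X z2) /\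
  X y1 != X y2 /\ X z1 != X z2.
Proof.
move=> /uniq4_neq NE w1 w2 w3 w4.
have H1 : [/\ ev [:: (y1, 1); (y2, 0); (z1, 0)] (X y1) = 1,
   ev [:: (y1, 1); (y2, 0); (z1, 0)] (X y2) = 0 &
   ev [:: (y1, 1); (y2, 0); (z1, 0)] (X z1) = 0].
  by rewrite /ev !pointX /= !eqxx !NE.
have H2 : [/\ ev [:: (y2, 1); (z1, -2%:R); (z2, 0)] (X y2) = 1,
   ev [:: (y2, 1); (z1, -2%:R); (z2, 0)] (X z1) = -2%:R &
   ev [:: (y2, 1); (z1, -2%:R); (z2, 0)] (X z2) = 0].
  by rewrite /ev !pointX /= !eqxx !NE.
split; last exact: line_neq H1 H2.
exact: (lineE n_ge fE H1 H2 (homogXw w1) (homogXw w3) (homogXw w2) (homogXw w4)).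
Qed.

Lemma mfVin_line (y3 z3 x1 x2 : V) :
  uniq [:: y3; z3; x1; x2] -> wt y3 = 2%N -> wt z3 = 4%N -> wt x1 = 2%N -> wt x2 = 2%N ->
  mfVin f y3 z3 x1 x2 = line n (X y3) (X x1 + X x2) (X z3) (X x1 * X x2) /\
  X y3 != X x1 + X x2 /\ X z3 != X x1 * X x2.
Proof.
move=> /uniq4_neq NE w1 w2 w3 w4.
pose e1 := ev [:: (y3, 1); (x1, 0); (x2, 0); (z3, 0)].
pose e2 := ev [:: (x1, 1); (x2, 0); (z3, -2%:R)].
have H1 : [/\ e1 (X y3) = 1, e1 (X x1 + X x2) = 0 & e1 (X z3) = 0].
  by rewrite (rmorphD e1 (X x1) (X x2)) /e1 /ev !pointX /= !eqxx !NE.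
have H2 : [/\ e2 (X x1 + X x2) = 1, e2 (X z3) = -2%:R & e2 (X x1 * X x2) = 0].
  rewrite (rmorphD e2 (X x1) (X x2)) (rmorphM e2 (X x1) (X x2)).
  by rewrite /e2 /ev !pointX /= !eqxx !NE.
split; last exact: line_neq H1 H2.
have [hD hM] := homogXX w3 w4.
have := lineE n_ge fE H1 H2 (homogXw w1) hD (homogXw w2) hM.
have <- // : X y3 - X x1 - X x2 = X y3 - (X x1 + X x2).
by rewrite -addrA opprD.
Qed.

Lemma mfVout_line (x1 x2 y3 z3 : V) :
  uniq [:: x1; x2; y3; z3] -> wt x1 = 2%N -> wt x2 = 2%N -> wt y3 = 2%N -> wt z3 = 4%N ->
  mfVout f x1 x2 y3 z3 = line n (X x1 + X x2) (X y3) (X x1 * X x2) (X z3) {{-1}} /\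
  X x1 + X x2 != X y3 /\ X x1 * X x2 != X z3.
Proof.
move=> /uniq4_neq NE w1 w2 w3 w4.
pose e1 := ev [:: (x1, 1); (x2, 0); (y3, 0)].
pose e2 := ev [:: (y3, 1); (x1, 1); (x2, -2%:R); (z3, 0)].
have H1 : [/\ e1 (X x1 + X x2) = 1, e1 (X y3) = 0 & e1 (X x1 * X x2) = 0].
  rewrite (rmorphD e1 (X x1) (X x2)) (rmorphM e1 (X x1) (X x2)).
  by rewrite /e1 /ev !pointX /= !eqxx !NE.
have H2 : [/\ e2 (X y3) = 1, e2 (X x1 * X x2) = -2%:R & e2 (X z3) = 0].
  by rewrite (rmorphM e2 (X x1) (X x2)) /e2 /ev !pointX /= !eqxx !NE.
split; last exact: line_neq H1 H2.
have [hD hM] := homogXX w1 w2.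
exact: (f_equal (fmf_shift (-1)) (lineE n_ge fE H1 H2 hD (homogXw w3) hM (homogXw w4))).
Qed.

Lemma mfW_line (x1 x2 x3 x4 : V) :
  uniq [:: x1; x2; x3; x4] -> wt x1 = 2%N -> wt x2 = 2%N -> wt x3 = 2%N -> wt x4 = 2%N ->
  mfW f x1 x2 x3 x4
    = line n (X x1 + X x2) (X x3 + X x4) (X x1 * X x2) (X x3 * X x4) {{-1}} /\
  X x1 + X x2 != X x3 + X x4 /\ X x1 * X x2 != X x3 * X x4.
Proof.
move=> /uniq4_neq NE w1 w2 w3 w4.
pose e1 := ev [:: (x1, 1); (x2, 0); (x3, 0); (x4, 0)].
pose e2 := ev [:: (x3, 1); (x4, 0); (x1, 1); (x2, -2%:R)].
have H1 : [/\ e1 (X x1 + X x2) = 1, e1 (X x3 + X x4) = 0 & e1 (X x1 * X x2) = 0].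
  rewrite (rmorphD e1 (X x1) (X x2)) (rmorphM e1 (X x1) (X x2)) (rmorphD e1 (X x3) (X x4)).
  by rewrite /e1 /ev !pointX /= !eqxx !NE.
have H2 : [/\ e2 (X x3 + X x4) = 1, e2 (X x1 * X x2) = -2%:R & e2 (X x3 * X x4) = 0].
  rewrite (rmorphM e2 (X x1) (X x2)) (rmorphM e2 (X x3) (X x4)) (rmorphD e2 (X x3) (X x4)).
  by rewrite /e2 /ev !pointX /= !eqxx !NE.
split; last exact: line_neq H1 H2.
have [hD hM] := homogXX w1 w2; have [hD' hM'] := homogXX w3 w4.
have := f_equal (fmf_shift (-1)) (lineE n_ge fE H1 H2 hD hD' hM hM').
have <- // : X x1 + X x2 - X x3 - X x4 = X x1 + X x2 - (X x3 + X x4).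
by rewrite -addrA opprD.
Qed.
End Elementary.

(** * Factorizations of diagrams *)

Section PotentialAt.
Variables (n : nat) (S : comNzRingType).

(* The potential of a diagram, its boundary parameters being given values in [S]. *)
Definition pot_at a b c d (s : bvars a b c d -> S) : S :=
  (\sum_(i < a) s (xout i) ^+ n.+1
    + \sum_(i < c) pw (s (dout i yvar)) (s (dout i zvar)) n.+1)
  - (\sum_(i < b) s (xin i) ^+ n.+1
    + \sum_(i < d) pw (s (din i yvar)) (s (din i zvar)) n.+1).

Lemma pot_at_union a b c d a' b' c' d' (s : bvars (a + a') (b + b') (c + c') (d + d') -> S) :
  pot_at (fun p : bvars a b c d => s (union_l a' b' c' d' p)) +
  pot_at (fun p : bvars a' b' c' d' => s (union_r a b c d p)) = pot_at s.
Proof.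
rewrite /pot_at !big_split_ord /=.
set A := \sum_(i < a) _; set B := \sum_(i < b) _; set C := \sum_(i < c) _.
set D := \sum_(i < d) _; set A' := \sum_(i < a') _; set B' := \sum_(i < b') _.
set C' := \sum_(i < c') _; set D' := \sum_(i < d') _.
by move: A B C D A' B' C' D' => A B C D A' B' C' D'; ring.
Qed.

(** The two glued end points have equal values and enter the potential with opposite signs. *)
Lemma pot_at_glue_single a b c d (s : bvars a.+1 b.+1 c d -> S) (s' : bvars a b c d -> S) o i :
  s (xout o) = s (xin i) ->
  (forall k, s (xout (lift o k)) = s' (xout k)) ->
  (forall k, s (xin (lift i k)) = s' (xin k)) ->
  (forall k e, s (dout k e) = s' (dout k e)) ->
  (forall k e, s (din k e) = s' (din k e)) -> pot_at s = pot_at s'.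
Proof.
move=> E E1 E2 E3 E4; rewrite /pot_at [\sum_(k < a.+1) _](bigD1_ord o) //=.
rewrite [\sum_(k < b.+1) _](bigD1_ord i) //= E.
under eq_bigr do rewrite E1; under [\sum_(k < c) _]eq_bigr do rewrite !E3.
under [\sum_(k < b) _]eq_bigr do rewrite E2.
under [\sum_(k < d) _]eq_bigr do rewrite !E4.
by ring.
Qed.

Lemma pot_at_glue_double a b c d (s : bvars a b c.+1 d.+1 -> S) (s' : bvars a b c d -> S) o i :
  (forall e, s (dout o e) = s (din i e)) ->
  (forall k, s (xout k) = s' (xout k)) -> (forall k, s (xin k) = s' (xin k)) ->
  (forall k e, s (dout (lift o k) e) = s' (dout k e)) ->
  (forall k e, s (din (lift i k) e) = s' (din k e)) -> pot_at s = pot_at s'.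
Proof.
move=> E E1 E2 E3 E4; rewrite /pot_at [\sum_(k < c.+1) _](bigD1_ord o) //=.
rewrite [\sum_(k < d.+1) _](bigD1_ord i) //= !E.
under eq_bigr do rewrite E1; under [\sum_(k < c) _]eq_bigr do rewrite !E3.
under [\sum_(k < b) _]eq_bigr do rewrite E2.
under [\sum_(k < d) _]eq_bigr do rewrite !E4.
by ring.
Qed.

(** Only the term of [o] changes, and the change is the potential of a double line glued to that end
    point. *)
Lemma pot_at_dout a b c d (s s' : bvars a b c d -> S) o :
  (forall i, s (xout i) = s' (xout i)) -> (forall i, s (xin i) = s' (xin i)) ->
  (forall i e, i != o -> s (dout i e) = s' (dout i e)) ->
  (forall i e, s (din i e) = s' (din i e)) ->
  pot_at s + (pw (s' (dout o yvar)) (s' (dout o zvar)) n.+1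
    - pw (s (dout o yvar)) (s (dout o zvar)) n.+1) = pot_at s'.
Proof.
move=> E1 E2 E3 E4; rewrite /pot_at.
have -> : \sum_(i < a) s (xout i) ^+ n.+1 = \sum_(i < a) s' (xout i) ^+ n.+1.
  by apply: eq_bigr => i _; rewrite E1.
have -> : \sum_(i < b) s (xin i) ^+ n.+1 = \sum_(i < b) s' (xin i) ^+ n.+1.
  by apply: eq_bigr => i _; rewrite E2.
have -> : \sum_(i < d) pw (s (din i yvar)) (s (din i zvar)) n.+1 =
    \sum_(i < d) pw (s' (din i yvar)) (s' (din i zvar)) n.+1.
  by apply: eq_bigr => i _; rewrite !E4.
rewrite (bigD1 o) //= [\sum_(i < c) _ in RHS](bigD1 o) //=.
have -> : \sum_(i < c | i != o) pw (s (dout i yvar)) (s (dout i zvar)) n.+1 =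
    \sum_(i < c | i != o) pw (s' (dout i yvar)) (s' (dout i zvar)) n.+1.
  by apply: eq_bigr => i Ni; rewrite !E3.
by ring.
Qed.

Lemma pot_at_din a b c d (s s' : bvars a b c d -> S) o :
  (forall i, s (xout i) = s' (xout i)) -> (forall i, s (xin i) = s' (xin i)) ->
  (forall i e, s (dout i e) = s' (dout i e)) ->
  (forall i e, i != o -> s (din i e) = s' (din i e)) ->
  pot_at s + (pw (s (din o yvar)) (s (din o zvar)) n.+1
    - pw (s' (din o yvar)) (s' (din o zvar)) n.+1) = pot_at s'.
Proof.
move=> E1 E2 E3 E4; rewrite /pot_at.
have -> : \sum_(i < a) s (xout i) ^+ n.+1 = \sum_(i < a) s' (xout i) ^+ n.+1.
  by apply: eq_bigr => i _; rewrite E1.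
have -> : \sum_(i < b) s (xin i) ^+ n.+1 = \sum_(i < b) s' (xin i) ^+ n.+1.
  by apply: eq_bigr => i _; rewrite E2.
have -> : \sum_(i < c) pw (s (dout i yvar)) (s (dout i zvar)) n.+1 =
    \sum_(i < c) pw (s' (dout i yvar)) (s' (dout i zvar)) n.+1.
  by apply: eq_bigr => i _; rewrite !E3.
rewrite [\sum_(i < d) _](bigD1 o) //= [\sum_(i < d) _ in RHS](bigD1 o) //=.
have -> : \sum_(i < d | i != o) pw (s (din i yvar)) (s (din i zvar)) n.+1 =
    \sum_(i < d | i != o) pw (s' (din i yvar)) (s' (din i zvar)) n.+1.
  by apply: eq_bigr => i Ni; rewrite !E4.
by ring.
Qed.

Lemma eq_pot_at a b c d (s s' : bvars a b c d -> S) : s =1 s' -> pot_at s = pot_at s'.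
Proof.
move=> E; rewrite /pot_at.
by congr (_ + _ - (_ + _)); apply: eq_bigr => i _; rewrite !E.
Qed.
End PotentialAt.

Lemma pot_at_rmorph n (S T : comNzRingType) (g : {rmorphism S -> T}) a b c d
    (s : bvars a b c d -> S) :
  g (pot_at n s) = pot_at n (fun p => g (s p)).
Proof.
rewrite /pot_at rmorphB !rmorphD !rmorph_sum.
congr (_ + _ - (_ + _)); apply: eq_bigr => i _; by rewrite ?rmorphXn // pw_rmorph.
Qed.

Section PotentialElementary.
Variables (n : nat) (S : comNzRingType).

Lemma pot_at_single (s : bvars 1 1 0 0 -> S) :
  pot_at n s = s (xout ord0) ^+ n.+1 - s (xin ord0) ^+ n.+1.
Proof. by rewrite /pot_at !big_ord1 !big_ord0 !addr0. Qed.

Lemma pot_at_double (s : bvars 0 0 1 1 -> S) :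
  pot_at n s = pw (s (dout ord0 yvar)) (s (dout ord0 zvar)) n.+1
    - pw (s (din ord0 yvar)) (s (din ord0 zvar)) n.+1.
Proof. by rewrite /pot_at !big_ord1 !big_ord0 !add0r. Qed.

Let ord_max2 : ord_max = lift ord0 ord0 :> 'I_2.
Proof. exact: val_inj. Qed.

Lemma pot_at_triin (s : bvars 0 2 1 0 -> S) :
  pot_at n s = pw (s (dout ord0 yvar)) (s (dout ord0 zvar)) n.+1
    - pw (s (xin ord0) + s (xin ord_max)) (s (xin ord0) * s (xin ord_max)) n.+1.
Proof.
rewrite /pot_at !big_ord1 !big_ord0 big_ord_recl big_ord1 !add0r addr0.
by rewrite pw_sum -ord_max2.
Qed.

Lemma pot_at_triout (s : bvars 2 0 0 1 -> S) :
  pot_at n s =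
    pw (s (xout ord0) + s (xout ord_max)) (s (xout ord0) * s (xout ord_max)) n.+1
    - pw (s (din ord0 yvar)) (s (din ord0 zvar)) n.+1.
Proof.
rewrite /pot_at !big_ord1 !big_ord0 big_ord_recl big_ord1 !add0r addr0.
by rewrite pw_sum -ord_max2.
Qed.

Lemma pot_at_four (s : bvars 2 2 0 0 -> S) :
  pot_at n s =
    pw (s (xout ord0) + s (xout ord_max)) (s (xout ord0) * s (xout ord_max)) n.+1
    - pw (s (xin ord0) + s (xin ord_max)) (s (xin ord0) * s (xin ord_max)) n.+1.
Proof.
by rewrite /pot_at !big_ord0 !big_ord_recl !big_ord0 !addr0 !pw_sum -ord_max2.
Qed.
End PotentialElementary.

Section Cfac.
Variables (n : nat) (f : {mpoly rat[2]}).
Hypothesis n_ge : (1 <= n)%N.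
Hypothesis fE : f = pw ('X_ord0 : {mpoly rat[2]}) 'X_ord_max n.+1.

Lemma mfS_pot_homog (V : gvars) (x1 x2 : V) :
  x1 != x2 -> wt x1 = 2%N -> wt x2 = 2%N ->
  fmf_pot (mfS n x1 x2) (X x1 ^+ n.+1 - X x2 ^+ n.+1) /\
  fmf_homog (mfS n x1 x2) n.+1%:Z.
Proof.
move=> n12 w1 w2.
have h1 := homogX x1; have h2 := homogX x2; rewrite w1 in h1; rewrite w2 in h2.
have hp : homogeneous (2 * n.+1)%N%:Z (X x1 ^+ n.+1 - X x2 ^+ n.+1).
  by rewrite PoszM; apply: homogB; apply: homog_exp.
pose r := \sum_(i < n.+1) X x1 ^+ (n - i) * X x2 ^+ i.
have rE : r * (X x1 - X x2) = X x1 ^+ n.+1 - X x2 ^+ n.+1.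
  by rewrite mulrC -(subrXX (X x1) (X x2) n.+1).
have p0 : X x1 ^+ n.+1 - X x2 ^+ n.+1 != 0.
  pose e := point (fun v : V => if v == x1 then 1 else 0).
  apply/eqP => /subr0_eq/(congr1 e) E.
  have := etrans (esym (rmorphXn e n.+1 (X x1))) (etrans E (rmorphXn e n.+1 (X x2))).
  rewrite /e !pointX eqxx eq_sym (negPf n12) expr1n expr0n => /eqP.
  by rewrite oner_eq0.
rewrite /mfS (koszulE rE p0 hp (homogB h1 h2)); split.
  by rewrite -rE; split; rewrite /= -scalar_mxM // mulrC.
apply: fmf_homog_koszul.
  have -> : n.+1%:Z - (2 - n.+1%:Z) = (2 * n.+1)%N%:Z - 2 by lia.
  apply: (homog_divl _ (homogB h1 h2)); last by rewrite mulrC rE.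
  by apply: contraNneq p0 => q0; rewrite -rE q0 mulr0.
by rewrite addrC subrK; apply: homogB.
Qed.

Lemma wt_union_l a b c d a' b' c' d' (p : bvars a b c d) :
  wt (union_l a' b' c' d' p) = wt p.
Proof. by case: p => [[]|[[]|[]]]. Qed.

Lemma wt_union_r a b c d a' b' c' d' (p : bvars a' b' c' d') :
  wt (union_r a b c d p) = wt p.
Proof. by case: p => [[]|[[]|[]]]. Qed.

Lemma wt_glue_single a b c d o i I p : wt (@glue_single a b c d o i I p) = wt p.
Proof.
case: p => [[[k|k]|[[k e]|[k e]]]|j] //=; by case: unlift.
Qed.

Lemma wt_glue_double a b c d o i I p : wt (@glue_double a b c d o i I p) = wt p.
Proof.
case: p => [[[k|k]|[[k e]|[k e]]]|j] //=; by case: unlift.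
Qed.

Lemma wt_prime_dout a b c d o I p : wt (@prime_dout a b c d o I p) = wt p.
Proof.
case: p => [[[k|k]|[[k e]|[k e]]]|j] //=; by case: eqP.
Qed.

Lemma wt_prime_din a b c d o I p : wt (@prime_din a b c d o I p) = wt p.
Proof.
case: p => [[[k|k]|[[k e]|[k e]]]|j] //=; by case: eqP.
Qed.

Lemma fmf_rename_pot_homog (V W : gvars) (s : V -> W) (M : fmf V) w w' :
  (forall v, wt (s v) = wt v) -> rename s w = w' ->
  fmf_pot M w /\ fmf_homog M n.+1%:Z ->
  fmf_pot (fmf_rename s M) w' /\ fmf_homog (fmf_rename s M) n.+1%:Z.
Proof.
move=> ws <- [Mw Mh]; split; first exact: (fmf_pot_map (rename s) Mw).
by apply: (fmf_homog_map (g := rename s)) Mh => d p; apply: homog_rename.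
Qed.

Definition pot_bv a b c d (I : gvars) : polyQ (gvars_sum (bvars a b c d) I) :=
  pot_at n (fun p => X (bv I p)).

Lemma rename_pot_bv a b c d (I W : gvars) (s : gvars_sum (bvars a b c d) I -> W) :
  rename s (pot_bv a b c d I) = pot_at n (fun p => X (s (bv I p))).
Proof.
rewrite /pot_bv (pot_at_rmorph n (rename s)); apply: eq_pot_at => p.
exact: renameX.
Qed.

Lemma fmf_rename_pot_bv a b c d (I W : gvars) (s : gvars_sum (bvars a b c d) I -> W)
    (M : fmf (gvars_sum (bvars a b c d) I)) :
  (forall v, wt (s v) = wt v) ->
  fmf_pot M (pot_bv a b c d I) /\ fmf_homog M n.+1%:Z ->
  fmf_pot (fmf_rename s M) (pot_at n (fun p => X (s (bv I p)))) /\
  fmf_homog (fmf_rename s M) n.+1%:Z.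
Proof. by move=> ws; apply: fmf_rename_pot_homog => //; apply: rename_pot_bv. Qed.

(** Induction on the diagram: unions add potentials, and a gluing renames the parameters of both end
    points to the same internal variables, so that their terms cancel. The degree n+1 of the
    differentials, required by every later elimination, passes through the same induction. *)
Lemma Cfac_pot_homog a b c d (D : diagram a b c d) :
  fmf_pot (ifac (Cfac n f D)) (pot_bv a b c d (ivars (Cfac n f D))) /\
  fmf_homog (ifac (Cfac n f D)) n.+1%:Z.
Proof.
have h2 (V : gvars) (x : V) : wt x = 2%N -> homogeneous 2 (X x).
  by move=> wx; have := homogX x; rewrite wx.
have h4 (V : gvars) (x : V) : wt x = 4%N -> homogeneous 4 (X x).
  by move=> wx; have := homogX x; rewrite wx.
have h22 (V : gvars) (x y : V) : wt x = 2%N -> wt y = 2%N ->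
    homogeneous 2 (X x + X y) /\ homogeneous 4 (X x * X y).
  by move=> /h2 hx /h2 hy; split; [apply: homogD | apply: homogM hx hy].
elim: D => {a b c d} [||||| a b c d a' b' c' d' D1 IH1 D2 IH2
  | a b c d o i D IH | a b c d o i D IH].
- rewrite /pot_bv pot_at_single; exact: mfS_pot_homog.
- rewrite /pot_bv pot_at_double /=.
  have [||||| -> [N1 N2]] := @mfL_line n f (gvars_sum (bvars 0 0 1 1) no_var) n_ge fE
    (bv _ (dout ord0 yvar)) (bv _ (dout ord0 zvar)) (bv _ (din ord0 yvar))
    (bv _ (din ord0 zvar)) => //.
  split; first exact: line_pot.
  by apply: line_homog => //; first [exact: h2 | exact: h4].
- rewrite /pot_bv pot_at_triin /=.
  have [||||| -> [N1 N2]] := @mfVin_line n f (gvars_sum (bvars 0 2 1 0) no_var) n_ge fE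
    (bv _ (dout ord0 yvar)) (bv _ (dout ord0 zvar)) (bv _ (xin ord0))
    (bv _ (xin ord_max)) => //.
  split; first exact: line_pot.
  have [hD hM] := @h22 _ (bv no_var (xin ord0) : gvars_sum (bvars 0 2 1 0) no_var)
    (bv no_var (xin ord_max)) erefl erefl.
  by apply: line_homog => //; first [exact: h2 | exact: h4].
- rewrite /pot_bv pot_at_triout /=.
  have [||||| -> [N1 N2]] := @mfVout_line n f (gvars_sum (bvars 2 0 0 1) no_var) n_ge fE
    (bv _ (xout ord0)) (bv _ (xout ord_max)) (bv _ (din ord0 yvar))
    (bv _ (din ord0 zvar)) => //.
  split; first exact: line_pot.
  have [hD hM] := @h22 _ (bv no_var (xout ord0) : gvars_sum (bvars 2 0 0 1) no_var)
    (bv no_var (xout ord_max)) erefl erefl.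
  by apply: fmf_homog_shift; apply: line_homog => //; first [exact: h2 | exact: h4].
- rewrite /pot_bv pot_at_four /=.
  have [||||| -> [N1 N2]] := @mfW_line n f (gvars_sum (bvars 2 2 0 0) no_var) n_ge fE
    (bv _ (xout ord0)) (bv _ (xout ord_max)) (bv _ (xin ord0))
    (bv _ (xin ord_max)) => //.
  split; first exact: line_pot.
  have [hD hM] := @h22 _ (bv no_var (xout ord0) : gvars_sum (bvars 2 2 0 0) no_var)
    (bv no_var (xout ord_max)) erefl erefl.
  have [hD' hM'] := @h22 _ (bv no_var (xin ord0) : gvars_sum (bvars 2 2 0 0) no_var)
    (bv no_var (xin ord_max)) erefl erefl.
  by apply: fmf_homog_shift; apply: line_homog.
- rewrite /pot_bv -pot_at_union /=.
  have [|P1 H1] := fmf_rename_pot_bv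
    (s := gvars_sum_map (@union_l a b c d a' b' c' d') (@bv _ (ivars (Cfac n f D2)))) _ IH1.
    by case=> [p|j] //=; apply: wt_union_l.
  have [|P2 H2] := fmf_rename_pot_bv
    (s := gvars_sum_map (@union_r a b c d a' b' c' d') (@iv (ivars (Cfac n f D1)) _)) _ IH2.
    by case=> [p|j] //=; apply: wt_union_r.
  by split; [exact: (fmf_pot_tens P1 P2) | exact: fmf_homog_tens].
- apply: (fmf_rename_pot_homog (s := @glue_single a b c d o i _)) IH.
  - exact: wt_glue_single.
  rewrite rename_pot_bv; apply: (pot_at_glue_single _ (o:=o) (i:=i)) => //=.
  - by rewrite !unlift_none.
  - by move=> k; rewrite liftK.
  - by move=> k; rewrite liftK.
- apply: (fmf_rename_pot_homog (s := @glue_double a b c d o i _)) IH.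
  - exact: wt_glue_double.
  rewrite rename_pot_bv; apply: (pot_at_glue_double _ (o:=o) (i:=i)) => //=.
  - by move=> e; rewrite !unlift_none.
  - by move=> k e; rewrite liftK.
  - by move=> k e; rewrite liftK.
Qed.
End Cfac.

Lemma fmf_shift0 (V : gvars) (M : fmf V) : M {{0}} = M.
Proof.
case: M => r0 r1 d0 d1 m0 m1; rewrite /fmf_shift /=.
by congr Fmf; apply: functional_extensionality => i; rewrite addr0.
Qed.

Lemma mfo_id (V : gvars) (iota : {rmorphism polyQ V -> polyQ V}) (M : fmf V) :
  (forall c, iota c = c) -> heq (mfo iota M) (mf_of M).
Proof.
move=> iotaE.
have L r : linear ((fun v => v) : restrict iota 'cV[polyQ V]_r -> 'cV[polyQ V]_r).
  by move=> c u v; rewrite -[in RHS](iotaE c).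
pose i0 (v : mod0 (mfo iota M)) : mod0 (mf_of M) := v.
pose i1 (v : mod1 (mfo iota M)) : mod1 (mf_of M) := v.
pose k0 (v : mod0 (mf_of M)) : mod0 (mfo iota M) := v.
pose k1 (v : mod1 (mf_of M)) : mod1 (mfo iota M) := v.
apply: (@heq_iso (polyQ V) (mfo iota M) (mf_of M) i0 i1 k0 k1).
- exact: L.
- exact: L.
- by move=> v.
- by move=> v.
- by move=> v.
- by move=> v.
- by move=> d v.
- by move=> d v.
- by move=> v.
- by move=> v.
Qed.

Lemma rename_comp (U V W : gvars) (g : V -> W) (h : U -> V) k p :
  (forall v, g (h v) = k v) -> rename g (rename h p) = rename k p.
Proof.
move=> E; apply: (polyQ_rmorph_eq (f := rename g \o rename h) (g := rename k)) => [c|v].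
  by rewrite -[LHS]/(rename g (rename h (constQ U c))) (renameC h) (renameC g) (renameC k).
apply: etrans (congr1 (rename g) (renameX h v)) _.
by rewrite (renameX g) (renameX k) E.
Qed.

(** * Gluing along a double line *)

Section GlueLine.
Variables (B V V1 V2 : gvars) (i0 : B -> V) (i1 : B -> V1) (i2 : B -> V2).
Variables (inc1 : V1 -> V) (inc2 : V2 -> V1) (ret1 : V -> V1) (ret2 : V1 -> V2).
Variables (y' : V) (z1 : V1) (gy : polyQ V1) (gz : polyQ V2).
Hypotheses (i01 : forall p, inc1 (i1 p) = i0 p) (i12 : forall p, inc2 (i2 p) = i1 p).
Hypotheses (inc1K : cancel inc1 ret1) (inc2K : cancel inc2 ret2).
Hypotheses (y'P : forall v, v = y' \/ v = inc1 (ret1 v)).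
Hypotheses (z1P : forall v, v = z1 \/ v = inc2 (ret2 v)).
Hypotheses (inc1_y' : forall v, inc1 v != y') (inc2_z1 : forall v, inc2 v != z1).
Hypotheses (wt_inc1 : forall v, wt (inc1 v) = wt v) (wt_inc2 : forall v, wt (inc2 v) = wt v).
Hypotheses (wt_y' : wt y' = 2%N) (wt_z1 : wt z1 = 4%N).
Hypotheses (gyH : homogeneous 2 gy) (gzH : homogeneous 4 gz).

Definition glue1 : {rmorphism polyQ V -> polyQ V1} :=
  subst (fun v => if v == y' then gy else X (ret1 v)).
Definition glue2 : {rmorphism polyQ V1 -> polyQ V2} :=
  subst (fun v => if v == z1 then gz else X (ret2 v)).

Lemma glue1_inc v : glue1 (X (inc1 v)) = X v.
Proof. by rewrite substX (negPf (inc1_y' v)) inc1K. Qed.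
Lemma glue1_y' : glue1 (X y') = gy.
Proof. by rewrite substX eqxx. Qed.
Lemma glue2_inc v : glue2 (X (inc2 v)) = X v.
Proof. by rewrite substX (negPf (inc2_z1 v)) inc2K. Qed.
Lemma glue2_z1 : glue2 (X z1) = gz.
Proof. by rewrite substX eqxx. Qed.

Lemma elim_glue1 b :
  b = X y' - rename inc1 gy \/ b = rename inc1 gy - X y' ->
  elim glue1 (rename inc1) b 2.
Proof.
move=> bE; have := @elim_var V V1 inc1 (fun v => if v == y' then gy else X (ret1 v)) y' b.
rewrite wt_y' eqxx; apply=> //.
- by move=> v; rewrite (negPf (inc1_y' v)) inc1K.
- by move=> v; case: (y'P v) => E; [left | right; exists (ret1 v)].
Qed.

Lemma elim_glue2 b :
  b = X z1 - rename inc2 gz \/ b = rename inc2 gz - X z1 ->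
  elim glue2 (rename inc2) b 4.
Proof.
move=> bE; have := @elim_var V1 V2 inc2 (fun v => if v == z1 then gz else X (ret2 v)) z1 b.
rewrite wt_z1 eqxx; apply=> //.
- by move=> v; rewrite (negPf (inc2_z1 v)) inc2K.
- by move=> v; case: (z1P v) => E; [left | right; exists (ret2 v)].
Qed.

Lemma glue1_rename c : glue1 (rename i0 c) = rename i1 c.
Proof.
apply: (polyQ_rmorph_eq (f := glue1 \o rename i0) (g := rename i1)) => [a|v].
  rewrite -[LHS]/(glue1 (rename i0 (constQ B a))) (renameC i0) (renameC i1).
  exact: substC.
apply: etrans (esym (renameX i1 v)).
by apply: etrans (congr1 glue1 (renameX i0 v)) _; rewrite -i01; apply: glue1_inc.
Qed.

Lemma glue2_rename c : glue2 (rename i1 c) = rename i2 c.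
Proof.
apply: (polyQ_rmorph_eq (f := glue2 \o rename i1) (g := rename i2)) => [a|v].
  rewrite -[LHS]/(glue2 (rename i1 (constQ B a))) (renameC i1) (renameC i2).
  exact: substC.
apply: etrans (esym (renameX i2 v)).
by apply: etrans (congr1 glue2 (renameX i1 v)) _; rewrite -i12; apply: glue2_inc.
Qed.

(** Up to sign, the entries u - v and z - w are y' - [gy] and z' - [gz], with z' = [inc1 z1], so
    both internal variables can be eliminated. The alternatives in the hypotheses are the two
    orientations of the line, which only change these signs. *)
Lemma heq_glue_line n (N : fmf V) m u v z w w0 W :
  (u = rename inc1 gy /\ v = X y' \/ u = X y' /\ v = rename inc1 gy) ->
  (z = rename inc1 (rename inc2 gz) /\ w = X (inc1 z1) \/
   z = X (inc1 z1) /\ w = rename inc1 (rename inc2 gz)) ->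
  fmf_pot N w0 -> fmf_homog N n.+1%:Z ->
  w0 + (pw u z n.+1 - pw v w n.+1) = rename i0 W ->
  heq (mfo (rename i0) (N \boxt (line n u v z w {{m}})))
      (mfo (rename i2) (fmf_map glue2 (fmf_map glue1 (N {{m}})))).
Proof.
move=> uv zw Nw Nh wE.
have E1 : elim glue1 (rename inc1) (u - v) 2.
  by apply: elim_glue1; case: uv => -[-> ->]; [right | left].
have g1r p : glue1 (rename inc1 p) = p := elim_secK E1 p.
have E2 : elim glue2 (rename inc2) (glue1 (z - w)) 4.
  apply: elim_glue2; rewrite rmorphB.
  by case: zw => -[-> ->]; [right | left]; rewrite g1r glue1_inc.
have hy : homogeneous 2 (X y') by have := homogX y'; rewrite wt_y'.
have hz : homogeneous 4 (X (inc1 z1)) by have := homogX (inc1 z1); rewrite wt_inc1 wt_z1.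
have hgy : homogeneous 2 (rename inc1 gy) by apply: homog_rename.
have hgz : homogeneous 4 (rename inc1 (rename inc2 gz)).
  by apply: homog_rename => //; apply: homog_rename.
have [hu hv] : homogeneous 2 u /\ homogeneous 2 v by case: uv => -[-> ->].
have [hz' hw'] : homogeneous 4 z /\ homogeneous 4 w by case: zw => -[-> ->].
have zw0 : z - w != 0.
  by apply: contra_neq (elim_neq0 E2) => ->; rewrite rmorph0.
rewrite /line; apply: (elim_pair (iota1 := rename i1) (w := W) m E1 E2 glue1_rename _
  glue2_rename _ Nw Nh _ erefl erefl).
- by move=> c; apply: rename_comp.
- by move=> c; apply: rename_comp.
- by rewrite -wE -(dpwP u v z w n.+1) addrA.
- have -> : n.+1%:Z - (4 - n.+1%:Z) = (2 * n.+1)%N%:Z - 4 by lia.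
  apply: (homog_divl zw0 (homogB hz' hw')).
  have := homogB (homog_pw (k := n.+1) hv hz') (homog_pw (k := n.+1) hv hw').
  by rewrite -(dpw1P v z w n.+1) mulrC.
- by rewrite addrC subrK; apply: homogB.
Qed.
End GlueLine.

(** Needed for the intermediate ring, in which y' has been eliminated and z' is still present. *)
Definition z_var : gvars := @Gvars unit (fun=> 4%N).

Section Unprime.
Variables (n : nat) (B I : gvars) (py pz : B).
Hypotheses (wt_py : wt py = 2%N) (wt_pz : wt pz = 4%N).

Let V := gvars_sum B (gvars_sum I double_var).
Let V1 := gvars_sum B (gvars_sum I z_var).
Let V2 := gvars_sum B I.
Let inc1 (v : V1) : V :=
  match v with
  | inl p => inl p | inr (inl j) => inr (inl j) | inr (inr _) => inr (inr zvar)
  end.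
Let ret1 (v : V) : V1 :=
  match v with
  | inl p => inl p | inr (inl j) => inr (inl j) | inr (inr _) => inr (inr tt)
  end.
Let inc2 (v : V2) : V1 :=
  match v with inl p => inl p | inr j => inr (inl j) end.
Let ret2 (v : V1) : V2 :=
  match v with inl p => inl p | inr (inl j) => inr j | inr (inr _) => inl py end.

Let y' : V := iv B (iv I yvar).
Let z' : V := iv B (iv I zvar).
Let z1 : V1 := iv B (iv I (tt : z_var)).

Variables (s : V2 -> V) (N : fmf V2).
Hypotheses (s_other : forall v, v != bv I py -> v != bv I pz -> s v = inc1 (inc2 v))
  (s_py : s (bv I py) = y') (s_pz : s (bv I pz) = z').

Let inc1K : cancel inc1 ret1. Proof. by case=> [|[|[]]]. Qed.
Let inc2K : cancel inc2 ret2. Proof. by case. Qed.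
Let y'P v : v = y' \/ v = inc1 (ret1 v).
Proof. by case: v => [|[|[]]]; [right | right | right | left]. Qed.
Let z1P v : v = z1 \/ v = inc2 (ret2 v).
Proof. by case: v => [|[|[]]]; [right | right | left]. Qed.
Let inc1_y' v : inc1 v != y'. Proof. by case: v => [|[|[]]]. Qed.
Let inc2_z1 v : inc2 v != z1. Proof. by case: v. Qed.
Let wt_inc1 v : wt (inc1 v) = wt v. Proof. by case: v => [|[|[]]]. Qed.
Let wt_inc2 v : wt (inc2 v) = wt v. Proof. by case: v. Qed.

Let gy : polyQ V1 := X (bv _ py).
Let gz : polyQ V2 := X (bv _ pz).
Let g1 : {rmorphism polyQ V -> polyQ V1} := glue1 ret1 y' gy.
Let g2 : {rmorphism polyQ V1 -> polyQ V2} := glue2 ret2 z1 gz.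

Let g1_inc v : g1 (X (inc1 v)) = X v. Proof. exact: glue1_inc. Qed.
Let g2_inc v : g2 (X (inc2 v)) = X v. Proof. exact: glue2_inc. Qed.
Let g1_y' : g1 (X y') = gy. Proof. exact: glue1_y'. Qed.
Let g2_z1 : g2 (X z1) = gz. Proof. exact: glue2_z1. Qed.

Let g12X v : g2 (g1 (X (s v))) = X v.
Proof.
have [-> {v}|v_py] := eqVneq v (bv I py).
  by rewrite s_py; apply: etrans (congr1 g2 g1_y') (g2_inc (bv I py)).
have [-> {v v_py}|v_pz] := eqVneq v (bv I pz).
  by rewrite s_pz; apply: etrans (congr1 g2 (g1_inc z1)) g2_z1.
by rewrite s_other //; apply: etrans (congr1 g2 (g1_inc (inc2 v))) (g2_inc v).
Qed.

(** Priming the parameters and then substituting the original ones for the primed ones is the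
    identity, so the elimination returns [N] itself. *)
Let g12 : fmf_map g2 (fmf_map g1 (fmf_rename s N)) = N.
Proof.
rewrite -[fmf_rename s N]/(fmf_map (rename s) N) !fmf_map_comp.
apply: fmf_map_id.
apply: (polyQ_rmorph_eq (f := g2 \o (g1 \o rename s)) (g := idfun)) => [c|v].
  rewrite -[LHS]/(g2 (g1 (rename s (constQ V2 c)))) renameC.
  by apply: etrans (congr1 g2 (substC _ c)) _; apply: substC.
rewrite -[LHS]/(g2 (g1 (rename s (X v)))).
exact: etrans (congr1 (g2 \o g1) (renameX s v)) (g12X v).
Qed.

Lemma heq_unprime u v z w (w0 : polyQ V) (W : polyQ B) :
  (u = X (bv _ py) /\ v = X y' \/ u = X y' /\ v = X (bv _ py)) ->
  (z = X (bv _ pz) /\ w = X z' \/ z = X z' /\ w = X (bv _ pz)) ->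
  fmf_pot (fmf_rename s N) w0 -> fmf_homog (fmf_rename s N) n.+1%:Z ->
  w0 + (pw u z n.+1 - pw v w n.+1) = rename (@bv B _) W ->
  heq (over_boundary (fmf_rename s N \boxt line n u v z w)) (over_boundary N).
Proof.
move=> uv zw Nw Nh wE.
have E1 : rename inc1 (X (bv _ py)) = X (bv _ py) := renameX inc1 _.
have E2 : rename inc1 (rename inc2 (X (bv _ pz))) = X (bv _ pz).
  by apply: etrans (congr1 (rename inc1) (renameX inc2 _)) _; apply: renameX.
rewrite -[line n u v z w]fmf_shift0 -{2}g12 -[X in fmf_map g1 X]fmf_shift0.
apply: (heq_glue_line (i1 := @bv B _) (inc1 := inc1) (inc2 := inc2) _ _ inc1K inc2K
  y'P z1P inc1_y' inc2_z1 wt_inc1 wt_inc2 _ _ _ _ _ _ _ Nw Nh wE) => //.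
- by have := homogX (bv (gvars_sum I z_var) py : V1); rewrite /= wt_py.
- by have := homogX (bv I pz : V2); rewrite /= wt_pz.
- by rewrite E1.
- by rewrite E2.
Qed.
End Unprime.

Section Parts.
Variables (n : nat) (f : {mpoly rat[2]}).
Hypothesis n_ge : (1 <= n)%N.
Hypothesis fE : f = pw ('X_ord0 : {mpoly rat[2]}) 'X_ord_max n.+1.

Lemma potentialE a b c d : potential a b c d n f = pot_at n (fun p => X p).
Proof.
apply: (f_equal2 (fun x y => x - y)); apply: (f_equal2 (fun x y => x + y)) => //.
  by apply: eq_bigr => i _; apply: fevalE.
by apply: eq_bigr => i _; apply: fevalE.
Qed.

Lemma rename_potential a b c d I :
  rename (@bv _ I) (potential a b c d n f) = pot_bv n a b c d I.
Proof.
rewrite potentialE; apply: etrans (pot_at_rmorph n (rename (@bv _ I)) _) _.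
by apply: eq_pot_at => p; apply: renameX.
Qed.

Lemma unprime_dout a b c d (D : diagram a b c.+1 d) (o : 'I_c.+1) :
  let y := dout o yvar : bvars a b c.+1 d in
  let z := dout o zvar : bvars a b c.+1 d in
  let y' := iv _ (iv (ivars (Cfac n f D)) yvar) in
  let z' := iv _ (iv (ivars (Cfac n f D)) zvar) in
  HMF_iso (potential a b c.+1 d n f)
    (over_boundary
       (fmf_rename (prime_dout o (I := _)) (ifac (Cfac n f D)) \boxt
        mfL f (bv _ y) (bv _ z) y' z'))
    (over_boundary (ifac (Cfac n f D))).
Proof.
move=> y z y' z'; have CD := Cfac_pot_homog n_ge fE D; have [Cp Ch] := CD.
set I := ivars (Cfac n f D) in y' z' CD Cp Ch *.
have [|||||-> _] := @mfL_line n f _ n_ge fE (bv _ y) (bv _ z) y' z' => //.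
  by rewrite /= !inE !negb_or /= !andbT; apply/eqP => -[].
have [Np Nh] := fmf_rename_pot_bv (s := @prime_dout a b c.+1 d o I) (@wt_prime_dout _ _ _ _ o I) CD.
set w0 := pot_at n _ in Np.
have wE : w0 + (pw (X (bv _ y)) (X (bv _ z)) n.+1 - pw (X y') (X z') n.+1)
    = rename (@bv _ _) (potential a b c.+1 d n f).
  rewrite rename_potential.
  have := @pot_at_dout n _ a b c.+1 d (fun p => X (@prime_dout a b c.+1 d o I (bv I p)))
    (fun p => X (bv (gvars_sum I double_var) p)) o.
  rewrite /= !eqxx; apply => //.
  by move=> i e /negPf ->.
split.
- apply: (is_mf_mfo (gbasis_bv _ _)).
  by rewrite -wE; apply: fmf_pot_tens Np (line_pot _ _ _ _ _).
- by apply: (is_mf_mfo (gbasis_bv _ _)); rewrite rename_potential.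
apply: (@heq_unprime n _ I y z _ _ _ _ _ _ _ _ _ _ _ w0 _ _ _ Np Nh wE) => //.
- case=> [[[k|k]|[[k e]|[k e]]]|j] //= Ny Nz.
  case: eqP => // E; move: Ny Nz; rewrite E.
  by case: e; rewrite ?eqxx.
- by rewrite /= eqxx.
- by rewrite /= eqxx.
- by left.
- by left.
Qed.

Lemma unprime_din a b c d (D : diagram a b c d.+1) (i : 'I_d.+1) :
  let y := din i yvar : bvars a b c d.+1 in
  let z := din i zvar : bvars a b c d.+1 in
  let y' := iv _ (iv (ivars (Cfac n f D)) yvar) in
  let z' := iv _ (iv (ivars (Cfac n f D)) zvar) in
  HMF_iso (potential a b c d.+1 n f)
    (over_boundary
       (fmf_rename (prime_din i (I := _)) (ifac (Cfac n f D)) \boxt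
        mfL f y' z' (bv _ y) (bv _ z)))
    (over_boundary (ifac (Cfac n f D))).
Proof.
move=> y z y' z'; have CD := Cfac_pot_homog n_ge fE D; have [Cp Ch] := CD.
set I := ivars (Cfac n f D) in y' z' CD Cp Ch *.
have [|||||-> _] := @mfL_line n f _ n_ge fE y' z' (bv _ y) (bv _ z) => //.
  by rewrite /= !inE /= ?andbT; apply/eqP => -[].
have [Np Nh] := fmf_rename_pot_bv (s := @prime_din a b c d.+1 i I) (@wt_prime_din _ _ _ _ i I) CD.
set w0 := pot_at n _ in Np.
have wE : w0 + (pw (X y') (X z') n.+1 - pw (X (bv _ y)) (X (bv _ z)) n.+1)
    = rename (@bv _ _) (potential a b c d.+1 n f).
  rewrite rename_potential.
  have := @pot_at_din n _ a b c d.+1 (fun p => X (@prime_din a b c d.+1 i I (bv I p)))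
    (fun p => X (bv (gvars_sum I double_var) p)) i.
  rewrite /= !eqxx; apply => //.
  by move=> k e /negPf ->.
split.
- apply: (is_mf_mfo (gbasis_bv _ _)).
  by rewrite -wE; apply: fmf_pot_tens Np (line_pot _ _ _ _ _).
- by apply: (is_mf_mfo (gbasis_bv _ _)); rewrite rename_potential.
apply: (@heq_unprime n _ I y z _ _ _ _ _ _ _ _ _ _ _ w0 _ _ _ Np Nh wE) => //.
- case=> [[[k|k]|[[k e]|[k e]]]|j] //= Ny Nz.
  case: eqP => // E; move: Ny Nz; rewrite E.
  by case: e; rewrite ?eqxx.
- by rewrite /= eqxx.
- by rewrite /= eqxx.
- by right.
- by right.
Qed.
End Parts.

(** * Two trivalent diagrams glued along a double line *)

Section FourValent.
Variables (n : nat) (f : {mpoly rat[2]}).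
Hypothesis n_ge : (1 <= n)%N.
Hypothesis fE : f = pw ('X_ord0 : {mpoly rat[2]}) 'X_ord_max n.+1.

Variables (B : gvars) (x1 x2 x3 x4 : B).
Hypotheses (x_uniq : uniq [:: x1; x2; x3; x4]).
Hypotheses (w1 : wt x1 = 2%N) (w2 : wt x2 = 2%N) (w3 : wt x3 = 2%N) (w4 : wt x4 = 2%N).

Let I := double_var.
Let V := gvars_sum B I.
Let V1 := gvars_sum B z_var.
Let inc1 (v : V1) : V := match v with inl p => inl p | inr _ => inr zvar end.
Let ret1 (v : V) : V1 := match v with inl p => inl p | inr _ => inr tt end.
Let inc2 (v : B) : V1 := bv _ v.
Let ret2 (v : V1) : B := match v with inl p => p | inr _ => x1 end.
Let y5 : V := iv B yvar.
Let z5 : V := iv B zvar.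
Let z1 : V1 := iv B (tt : z_var).

Let inc1K : cancel inc1 ret1. Proof. by case=> [|[]]. Qed.
Let inc2K : cancel inc2 ret2. Proof. by []. Qed.
Let y'P v : v = y5 \/ v = inc1 (ret1 v).
Proof. by case: v => [|[]]; [right | right | left]. Qed.
Let z1P v : v = z1 \/ v = inc2 (ret2 v).
Proof. by case: v => [|[]]; [right | left]. Qed.
Let inc1_y' v : inc1 v != y5. Proof. by case: v => [|[]]. Qed.
Let inc2_z1 v : inc2 v != z1. Proof. by []. Qed.
Let wt_inc1 v : wt (inc1 v) = wt v. Proof. by case: v => [|[]]. Qed.
Let wt_inc2 v : wt (inc2 v) = wt v. Proof. by []. Qed.

Let gy : polyQ V1 := X (bv _ x3) + X (bv _ x4).
Let gz : polyQ B := X x3 * X x4.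
Let g1 : {rmorphism polyQ V -> polyQ V1} := glue1 ret1 y5 gy.
Let g2 : {rmorphism polyQ V1 -> polyQ B} := glue2 ret2 z1 gz.

Let g1_inc v : g1 (X (inc1 v)) = X v. Proof. exact: glue1_inc. Qed.
Let g2_inc v : g2 (X (inc2 v)) = X v. Proof. exact: glue2_inc. Qed.
Let g1_y' : g1 (X y5) = gy. Proof. exact: glue1_y'. Qed.
Let g2_z1 : g2 (X z1) = gz. Proof. exact: glue2_z1. Qed.

Let g12_bv p : g2 (g1 (X (bv _ p))) = X p.
Proof. exact: etrans (congr1 g2 (g1_inc (bv _ p))) (g2_inc p). Qed.

Let potB : polyQ B := X x1 ^+ n.+1 + X x2 ^+ n.+1 - X x3 ^+ n.+1 - X x4 ^+ n.+1.

Let potBE : potB = pw (X x1 + X x2) (X x1 * X x2) n.+1 - pw (X x3 + X x4) (X x3 * X x4) n.+1.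
Proof.
rewrite (pw_sum (X x1) (X x2) n.+1) (pw_sum (X x3) (X x4) n.+1) /potB.
by rewrite -addrA -opprD.
Qed.

Let renameD (U W : gvars) (s : U -> W) p q : rename s (X p + X q) = X (s p) + X (s q).
Proof. by rewrite (rmorphD (rename s) (X p) (X q)) (renameX s p) (renameX s q). Qed.

Let renameM (U W : gvars) (s : U -> W) p q : rename s (X p * X q) = X (s p) * X (s q).
Proof. by rewrite (rmorphM (rename s) (X p) (X q)) (renameX s p) (renameX s q). Qed.

(** The entries y5 - (x3 + x4) and z5 - x3 x4 of [mfVin] eliminate y5 and z5 from [mfVout], which
    specializes to [mfW]; both carry the shift by -1. *)
Lemma four_valent :
  HMF_iso potB
    (over_boundary
        (mfVout f (bv I x1) (bv I x2) (iv B (yvar : I)) (iv B (zvar : I)) \boxt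
         mfVin f (iv B (yvar : I)) (iv B (zvar : I)) (bv I x3) (bv I x4)))
    (mf_of (mfW f x1 x2 x3 x4)).
Proof.
move: (x_uniq); rewrite /= !inE !negb_or => /and4P[/and3P[n1 n2 n3] /andP[n4 n5] n6 _].
have [|||||-> [N1 N2]] := @mfVout_line n f _ n_ge fE (bv I x1) (bv I x2) y5 z5 => //.
  by rewrite /= !inE /= orbF andbT; apply: contraNneq n1 => -[->].
have [|||||-> _] := @mfVin_line n f _ n_ge fE y5 z5 (bv I x3) (bv I x4) => //.
  by rewrite /= !inE /= andbT; apply: contraNneq n6 => -[->].
have [|||||-> _] := @mfW_line n f _ n_ge fE x1 x2 x3 x4 => //.
set U := X (bv I x1) + X (bv I x2) in N1 *.
set T := X (bv I x1) * X (bv I x2) in N2 *.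
pose L1 : fmf V := line n U (X y5) T (X z5) {{-1}}.
have L1p : fmf_pot L1 (pw U T n.+1 - pw (X y5) (X z5) n.+1) by exact: line_pot.
have hx (W : gvars) (x : W) k : wt x = k -> homogeneous k%:Z (X x).
  by move=> <-; apply: homogX.
have L1h : fmf_homog L1 n.+1%:Z.
  apply: fmf_homog_shift; apply: line_homog => //; try exact: hx.
    by apply: homogD; apply: hx.
  by apply: (@homogM _ 2 2); apply: hx.
have wE : pw U T n.+1 - pw (X y5) (X z5) n.+1 +
   (pw (X y5) (X z5) n.+1 - pw (X (bv I x3) + X (bv I x4)) (X (bv I x3) * X (bv I x4)) n.+1)
   = rename (@bv B I) potB.
  rewrite potBE (rmorphB (rename (@bv B I))) !(pw_rmorph (rename (@bv B I))).
  by rewrite !renameD !renameM addrA subrK.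
split.
- apply: (is_mf_mfo (gbasis_bv _ _)); rewrite -wE.
  exact: fmf_pot_tens L1p (line_pot _ _ _ _ _).
- by apply: is_mf_mf_of; rewrite potBE; apply: line_pot.
have E : fmf_map g2 (fmf_map g1 (L1 {{0}})) =
    line n (X x1 + X x2) (X x3 + X x4) (X x1 * X x2) (X x3 * X x4) {{-1}}.
  have gD p q : g2 (g1 (X (bv I p) + X (bv I q))) = X p + X q :=
    etrans (congr1 g2 (rmorphD g1 _ _))
      (etrans (rmorphD g2 _ _) (f_equal2 +%R (g12_bv p) (g12_bv q))).
  have gM p q : g2 (g1 (X (bv I p) * X (bv I q))) = X p * X q :=
    etrans (congr1 g2 (rmorphM g1 _ _))
      (etrans (rmorphM g2 _ _) (f_equal2 *%R (g12_bv p) (g12_bv q))).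
  have gy5 : g2 (g1 (X y5)) = X x3 + X x4.
    apply: etrans (congr1 g2 g1_y') (etrans (rmorphD g2 _ _) _).
    exact: (f_equal2 +%R (g2_inc x3) (g2_inc x4)).
  have gz5 : g2 (g1 (X z5)) = X x3 * X x4 := etrans (congr1 g2 (g1_inc z1)) g2_z1.
  rewrite fmf_shift0.
  rewrite -[LHS]/((fmf_map g2 (fmf_map g1 (line n U (X y5) T (X z5)))) {{-1}}).
  apply: (f_equal (fmf_shift (-1))).
  apply: etrans (congr1 (fmf_map g2) (line_map n g1 U (X y5) T (X z5))) _.
  apply: etrans (line_map n g2 _ _ _ _) _.
  exact: (f_equal4 (@line n B) (gD x1 x2) gy5 (gM x1 x2) gz5).
(* The target has no internal variables: it is regarded over its own ring along the identity
   renaming, to fit the form of [heq_glue_line]. *)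
apply: heq_trans (mfo_id (iota := rename (fun p : B => p)) _ _); last first.
  by move=> c; apply: (polyQ_rmorph_eq (f := rename (fun p : B => p)) (g := idfun));
    [move=> r; apply: renameC | move=> v; apply: renameX].
rewrite -E -[line n (X y5) _ _ _]fmf_shift0.
apply: (heq_glue_line (i1 := @bv B _) (inc1 := inc1) (inc2 := inc2) _ _ inc1K inc2K
  y'P z1P inc1_y' inc2_z1 wt_inc1 wt_inc2 _ _ _ _ _ _ _ L1p L1h wE) => //.
- by apply: homogD; apply: hx.
- by apply: (@homogM _ 2 2); apply: hx.
- by right; split=> //; rewrite renameD.
- right; split=> //; apply: esym.
  exact: etrans (congr1 (rename inc1) (renameM inc2 x3 x4)) (renameM inc1 _ _).
Qed.
End FourValent.

(** * The quadratic extension Q[y,z][x] / (x^2 - y x + z) *)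

(** The divided difference is polynomial in its last argument. This compares a specialized trivalent
    diagram with the double line modulo [b]. *)
Lemma dpw1_congr (S : comNzRingType) (s t t1 t2 : S) k :
  exists D, dpw1 s t t1 k = dpw1 s t t2 k + (t1 - t2) * D.
Proof.
suff [] : (exists D, dpw1 s t t1 k = dpw1 s t t2 k + (t1 - t2) * D) /\
    (exists D, dpw1 s t t1 k.+1 = dpw1 s t t2 k.+1 + (t1 - t2) * D) by [].
elim: k => [|k [[D1 E1] [D2 E2]]].
  by split; exists 0; rewrite ?dpw10 ?dpw11 mulr0 addr0.
split; first by exists D2.
exists (s * D2 - t1 * D1 - dpw1 s t t2 k).
by rewrite !dpw1SS E1 E2; ring.
Qed.

(** The reduction x^2 = y x - z - b brings the product of two normal forms into normal form. *)
Lemma quad_mul (R : comNzRingType) (x y z u r0 r1 u' r0' r1' : R) :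
  let b := x * (y - x) - z in
  (b * u + r0 + x * r1) * (b * u' + r0' + x * r1') =
  b * (u * (b * u' + r0' + x * r1') + (r0 + x * r1) * u' - r1 * r1') +
  (r0 * r0' - z * (r1 * r1')) + x * (r0 * r1' + r1 * r0' + y * (r1 * r1')).
Proof. by move=> b'; rewrite /b'; ring. Qed.

Lemma quad_add (R : comNzRingType) (b x u r0 r1 u' r0' r1' : R) :
  (b * u + r0 + x * r1) + (b * u' + r0' + x * r1') =
  b * (u + u') + (r0 + r0') + x * (r1 + r1').
Proof. by ring. Qed.

Lemma quad_lin (R : comNzRingType) (b x c u r0 r1 u' r0' r1' : R) :
  c * (b * u + r0 + x * r1) + (b * u' + r0' + x * r1') =
  b * (c * u + u') + (c * r0 + r0') + x * (c * r1 + r1').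
Proof. by ring. Qed.

Lemma quad_s_alg (R : comNzRingType) (x c u0 u1 v0 v1 : R) :
  c * u0 + v0 + x * (c * u1 + v1) = c * (u0 + x * u1) + (v0 + x * v1).
Proof. by ring. Qed.

Lemma quad_rem (R : comNzRingType) (b x r0 r1 : R) : r0 + x * r1 = b * 0 + r0 + x * r1.
Proof. by ring. Qed.

Lemma quad_quo (R : comNzRingType) (b x u : R) : b * u = b * u + 0 + x * 0.
Proof. by ring. Qed.

(** Up to sign the divisor is monic of degree 2, so its nonzero multiples have degree at least 2 and
    cannot be linear in 'X. *)
Lemma poly_quad_uniq (D : idomainType) (y z r0 r1 : D) (u : {poly D}) :
  ('X * (y%:P - 'X) - z%:P) * u + r0%:P + 'X * r1%:P = 0 -> [/\ u = 0, r0 = 0 & r1 = 0].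
Proof.
move=> E; pose q : {poly D} := 'X^2 + (z%:P - y%:P * 'X).
have small (c d : D) : (size (c%:P + d%:P * 'X)%R <= 2)%N.
  rewrite (leq_trans (size_polyD _ _)) // geq_max (leq_trans (size_polyC_leq1 c)) //.
  by rewrite mul_polyC (leq_trans (size_scale_leq _ _)) // size_polyX.
have qs : size q = 3%N.
  rewrite size_polyDl size_polyXn //.
  by rewrite ltnS -mulNr -polyCN; apply: small.
have q0 : q != 0 by rewrite -size_poly_eq0 qs.
have quE : q * u = r0%:P + r1%:P * 'X.
  apply/eqP; rewrite -subr_eq0 -oppr_eq0; apply/eqP; rewrite -E /q; ring.
have u0 : u = 0.
  apply/eqP; apply: contraT => u0; have := small r0 r1.
  rewrite -quE size_mul // qs; have : (0 < size u)%N by rewrite size_poly_gt0.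
  by case: (size u).
move: quE; rewrite u0 mulr0 => /esym rE; split=> //.
  by have := congr1 (fun p : {poly D} => p`_0) rE; rewrite /= coefD coefC coefMX coef0 addr0.
by have := congr1 (fun p : {poly D} => p`_1) rE; rewrite /= coefD coefC coefMX coefC coef0 add0r.
Qed.

Lemma restrict_combE (R : gring) (V : gvars) (iota : {rmorphism R -> polyQ V}) r c
    (u v : restrict iota 'cV[polyQ V]_r) i :
  (c *: u + v : restrict iota 'cV[polyQ V]_r) i 0
    = iota c * (u : 'cV_r) i 0 + (v : 'cV_r) i 0.
Proof. by rewrite !mxE. Qed.

Section QuadraticExtension.
Variables (B : gvars) (y z : B).
Hypotheses (wt_y : wt y = 2%N) (wt_z : wt z = 4%N).

Let V := gvars_sum B single_var.
Let S : comNzRingType := polyQ B.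
Let T := polyQ V.
Let iota : {rmorphism polyQ B -> polyQ V} := rename (@bv B single_var).
Let x : T := X (iv B xvar).
Let b : T := x * (iota (X y) - x) - iota (X z).

Let quad_div (t : T) : exists u r0 r1, t = b * u + iota r0 + x * iota r1.
Proof.
elim/polyQ_ind: t => [c|[v|[]]|p q [u [r0 [r1 ->]]] [u' [r0' [r1' ->]]]
    |p q [u [r0 [r1 ->]]] [u' [r0' [r1' ->]]]].
- exists 0, (constQ B c), 0.
  by rewrite rmorph0 !mulr0 add0r addr0 /iota renameC.
- exists 0, (X v), 0.
  by rewrite rmorph0 !mulr0 add0r addr0 /iota renameX.
- exists 0, 0, 1.
  by rewrite rmorph0 rmorph1 mulr0 mulr1 !add0r.
- exists (u + u'), (r0 + r0'), (r1 + r1').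
  by rewrite (rmorphD iota r0 r0') (rmorphD iota r1 r1'); exact: quad_add.
- exists (u * (b * u' + iota r0' + x * iota r1') + (iota r0 + x * iota r1) * u'
    - iota r1 * iota r1'),
   (r0 * r0' - X z * (r1 * r1')), (r0 * r1' + r1 * r0' + X y * (r1 * r1')).
  rewrite (rmorphB iota) !(rmorphD iota) !(rmorphM iota).
  exact: quad_mul.
Qed.

Let P : comNzRingType := {poly (mpoly #|B| rat)}.

Let to_poly_var (i : 'I_#|V|) : P :=
  match enum_val i with inl p => (X p)%:P | inr _ => 'X end.

(** Reading the internal variable as the variable of univariate polynomials over Q[B] makes the
    degree argument of [poly_quad_uniq] available. *)
Let to_poly : {rmorphism T -> P} :=
  mmap (polyC \o constQ B : {rmorphism rat -> P}) to_poly_var.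

Let to_polyC c : to_poly (constQ V c) = (constQ B c)%:P.
Proof. exact: mmapC. Qed.

Let to_polyX v : to_poly (X v) = match v with inl p => (X p)%:P | inr _ => 'X end.
Proof. by rewrite /to_poly /= mmapX mmap1U /to_poly_var enum_rankK. Qed.

Let to_poly_iota c : to_poly (iota c) = c%:P.
Proof.
apply: (polyQ_rmorph_eq (f := to_poly \o iota) (g := polyC : {rmorphism S -> P})) => [a|v].
  exact: etrans (congr1 to_poly (renameC _ a)) (to_polyC a).
exact: etrans (congr1 to_poly (renameX _ v)) (to_polyX _).
Qed.

Let to_poly_x : to_poly x = 'X. Proof. exact: to_polyX. Qed.

Let to_poly_b : to_poly b = 'X * ((X y)%:P - 'X) - (X z)%:P.
Proof.
rewrite /b (rmorphB to_poly) (rmorphM to_poly) (rmorphB to_poly) to_poly_x.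
by rewrite (to_poly_iota (X y)) (to_poly_iota (X z)).
Qed.

Let b_neq0 : b != 0.
Proof.
apply/eqP => b0.
have := @poly_quad_uniq (mpoly #|B| rat) (X y) (X z) 0 0 1.
rewrite !mulr1 mulr0 !addr0 => H.
have [|/eqP] := H; last by rewrite oner_eq0.
by apply: etrans (esym to_poly_b) _; rewrite b0; apply: rmorph0.
Qed.

Let quad_uniq u r0 r1 : b * u + iota r0 + x * iota r1 = 0 -> r0 = 0 /\ r1 = 0.
Proof.
move=> E; have := @poly_quad_uniq (mpoly #|B| rat) (X y) (X z) r0 r1 (to_poly u).
case=> //; apply: etrans (_ : to_poly (b * u + iota r0 + x * iota r1) = 0); last first.
  by rewrite E; apply: rmorph0.
apply: esym; apply: etrans (rmorphD to_poly _ _) _.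
apply: (f_equal2 +%R); last first.
  by apply: etrans (rmorphM to_poly _ _) _; rewrite to_poly_x (to_poly_iota r1).
apply: etrans (rmorphD to_poly _ _) _; apply: (f_equal2 +%R); last exact: to_poly_iota.
by apply: etrans (rmorphM to_poly _ _) _; rewrite to_poly_b.
Qed.

Let quad_uniq2 u r0 r1 u' r0' r1' :
  b * u + iota r0 + x * iota r1 = b * u' + iota r0' + x * iota r1' ->
  [/\ u = u', r0 = r0' & r1 = r1'].
Proof.
move=> E; have [|E0 E1] := @quad_uniq (u - u') (r0 - r0') (r1 - r1').
  rewrite (rmorphB iota r0 r0') (rmorphB iota r1 r1').
  have := quad_add b x u (iota r0) (iota r1) (- u') (- iota r0') (- iota r1').
  by rewrite E => <-; rewrite !mulrN -!opprD subrr.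
move: E; rewrite (subr0_eq E0) (subr0_eq E1) => /addIr/addIr/(mulfI b_neq0) ->.
by split.
Qed.

Let rem (t : T) : polyQ B * polyQ B :=
  epsilon (inhabits (0, 0)) (fun r => exists u, t = b * u + iota r.1 + x * iota r.2).
Let rem0 t := (rem t).1.
Let rem1 t := (rem t).2.
Let quo (t : T) : T := epsilon (inhabits 0)
  (fun u => t = b * u + iota (rem0 t) + x * iota (rem1 t)).

Let quoP t : t = b * quo t + iota (rem0 t) + x * iota (rem1 t).
Proof.
have H : exists r u, t = b * u + iota r.1 + x * iota r.2.
  by have [u [r0 [r1 E]]] := quad_div t; exists (r0, r1), u.
exact: (epsilon_spec (inhabits 0) _ (epsilon_spec (inhabits (0, 0)) _ H)).
Qed.

Let quo_lin c t t' :
  [/\ quo (iota c * t + t') = iota c * quo t + quo t',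
      rem0 (iota c * t + t') = c * rem0 t + rem0 t' &
      rem1 (iota c * t + t') = c * rem1 t + rem1 t'].
Proof.
apply: quad_uniq2; apply: etrans (esym (quoP _)) _.
apply: etrans (f_equal2 +%R (f_equal ( *%R (iota c)) (quoP t)) (quoP t')) _.
rewrite (rmorphD iota (c * rem0 t)) (rmorphD iota (c * rem1 t)).
rewrite (rmorphM iota c (rem0 t)) (rmorphM iota c (rem1 t)).
exact: quad_lin.
Qed.

Let quo_lin_q c t t' : quo (iota c * t + t') = iota c * quo t + quo t'.
Proof. by case: (quo_lin c t t'). Qed.
Let quo_lin_0 c t t' : rem0 (iota c * t + t') = c * rem0 t + rem0 t'.
Proof. by case: (quo_lin c t t'). Qed.
Let quo_lin_1 c t t' : rem1 (iota c * t + t') = c * rem1 t + rem1 t'.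
Proof. by case: (quo_lin c t t'). Qed.

Let rem_iota r0 r1 : rem0 (iota r0 + x * iota r1) = r0 /\ rem1 (iota r0 + x * iota r1) = r1.
Proof.
by have [_ -> ->] := quad_uniq2 (u' := 0) (r0' := r0) (r1' := r1)
  (etrans (esym (quoP _)) (quad_rem b x (iota r0) (iota r1))).
Qed.

Let rem_b u : rem0 (b * u) = 0 /\ rem1 (b * u) = 0.
Proof.
have E : b * u = b * u + iota 0 + x * iota 0.
  by rewrite (rmorph0 iota); exact: quad_quo.
by have [_ -> ->] := quad_uniq2 (etrans (esym (quoP _)) E).
Qed.

Let xH : homogeneous 2 x. Proof. exact: (homogX (iv B xvar : V)). Qed.

Let iotaH d p : homogeneous d p -> homogeneous d (iota p).
Proof. exact: homog_rename. Qed.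

Let bH : homogeneous 4 b.
Proof.
have hy := iotaH (homogX y); rewrite wt_y in hy.
have hz := iotaH (homogX z); rewrite wt_z in hz.
apply: homogB hz; apply: (@homogM _ 2 2) => //.
exact: homogB hy xH.
Qed.

(** The homogeneous components of the division identity form another division of t, and uniqueness
    identifies the two. *)
Let quoH d t : homogeneous d t ->
  [/\ homogeneous (d - 4) (quo t), homogeneous d (rem0 t) & homogeneous (d - 2) (rem1 t)].
Proof.
move=> ht.
have E : t = b * hproj (d - 4) (quo t) + iota (hproj d (rem0 t))
    + x * iota (hproj (d - 2) (rem1 t)).
  apply: etrans (esym (hproj_id ht)) _; rewrite {1}[t]quoP.
  apply: etrans (raddfD (hproj d) _ _) (f_equal2 +%R _ _).
    apply: etrans (raddfD (hproj d) _ _) (f_equal2 +%R (hprojM d (quo t) bH) _).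
    exact: (hproj_graded (g := iota)).
  apply: etrans (hprojM d (iota (rem1 t)) xH) _.
  by apply: f_equal; apply: (hproj_graded (g := iota)).
have [E1 E2 E3] := quad_uniq2 (etrans (esym (quoP t)) E).
by split; [rewrite E1 | rewrite E2 | rewrite E3]; apply: hprojP.
Qed.

Let remD t t' : rem0 (t + t') = rem0 t + rem0 t' /\ rem1 (t + t') = rem1 t + rem1 t'.
Proof.
have [_] := quo_lin 1 t t'; rewrite (rmorph1 iota) mul1r => -> ->.
by rewrite !mul1r.
Qed.

Let rem_zero : rem0 0 = 0 /\ rem1 0 = 0.
Proof. by have := rem_b 0; rewrite mulr0. Qed.

Let rem_mul l D t :
  rem0 ((iota l + b * D) * t) = l * rem0 t /\ rem1 ((iota l + b * D) * t) = l * rem1 t.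
Proof.
have -> : (iota l + b * D) * t = iota l * t + b * (D * t) by rewrite mulrDl mulrA.
have [_ -> ->] := quo_lin l t (b * (D * t)).
by have [-> ->] := rem_b (D * t); rewrite !addr0.
Qed.

Let quad_s_lin c u0 u1 v0 v1 :
  iota (c * u0 + v0) + x * iota (c * u1 + v1)
    = iota c * (iota u0 + x * iota u1) + (iota v0 + x * iota v1).
Proof.
rewrite (rmorphD iota (c * u0)) (rmorphD iota (c * u1)).
rewrite (rmorphM iota c u0) (rmorphM iota c u1).
exact: quad_s_alg.
Qed.

Section Vector.
Variable r : nat.
Implicit Types v : restrict iota 'cV[polyQ V]_r.

Definition quad_p v : 'cV[polyQ B]_(r + r) := col_mx (map_mx rem0 v) (map_mx rem1 v).
Definition quad_s (w : 'cV[polyQ B]_(r + r)) : restrict iota 'cV[polyQ V]_r :=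
  \col_i (iota (usubmx w i 0) + x * iota (dsubmx w i 0)).
Definition quad_q v : restrict iota 'cV[polyQ V]_r := map_mx quo v.

Lemma quad_p_linear : linear quad_p.
Proof.
move=> c u v; rewrite /quad_p scale_col_mx add_col_mx.
by congr col_mx; apply/colP => i; rewrite !mxE; [exact: quo_lin_0 | exact: quo_lin_1].
Qed.

Lemma quad_q_linear : linear quad_q.
Proof.
move=> c u v; apply/colP => i.
apply: etrans (mxE _ _ _ _) _; rewrite restrict_combE.
apply: etrans (quo_lin_q _ _ _) _; apply: esym; rewrite restrict_combE.
by apply: (f_equal2 +%R); [apply: f_equal|]; apply: mxE.
Qed.

Lemma quad_s_linear : linear quad_s.
Proof.
move=> c u v; apply/colP => i; apply: etrans (mxE _ _ _ _) _.
apply: esym; rewrite restrict_combE.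
apply: etrans (f_equal2 +%R (f_equal _ (mxE _ _ _ _)) (mxE _ _ _ _)) _.
by rewrite !linearP !mxE; apply: esym; apply: quad_s_lin.
Qed.

Lemma quad_sK : cancel quad_s quad_p.
Proof.
move=> w; rewrite /quad_p -[RHS]vsubmxK.
by congr col_mx; apply/colP => i; rewrite mxE [quad_s w i 0]mxE;
  have [E0 E1] := rem_iota (usubmx w i 0) (dsubmx w i 0).
Qed.

Lemma quad_p_mul (v : 'cV[polyQ V]_r) : quad_p (b *: v) = 0.
Proof.
rewrite /quad_p -(col_mx0 (polyQ B) r r 1).
by congr col_mx; apply/colP => i; rewrite !mxE; have [E0 E1] := rem_b (v i 0).
Qed.

Lemma quad_qP v : v = b *: (quad_q v : 'cV_r) + quad_s (quad_p v).
Proof.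
apply/colP => i; apply: etrans (quoP (v i 0)) _; rewrite -addrA.
have E : quad_s (quad_p v) i 0 = iota (rem0 (v i 0)) + x * iota (rem1 (v i 0)).
  apply: etrans (mxE _ _ _ _) _.
  have E0 : usubmx (quad_p v) i 0 = rem0 (v i 0) :=
    etrans (f_equal (fun A : 'cV_r => A i 0) (col_mxKu _ _)) (mxE _ _ _ _).
  have E1 : dsubmx (quad_p v) i 0 = rem1 (v i 0) :=
    etrans (f_equal (fun A : 'cV_r => A i 0) (col_mxKd _ _)) (mxE _ _ _ _).
  exact: (f_equal2 (fun a b => iota a + x * iota b) E0 E1).
apply: esym; apply: etrans (mxE _ _ _ _) (f_equal2 +%R _ E).
by apply: etrans (mxE _ _ _ _) _; apply: f_equal; apply: mxE.
Qed.

Lemma quad_b_inj : injective ( *:%R b : 'cV[polyQ V]_r -> _).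
Proof.
move=> u v uv; apply/colP => i; apply: (mulfI b_neq0).
by have /colP/(_ i) := uv; rewrite !mxE.
Qed.

(** Entries congruent modulo [b] to elements of Q[B] act separately on the coordinates of 1 and of
    x. This is why the quotient splits into two copies. *)
Lemma quad_p_mx r' (L : 'M[polyQ B]_(r', r)) (M : 'M[polyQ V]_(r', r)) (v : 'cV_r) :
  (forall i j, exists D, M i j = iota (L i j) + b * D) ->
  map_mx rem0 (M *m v) = L *m map_mx rem0 v /\ map_mx rem1 (M *m v) = L *m map_mx rem1 v.
Proof.
move=> LM; split; apply/colP => i; rewrite !mxE.
  rewrite (big_morph rem0 (fun t t' => (remD t t').1) rem_zero.1).
  apply: eq_bigr => j _; have [D ->] := LM i j; rewrite mxE.
  exact: (rem_mul _ _ _).1.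
rewrite (big_morph rem1 (fun t t' => (remD t t').2) rem_zero.2).
apply: eq_bigr => j _; have [D ->] := LM i j; rewrite mxE.
exact: (rem_mul _ _ _).2.
Qed.
End Vector.

(** The basis element x has degree 2, so the shift by -1 stays on the coordinate of 1 and becomes a
    shift by 1 on that of x. *)
Let quad_p_homog r (dg : 'I_r -> int) d v :
  (forall i, homogeneous (d - (dg i - 1)) ((v : 'cV[polyQ V]_r) i 0)) ->
  forall i, homogeneous (d - dg_sum (fun i => dg i - 1) (fun i => dg i + 1) i)
    (quad_p v i 0).
Proof.
move=> hv i; have [k ->|k ->] := split_ordP i.
  rewrite dg_sum_lshift /quad_p col_mxEu mxE.
  by have [_ + _] := quoH (hv k).
rewrite dg_sum_rshift /quad_p col_mxEd mxE; have [_ _] := quoH (hv k).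
by congr homogeneous; ring.
Qed.

Let quad_s_homog r (dg : 'I_r -> int) d (v : 'cV[polyQ B]_(r + r)) :
  (forall i, homogeneous (d - dg_sum (fun i => dg i - 1) (fun i => dg i + 1) i) (v i 0)) ->
  forall i, homogeneous (d - (dg i - 1)) ((quad_s v : 'cV[polyQ V]_r) i 0).
Proof.
move=> hv i; rewrite mxE; apply: homogD.
  by have := hv (lshift r i); rewrite dg_sum_lshift mxE => /iotaH.
have -> : d - (dg i - 1) = 2 + (d - (dg i + 1)) by ring.
apply: homogM xH _; apply: iotaH.
by have := hv (rshift r i); rewrite dg_sum_rshift mxE.
Qed.

Variables (L : fmf B) (M0 : 'M[polyQ V]_(rk1 L, rk0 L)) (M1 : 'M[polyQ V]_(rk0 L, rk1 L)).
Let N := Fmf (@dg0 B L) (@dg1 B L) M0 M1.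
Hypotheses (LM0 : forall i j, exists D, M0 i j = iota (mx0 L i j) + b * D)
  (LM1 : forall i j, exists D, M1 i j = iota (mx1 L i j) + b * D).
Variables (delta k : int) (w0 a : polyQ V) (w : polyQ B).
Hypotheses (Nw : fmf_pot N w0) (Nh : fmf_homog N delta) (Lw : fmf_pot L w).
Hypotheses (wE : w0 + a * b = iota w) (kE : k = 4 - delta).

Lemma quad_elim :
  heq (kcone iota (N {{-1}}) k a b) (mf_of (L {{-1}} \oplus L {{1}})).
Proof.
have [N0 N1] := Nw.
have alg r (v : 'cV[polyQ V]_r) : w0 *: v + b *: (a *: v) = iota w *: v.
  by rewrite scalerA -scalerDl [b * a]mulrC wE.
have [C0 C1] := fmf_pot_sum (fmf_pot_shift (-1) Lw) (fmf_pot_shift 1 Lw).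
apply: (@cone_elim _ (mfo iota (N {{-1}})) _ _ _ _ k (mf_of (L {{-1}} \oplus L {{1}})) w
  delta 4 (@quad_p _) (@quad_p _) (@quad_s _) (@quad_s _) (@quad_q _) (@quad_q _)).
- exact: quad_p_linear.
- exact: quad_p_linear.
- exact: quad_s_linear.
- exact: quad_s_linear.
- exact: quad_q_linear.
- exact: quad_q_linear.
- exact: quad_b_inj.
- exact: quad_b_inj.
- exact: quad_p_mul.
- exact: quad_p_mul.
- exact: quad_sK.
- exact: quad_sK.
- exact: quad_qP.
- exact: quad_qP.
- by move=> v; exact: (esym (scalemxAr _ _ _)).
- by move=> v; exact: (esym (scalemxAr _ _ _)).
- by move=> v; exact: (mulpC a b v).
- by move=> v; exact: (mulpC a b v).
- move=> v /=; rewrite /restrict_fun /= mulmxA N0 mul_scalar_mx; exact: alg.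
- move=> v /=; rewrite /restrict_fun /= mulmxA N1 mul_scalar_mx; exact: alg.
- by move=> v; rewrite -[RHS]mul_scalar_mx -C0 -mulmxA.
- by move=> v; rewrite -[RHS]mul_scalar_mx -C1 -mulmxA.
- move=> v; apply: etrans (mul_block_col _ _ _ _ _ _) _.
  rewrite !mul0mx addr0 add0r.
  have [E0 E1] := quad_p_mx v LM0.
  by apply: esym; apply: (f_equal2 (fun a b => col_mx a b) E0 E1).
- move=> v; apply: etrans (mul_block_col _ _ _ _ _ _) _.
  rewrite !mul0mx addr0 add0r.
  have [E0 E1] := quad_p_mx v LM1.
  by apply: esym; apply: (f_equal2 (fun a b => col_mx a b) E0 E1).
- exact: kE.
- by move=> d v hv i; rewrite mxE; apply/homogN/hv.
- exact: quad_p_homog.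
- exact: quad_p_homog.
- exact: quad_s_homog.
- exact: quad_s_homog.
- by move=> d v hv i; rewrite mxE addrAC; have [+ _ _] := quoH (hv i).
- by move=> d v hv i; rewrite mxE addrAC; have [+ _ _] := quoH (hv i).
- exact: (fmf_mul_homog0 (fmf_homog_shift (-1) Nh)).
- exact: (fmf_mul_homog1 (fmf_homog_shift (-1) Nh)).
Qed.
End QuadraticExtension.

(** Only the entries containing the last argument change: z - w changes by -1 times t - g w, and
    [dpw1] by the multiple given by [dpw1_congr]. *)
Lemma line_mx_congr n (B V : gvars) (g : {rmorphism polyQ B -> polyQ V})
    (u v z w : polyQ B) (t : polyQ V) :
  (forall i j, exists D, mx0 (line n (g u) (g v) (g z) t) i j
     = g (mx0 (line n u v z w) i j) + (t - g w) * D) /\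
  (forall i j, exists D, mx1 (line n (g u) (g v) (g z) t) i j
     = g (mx1 (line n u v z w) i j) + (t - g w) * D).
Proof.
have [D0 E0] := dpw1_congr (g v) (g z) t (g w) n.+1.
have [A00 A01 A10 A11] := kos2_mx0 (2 - n.+1%:Z) (dpw0 (g u) (g v) (g z) n.+1) (g u - g v)
  (4 - n.+1%:Z) (dpw1 (g v) (g z) t n.+1) (g z - t).
have [B00 B01 B10 B11] := kos2_mx0 (2 - n.+1%:Z) (dpw0 u v z n.+1) (u - v)
  (4 - n.+1%:Z) (dpw1 v z w n.+1) (z - w).
have [A00' A01' A10' A11'] := kos2_mx1 (2 - n.+1%:Z) (dpw0 (g u) (g v) (g z) n.+1) (g u - g v)
  (4 - n.+1%:Z) (dpw1 (g v) (g z) t n.+1) (g z - t).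
have [B00' B01' B10' B11'] := kos2_mx1 (2 - n.+1%:Z) (dpw0 u v z n.+1) (u - v)
  (4 - n.+1%:Z) (dpw1 v z w n.+1) (z - w).
have ga : dpw0 (g u) (g v) (g z) n.+1 = g (dpw0 u v z n.+1) + (t - g w) * 0.
  by rewrite mulr0 addr0 (dpw0_rmorph g u v z n.+1).
have gb : g u - g v = g (u - v) + (t - g w) * 0 by rewrite mulr0 addr0 (rmorphB g).
have gc : dpw1 (g v) (g z) t n.+1 = g (dpw1 v z w n.+1) + (t - g w) * D0.
  by rewrite (dpw1_rmorph g v z w n.+1).
have gd : g z - t = g (z - w) + (t - g w) * (-1).
  by rewrite (rmorphB g z w) mulrN1 opprB addrA subrK.
have gN (p : polyQ B) (q D : polyQ V) : q = g p + (t - g w) * D ->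
    - q = g (- p) + (t - g w) * (- D).
  by move=> ->; rewrite opprD (rmorphN g p) mulrN.
split=> i j; case: (j01P i) => ->; case: (j01P j) => ->.
- exists 0; exact: etrans A00 (etrans ga (f_equal (fun p => g p + _) (esym B00))).
- exists (- (-1)); exact: etrans A01 (etrans (gN _ _ _ gd) (f_equal (fun p => g p + _) (esym B01))).
- exists D0; exact: etrans A10 (etrans gc (f_equal (fun p => g p + _) (esym B10))).
- exists 0; exact: etrans A11 (etrans gb (f_equal (fun p => g p + _) (esym B11))).
- exists 0; exact: etrans A00' (etrans gb (f_equal (fun p => g p + _) (esym B00'))).
- exists (-1); exact: etrans A01' (etrans gd (f_equal (fun p => g p + _) (esym B01'))).
- exists (- D0); exact: etrans A10' (etrans (gN _ _ _ gc) (f_equal (fun p => g p + _) (esym B10'))).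
- exists 0; exact: etrans A11' (etrans ga (f_equal (fun p => g p + _) (esym B11'))).
Qed.

Lemma sub_add_swap (S : comNzRingType) (a b c : S) : a + b - c = b - (c - a).
Proof. by ring. Qed.

Lemma double_degE n : n.+1%:Z - (4 - n.+1%:Z) = (2 * n.+1)%N%:Z - 4.
Proof. by lia. Qed.

(** * The digon *)

Section Digon.
Variables (n : nat) (f : {mpoly rat[2]}).
Hypothesis n_ge : (1 <= n)%N.
Hypothesis fE : f = pw ('X_ord0 : {mpoly rat[2]}) 'X_ord_max n.+1.

Variables (B : gvars) (y1 z1 y2 z2 : B).
Hypotheses (yz_uniq : uniq [:: y1; z1; y2; z2]).
Hypotheses (w1 : wt y1 = 2%N) (w2 : wt z1 = 4%N) (w3 : wt y2 = 2%N) (w4 : wt z2 = 4%N).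

Let I := gvars_sum single_var single_var.
Let V := gvars_sum B I.
Let V1 := gvars_sum B single_var.
Let x3 : V := iv B (bv single_var xvar).
Let x4 : V := iv B (iv single_var xvar).
Let x : polyQ V1 := X (iv B xvar).
Let inc1 (v : V1) : V := match v with inl p => inl p | inr _ => inr (inl tt) end.
Let ret1 (v : V) : V1 := match v with inl p => inl p | inr _ => inr tt end.

Let inc1K : cancel inc1 ret1. Proof. by case=> [|[]]. Qed.
Let x4P v : v = x4 \/ v = inc1 (ret1 v).
Proof. by case: v => [|[[]|[]]]; [right | right | left]. Qed.
Let inc1_x4 v : inc1 v != x4. Proof. by case: v => [|[]]. Qed.
Let wt_inc1 v : wt (inc1 v) = wt v. Proof. by case: v => [|[]]. Qed.

Let iota : {rmorphism polyQ B -> polyQ V1} := rename (@bv B single_var).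
Let gy : polyQ V1 := iota (X y2) - x.
Let g1 : {rmorphism polyQ V -> polyQ V1} := glue1 ret1 x4 gy.
Let g1_inc v : g1 (X (inc1 v)) = X v. Proof. exact: glue1_inc. Qed.
Let g1_x4 : g1 (X x4) = gy. Proof. exact: glue1_y'. Qed.

Let iotaX p : iota (X p) = X (bv _ p). Proof. exact: renameX. Qed.
Let g1_bv p : g1 (X (bv _ p)) = iota (X p).
Proof. exact: etrans (g1_inc (bv _ p)) (esym (iotaX p)). Qed.
Let g1_x3 : g1 (X x3) = x. Proof. exact: (g1_inc (iv B xvar)). Qed.

Let t : polyQ V1 := x * (iota (X y2) - x).

Let g1D : g1 (X x3 + X x4) = iota (X y2).
Proof.
apply: etrans (rmorphD g1 _ _) _.
by apply: etrans (f_equal2 +%R g1_x3 g1_x4) _; rewrite /gy addrC subrK.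
Qed.

Let g1M : g1 (X x3 * X x4) = t.
Proof.
by apply: etrans (rmorphM g1 _ _) _; apply: etrans (f_equal2 *%R g1_x3 g1_x4) _.
Qed.

Let potB : polyQ B := pw (X y1) (X z1) n.+1 - pw (X y2) (X z2) n.+1.

(** Here [mfVout] provides the Koszul entries. The first, x3 + x4 - y2, eliminates x4 and turns x3
    x4 into t = x (y2 - x); the second becomes t - z2. Modulo it, [mfVin], which has t as last
    argument, has the entries of the double line, with z2 as last argument. *)
Lemma digon :
  HMF_iso potB
    (over_boundary
        (mfVin f (bv I y1) (bv I z1) x3 x4 \boxt mfVout f x3 x4 (bv I y2) (bv I z2)))
    (mf_of (mfL f y1 z1 y2 z2 {{ -1 }} \oplus mfL f y1 z1 y2 z2 {{ 1 }})).
Proof.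
move: (yz_uniq); rewrite /= !inE !negb_or => /and4P[/and3P[n1 n2 n3] /andP[n4 n5] n6 _].
have [|||||-> [N1 N2]] := @mfVin_line n f _ n_ge fE (bv I y1) (bv I z1) x3 x4 => //.
  by rewrite /= !inE /= !orbF !andbT; apply: contraNneq n1 => -[->].
have [|||||-> [N3 N4]] := @mfVout_line n f _ n_ge fE x3 x4 (bv I y2) (bv I z2) => //.
  by rewrite /= !inE /= !andbT; apply: contraNneq n6 => -[->].
have [|||||-> [N5 N6]] := @mfL_line n f _ n_ge fE y1 z1 y2 z2 => //.
have hx (W : gvars) (v : W) k : wt v = k -> homogeneous k%:Z (X v).
  by move=> <-; apply: homogX.
have hD : homogeneous 2 (X x3 + X x4) by apply: homogD; apply: hx.
have hM : homogeneous 4 (X x3 * X x4) by apply: (@homogM _ 2 2); apply: hx.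
set U := X x3 + X x4 in N1 N3 hD *; set T := X x3 * X x4 in N2 N4 hM *.
pose N : fmf V := line n (X (bv I y1)) U (X (bv I z1)) T.
have Np : fmf_pot N (pw (X (bv I y1)) (X (bv I z1)) n.+1 - pw U T n.+1) by exact: line_pot.
have Nh : fmf_homog N n.+1%:Z by apply: line_homog => //; apply: hx.
have wE : pw (X (bv I y1)) (X (bv I z1)) n.+1 - pw U T n.+1 +
   (pw U T n.+1 - pw (X (bv I y2)) (X (bv I z2)) n.+1) = rename (@bv B I) potB.
  rewrite (rmorphB (rename (@bv B I))) !(pw_rmorph (rename (@bv B I))).
  by rewrite !renameX addrA subrK.
split.
- apply: (is_mf_mfo (gbasis_bv _ _)); rewrite -wE.
  exact: fmf_pot_tens Np (line_pot _ _ _ _ _).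
- by apply: is_mf_mf_of; apply: fmf_pot_sum; apply: fmf_pot_shift; apply: line_pot.
have hy2 : homogeneous 2 (X (bv I y2)) by apply: hx.
have hz2 : homogeneous 4 (X (bv I z2)) by apply: hx.
pose a1 := dpw0 U (X (bv I y2)) T n.+1; pose b1 := U - X (bv I y2).
pose a2 := dpw1 (X (bv I y2)) T (X (bv I z2)) n.+1; pose b2 := T - X (bv I z2).
pose k1 : int := 2 - n.+1%:Z; pose k2 : int := 4 - n.+1%:Z.
apply: heq_trans (heq_kcone2 _ N (-1) k1 a1 b1 k2 a2 b2) _.
have b1E : b1 = X x4 - rename inc1 gy.
  apply: etrans (sub_add_swap (X x3) (X x4) (X (bv I y2))) (f_equal _ _).
  apply: f_equal; apply: esym; apply: etrans (rmorphB (rename inc1) _ _) _.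
  apply: (f_equal2 (fun a b => a - b)) (renameX inc1 _).
  by apply: etrans (f_equal _ (iotaX y2)) _; apply: renameX.
have gyH : homogeneous 2 gy.
  apply: homogB; last exact: (hx V1).
  by apply: homog_rename => //; apply: hx.
have E1 : elim g1 (rename inc1) b1 2.
  by apply: (elim_glue1 inc1K x4P inc1_x4 wt_inc1) => //; left.
have a2H : homogeneous (n.+1%:Z - k2) a2.
  rewrite double_degE.
  exact: homog_dpw1.
have b2H : homogeneous (n.+1%:Z + k2) b2.
  by rewrite /k2 addrC subrK; apply: homogB.
apply: heq_trans (kcone2_elim (iota' := iota) (w := potB) E1 _ _ (N := N {{-1}}) Np
  (fmf_homog_shift _ Nh) (erefl k1) a2H b2H _) _.
- by apply: (glue1_rename (i0 := @bv B I) (i1 := @bv B single_var) (inc1 := inc1)).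
- by move=> c; apply: rename_comp.
- rewrite -wE; apply: etrans (f_equal _ (dpwP U (X (bv I y2)) T (X (bv I z2)) n.+1)).
  by rewrite addrAC -addrA.
have FE : fmf_map g1 N = line n (iota (X y1)) (iota (X y2)) (iota (X z1)) t.
  apply: etrans (line_map n g1 _ _ _ _) _.
  exact: (f_equal4 (@line n V1) (g1_bv y1) g1D (g1_bv z1) g1M).
have b2E : g1 b2 = t - iota (X z2).
  by apply: etrans (rmorphB g1 _ _) _; apply: (f_equal2 (fun a b => a - b) g1M (g1_bv z2)).
rewrite -[fmf_map g1 (N {{-1}})]/((fmf_map g1 N) {{-1}}) FE b2E.
have [C0 C1] := line_mx_congr n iota (X y1) (X y2) (X z1) (X z2) t.
have a2E : g1 a2 = dpw1 (iota (X y2)) t (iota (X z2)) n.+1.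
  apply: etrans (dpw1_rmorph g1 _ _ _ _) _.
  exact: (f_equal3 (fun a b c => dpw1 a b c n.+1) (g1_bv y2) g1M (g1_bv z2)).
have Lh : fmf_homog (line n (iota (X y1)) (iota (X y2)) (iota (X z1)) t) n.+1%:Z.
  by rewrite -FE; apply: fmf_homog_map Nh; exact: elim_evH E1.
have Lp := line_pot n (X y1) (X y2) (X z1) (X z2).
have Np1 := line_pot n (iota (X y1)) (iota (X y2)) (iota (X z1)) t.
have potE : pw (iota (X y1)) (iota (X z1)) n.+1 - pw (iota (X y2)) t n.+1
    + g1 a2 * (t - iota (X z2)) = iota potB.
  rewrite a2E dpw1P addrA subrK; apply: esym.
  apply: etrans (rmorphB iota _ _) _.
  exact: (f_equal2 (fun a b => a - b) (pw_rmorph iota _ _ _) (pw_rmorph iota _ _ _)).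
apply: (quad_elim w3 w4 (L := line n (X y1) (X y2) (X z1) (X z2)) C0 C1 _ _ Lp potE (erefl _)).
- exact: Np1.
- exact: Lh.
Qed.
End Digon.

(** * The closed double line *)

Section NormalForm.
Import Order.TTheory.
Variables (k : nat) (F : fieldType) (I : {mpoly F[k]} -> Prop).
Hypotheses (I0 : I 0) (Ilin : forall c p q, I p -> I q -> I (c *: p + q)).
Implicit Types (m : 'X_{1..k}) (p q r : {mpoly F[k]}).

Definition leading m : Prop := exists q, [/\ I q, q != 0 & mlead q = m].
(** The span of the monomials that lead no element of [I]. It is a complement of the subspace [I],
    so reduction modulo [I] is a linear projection onto it. *)
Definition standard r : Prop := forall m, m \in msupp r -> ~ leading m.

Let IB p q : I p -> I q -> I (p - q).
Proof. by move=> hp hq; rewrite addrC -scaleN1r; apply: Ilin. Qed.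

Let mlead_lt p m : p != 0 -> (mlead p <= m)%O -> p@_m = 0 -> (mlead p < m)%O.
Proof.
move=> p0 pm pm0; rewrite lt_neqAle pm andbT.
by apply: contraNneq p0 => E; rewrite -mleadc_eq0 E pm0.
Qed.

Let mleadB_le2 p q m : (mlead p <= m)%O -> (mlead q <= m)%O -> (mlead (p - q) <= m)%O.
Proof.
move=> pm qm; apply: le_trans (mleadB_le _ _) _.
by rewrite leUx pm.
Qed.

Lemma standard_lin c p q : standard p -> standard q -> standard (c *: p + q).
Proof.
move=> hp hq m /msuppD_le; rewrite mem_cat => /orP[/msuppZ_le|]; [exact: hp|exact: hq].
Qed.

Lemma standard0 : standard 0. Proof. by move=> m; rewrite msupp0. Qed.

(** Well-founded induction on a bound m for the leading monomial: the term at m is cancelled by an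
    element of [I] if m is leading, and moved to the remainder otherwise. *)
Lemma standard_exists p : exists r, standard r /\ I (p - r).
Proof.
suff H m : forall p, (mlead p <= m)%O -> exists r, standard r /\ I (p - r).
  exact: H (lexx _).
elim/(well_founded_ind (@ltom_wf k)): m => m IH {}p pm.
have rec q : (mlead q <= m)%O -> q@_m = 0 -> exists r, standard r /\ I (q - r).
  move=> qm qm0; have [->|q0] := eqVneq q 0.
    by exists 0; rewrite subr0; split=> //; apply: standard0.
  exact: IH (mlead_lt q0 qm qm0) _ (lexx _).
have [[q [Iq q0 qm]]|nlm] := excluded_middle_informative (leading m).
  pose c := p@_m / q@_m.
  have qm0 : q@_m != 0 by rewrite -qm mleadc_eq0.
  have [||r [sr Ir]] := rec (p - c *: q).
  - apply: mleadB_le2 => //; rewrite -qm; exact: mleadZ_le.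
  - by rewrite mcoeffB mcoeffZ divfK // subrr.
  exists r; split=> //; have := Ilin c Iq Ir.
  by rewrite addrCA addrA addrNK addrC; congr I; rewrite addrC.
have [||r [sr Ir]] := rec (p - p@_m *: 'X_[m]).
- apply: mleadB_le2 => //; apply: le_trans (mleadZ_le _ _) _.
  by rewrite mleadXm.
- by rewrite mcoeffB mcoeffZ mcoeffX eqxx mulr1 subrr.
exists (p@_m *: 'X_[m] + r); split; last by rewrite opprD addrA.
apply: standard_lin => // m'; rewrite msuppX inE => /eqP -> //.
Qed.

Definition nform p := epsilon (inhabits 0) (fun r => standard r /\ I (p - r)).

Lemma nform_standard p : standard (nform p).
Proof. by have [] := epsilon_spec (inhabits 0) _ (standard_exists p). Qed.

Lemma nformP p : I (p - nform p).
Proof. by have [] := epsilon_spec (inhabits 0) _ (standard_exists p). Qed.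

Lemma standard_eq0 r : standard r -> I r -> r = 0.
Proof.
move=> sr Ir; apply/eqP/negPn/negP => r0.
by apply: (sr _ (mlead_supp r0)); exists r.
Qed.

Lemma nform_uniq p r : standard r -> I (p - r) -> nform p = r.
Proof.
move=> sr Ir; apply/eqP; rewrite -subr_eq0; apply/eqP/standard_eq0.
  by rewrite addrC -scaleN1r; apply: standard_lin => //; apply: nform_standard.
have := IB Ir (nformP p); congr I.
by rewrite opprB addrC addrA addrNK.
Qed.

Lemma nform_lin c p q : nform (c *: p + q) = c *: nform p + nform q.
Proof.
apply: nform_uniq; first by apply: standard_lin; apply: nform_standard.
have := Ilin c (nformP p) (nformP q); congr I.
by rewrite scalerBr opprD addrACA.
Qed.

Lemma nform_eq0 p : I p -> nform p = 0.
Proof. by move=> Ip; apply: nform_uniq; [exact: standard0 | rewrite subr0]. Qed.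

End NormalForm.

(** On the diagonal, the recursions of the divided differences are the Leibniz rule applied to the
    recursion of [pw]. *)
Lemma mderiv_pw k : 
  (pw 'X_ord0 'X_ord_max k : {mpoly rat[2]})^`M(ord0) = dpw0 'X_ord0 'X_ord0 'X_ord_max k /\
  (pw 'X_ord0 'X_ord_max k : {mpoly rat[2]})^`M(ord_max) = dpw1 'X_ord0 'X_ord_max 'X_ord_max k.
Proof.
set s : {mpoly rat[2]} := 'X_ord0; set t : {mpoly rat[2]} := 'X_ord_max.
have UU (i : 'I_2) : (U_(i) - U_(i) = 0)%MM by apply/mnmP => j; rewrite !mnmE subnn.
have s0 : s^`M(ord0) = 1 by rewrite mderivX mnm1E eqxx scale1r UU mpolyX0.
have t1 : t^`M(ord_max) = 1 by rewrite mderivX mnm1E eqxx scale1r UU mpolyX0.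
have s1 : s^`M(ord_max) = 0 by rewrite mderivX mnm1E scale0r.
have t0 : t^`M(ord0) = 0 by rewrite mderivX mnm1E scale0r.
have c i : (2%:R : {mpoly rat[2]})^`M(i) = 0 by rewrite [LHS]raddfMn -mpolyC1 /= mderivC mul0rn.
suff [] : ((pw s t k)^`M(ord0) = dpw0 s s t k /\ (pw s t k)^`M(ord_max) = dpw1 s t t k) /\
    ((pw s t k.+1)^`M(ord0) = dpw0 s s t k.+1 /\ (pw s t k.+1)^`M(ord_max) = dpw1 s t t k.+1)
  by [].
elim: k => [|k [[A0 A1] [B0 B1]]].
  by rewrite !pw0 !pw1 dpw00 dpw01 dpw10 dpw11 !c s0 s1.
split=> //; rewrite dpw0SS dpw1SS pwSS !mderivB !mderivM.
by rewrite A0 A1 B0 B1 s0 s1 t0 t1 !mul0r !mul1r !add0r opprD addrA addrAC.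
Qed.

Fixpoint hs_rec (S : comNzRingType) (s t : S) k : S :=
  if k is k1.+1 then
    if k1 is k2.+1 then s * hs_rec s t k1 - t * hs_rec s t k2 else s
  else 1.

(* In terms of [s = x + y] and [t = x * y], the complete symmetric polynomial in [x] and [y]. *)
HB.lock Definition hs (S : comNzRingType) (s t : S) (k : nat) : S := hs_rec s t k.

Section CompleteSymmetric.
Variable S : comNzRingType.
Implicit Types s t : S.

Lemma hs0 s t : hs s t 0 = 1. Proof. by rewrite hs.unlock. Qed.

Lemma hs1 s t : hs s t 1 = s. Proof. by rewrite hs.unlock. Qed.

Lemma hsSS s t k : hs s t k.+2 = s * hs s t k.+1 - t * hs s t k.
Proof. by rewrite hs.unlock. Qed.

Lemma pw_hs s t k : pw s t k.+2 = hs s t k.+2 - t * hs s t k.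
Proof.
suff [] : pw s t k.+2 = hs s t k.+2 - t * hs s t k /\
          pw s t k.+3 = hs s t k.+3 - t * hs s t k.+1 by [].
elim: k => [|k [IH1 IH2]].
  by rewrite !pwSS !hsSS pw0 pw1 hs0 hs1; split; ring.
by split=> //; rewrite pwSS IH1 IH2 !hsSS; ring.
Qed.

(** The classical formula by which the derivative of the power sum p_m with respect to the
    elementary symmetric e_j is (-1)^(j-1) m h_(m-j), for j = 1, 2 and m = k+2. *)
Lemma dpw_hs s t k :
  dpw0 s s t k.+2 = k.+2%:R * hs s t k.+1 /\ dpw1 s t t k.+2 = - (k.+2%:R * hs s t k).
Proof.
suff [] : (dpw0 s s t k.+2 = k.+2%:R * hs s t k.+1 /\
    dpw1 s t t k.+2 = - (k.+2%:R * hs s t k)) /\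
  (dpw0 s s t k.+3 = k.+3%:R * hs s t k.+2 /\
    dpw1 s t t k.+3 = - (k.+3%:R * hs s t k.+1)) by [].
elim: k => [|k [[A0 A1] [B0 B1]]].
  rewrite !dpw0SS !dpw1SS !pwSS !hsSS !pw0 !pw1 !dpw00 !dpw01 !dpw10 !dpw11 !hs0 !hs1.
  by repeat split; ring.
split=> //; rewrite dpw0SS dpw1SS A0 A1 B0 B1 !pw_hs !hsSS.
by split; ring.
Qed.
End CompleteSymmetric.

Lemma hs_rmorph (S T : comNzRingType) (g : {rmorphism S -> T}) s t k :
  g (hs s t k) = hs (g s) (g t) k.
Proof.
suff [] : g (hs s t k) = hs (g s) (g t) k /\ g (hs s t k.+1) = hs (g s) (g t) k.+1 by [].
elim: k => [|k [IH1 IH2]]; first by rewrite !hs0 !hs1 rmorph1.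
by split=> //; rewrite !hsSS rmorphB !rmorphM IH1 IH2.
Qed.

Lemma hs_exp (S : comNzRingType) (s : S) k : hs s 0 k = s ^+ k.
Proof.
suff [] : hs s 0 k = s ^+ k /\ hs s 0 k.+1 = s ^+ k.+1 by [].
elim: k => [|k [IH1 IH2]]; first by rewrite hs0 hs1 expr0 expr1.
by split=> //; rewrite hsSS IH2 mul0r subr0 -exprS.
Qed.

Section RegularSequence.
Variables (S T : idomainType) (g : {rmorphism S -> T}) (s t : S).
Hypotheses (t0 : t != 0) (gt : g t = 0) (gs : g s != 0).
Hypothesis ker_g : forall p, g p = 0 -> exists q, p = t * q.

(** Let h_k be [hs s t k]. The relation for h_(k+1), h_(k+2) becomes h_(k+1) (s u - v) = t h_k u by
    the recursion. Modulo t, h_(k+1) is a power of s and nonzero, so s u - v = t q, and cancelling t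
    leaves the relation for h_k, h_(k+1) between q and u. *)
Lemma hs_syzygy k u v : hs s t k * v = hs s t k.+1 * u ->
  exists x, u = hs s t k * x /\ v = hs s t k.+1 * x.
Proof.
elim: k u v => [|k IH] u v; first by rewrite hs0 hs1 mul1r => ->; exists u; rewrite mul1r.
rewrite hsSS => E.
have E1 : hs s t k.+1 * (s * u - v) = t * (hs s t k * u) by rewrite mulrBr E; ring.
have [q qE] : exists q, s * u - v = t * q.
  apply: ker_g; have := congr1 g E1.
  rewrite !rmorphM gt mul0r hs_rmorph gt hs_exp => /eqP.
  by rewrite mulf_eq0 expf_eq0 (negPf gs) andbF => /eqP.
have [|x [qx ux]] := IH q u.
  by apply: (mulfI t0); rewrite -E1 qE; ring.
exists x; split=> //; have -> : v = s * u - t * q by rewrite -qE; ring.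
by rewrite ux qx; ring.
Qed.

Lemma dpw_syzygy k u v : (k.+2%:R : S) \is a GRing.unit ->
  dpw1 s t t k.+2 * u = dpw0 s s t k.+2 * v ->
  exists x, u = dpw0 s s t k.+2 * x /\ v = dpw1 s t t k.+2 * x.
Proof.
have [-> ->] := dpw_hs s t k => ku E.
have [|x [vx ux]] := @hs_syzygy k v (- u).
  by apply: (mulrI ku); rewrite mulrN -mulrN mulrA mulrN -mulNr E mulrA.
exists (- (k.+2%:R^-1 * x)); rewrite -[u]opprK ux vx.
have cancel h : k.+2%:R * h * (k.+2%:R^-1 * x) = h * x.
  by rewrite [_ * h]mulrC -mulrA mulVKr.
by rewrite mulrN mulrN mulNr opprK !cancel.
Qed.
End RegularSequence.

(** Consequently the components of a standard polynomial are standard. *)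
Lemma msupp_hproj (V : gvars) d (p : polyQ V) m : m \in msupp (hproj d p) -> m \in msupp p.
Proof.
case: d => [e|e]; last by rewrite msupp0.
rewrite /hproj pihomogE => /msupp_sum_le /flatten_mapP[m' + /msuppZ_le].
by rewrite mem_filter => /andP[_ m'p]; rewrite msuppX inE => /eqP->.
Qed.

Lemma koszul_split_alg (S : comNzRingType) (a1 a2 u v u' v' : S) :
  a1 * v' - a2 * u' = - (a1 * v - a2 * u) -> a2 * (u + u') = a1 * (v + v').
Proof.
move=> E; apply/eqP; rewrite -subr_eq0 -oppr_eq0; apply/eqP.
have -> : - (a2 * (u + u') - a1 * (v + v')) = (a1 * v' - a2 * u') + (a1 * v - a2 * u) by ring.
by rewrite E addNr.
Qed.

Lemma koszul_lin_alg (S : comNzRingType) (a1 a2 c u v u' v' : S) :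
  a1 * (c * v + v') - a2 * (c * u + u') = c * (a1 * v - a2 * u) + (a1 * v' - a2 * u').
Proof. by ring. Qed.

Lemma lin_alg2 (S : comNzRingType) (a c x y : S) : a * (c * x + y) = c * (a * x) + a * y.
Proof. by ring. Qed.

Lemma lin_opp_alg (S : comNzRingType) (c u u' w w' : S) :
  c * - (u + u') + - (w + w') = - (c * u + w + (c * u' + w')).
Proof. by ring. Qed.

Lemma koszul_quo_alg (S : comNzRingType) (a1 a2 r s i q : S) :
  a1 * (r - a2 * q) - a2 * (- (s + a1 * q)) = r * a1 + s * a2 + 0 * i.
Proof. by ring. Qed.

Lemma koszul_diff_alg (S : comNzRingType) (a1 a2 u v u' v' : S) :
  a1 * v' - a2 * u' = a1 * v - a2 * u -> a2 * (u - u') = a1 * (v - v').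
Proof.
move=> E; apply/eqP; rewrite -subr_eq0 -oppr_eq0; apply/eqP.
have -> : - (a2 * (u - u') - a1 * (v - v')) = (a1 * v - a2 * u) - (a1 * v' - a2 * u') by ring.
by rewrite E subrr.
Qed.

(** * The Koszul complex of a regular sequence of length two *)

Section KoszulHomology.
Variables (V : gvars) (a1 a2 : polyQ V).
Hypothesis a1_neq0 : a1 != 0.
Hypothesis syzygy : forall u v, a2 * u = a1 * v -> exists x, u = a1 * x /\ v = a2 * x.
Variables d1 d2 : int.
Hypotheses (a1H : homogeneous d1 a1) (a2H : homogeneous d2 a2).

Let k := #|V|.
Let I1 (p : mpoly k rat) : Prop := exists q : polyQ V, p = a1 * q.
Let I2 (p : mpoly k rat) : Prop := (p : polyQ V) \in ideal2 a1 a2.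

Let scaleE c (p : mpoly k rat) : constQ V c * p = c *: p.
Proof. exact: mul_mpolyC. Qed.

Let I1_0 : I1 0. Proof. by exists 0; rewrite mulr0. Qed.
Let I1_lin c p q : I1 p -> I1 q -> I1 (c *: p + q).
Proof.
move=> [p' ->] [q' ->]; exists (constQ V c * p' + q').
by rewrite -scaleE; apply: esym; exact: lin_alg2.
Qed.
Let I2_0 : I2 0. Proof. exact: rpred0. Qed.
Let I2_lin c p q : I2 p -> I2 q -> I2 (c *: p + q).
Proof. by move=> hp hq; rewrite -scaleE; apply: rpredD hq; apply: ideal2M. Qed.

Definition nf (p : polyQ V) : polyQ V := nform I2 p.

Lemma nf_lin c p q : nf (constQ V c * p + q) = constQ V c * nf p + nf q.
Proof. by rewrite /nf !scaleE; exact: (nform_lin I2_0 I2_lin). Qed.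

Lemma nfP p : p - nf p \in ideal2 a1 a2.
Proof. exact: (nformP I2_0 I2_lin). Qed.

Lemma nf_eq0 p : p \in ideal2 a1 a2 -> nf p = 0.
Proof. exact: (nform_eq0 I2_0 I2_lin). Qed.

Let I2_hproj d p : I2 p -> I2 (hproj d p).
Proof.
move=> /ideal2P[r [s ->]]; apply/ideal2P.
exists (hproj (d - d1) r), (hproj (d - d2) s).
apply: etrans (raddfD (hproj d) (r * a1) (s * a2)) (f_equal2 +%R _ _).
  exact: etrans (f_equal (hproj d) (mulrC r a1)) (etrans (hprojM d r a1H) (mulrC _ _)).
exact: etrans (f_equal (hproj d) (mulrC s a2)) (etrans (hprojM d s a2H) (mulrC _ _)).
Qed.

(** The component of degree d of the normal form is again standard and congruent to p, hence equal
    to the normal form. *)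
Lemma nf_homog d p : homogeneous d p -> homogeneous d (nf p).
Proof.
move=> hp; suff -> : nf p = hproj d (nf p) by apply: hprojP.
apply: (nform_uniq I2_0 I2_lin).
  by move=> m /msupp_hproj; apply: (nform_standard I2_0 I2_lin).
rewrite -{1}(hproj_id hp); have := I2_hproj d (nfP p).
by congr I2; exact: (raddfB (hproj d) p (nf p)).
Qed.

(** A preimage of p under the map (u, v) to a1 v - a2 u, normalized by u being standard modulo (a1).
    Two preimages differ by a syzygy (a1 x, a2 x), and a standard multiple of a1 is zero, so the
    preimage is unique. Uniqueness is what makes [sec] linear over the rationals. *)
Let sec_spec (p : polyQ V) (uv : polyQ V * polyQ V) :=
  standard I1 uv.1 /\ a1 * uv.2 - a2 * uv.1 = p.

Let sec (p : polyQ V) : polyQ V * polyQ V := epsilon (inhabits (0, 0)) (sec_spec p).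

Let secP p : p \in ideal2 a1 a2 -> sec_spec p (sec p).
Proof.
move=> /ideal2P[r [s pE]]; apply: epsilon_spec.
have [q qE] := nformP I1_0 I1_lin (- s).
exists (nform I1 (- s), r - a2 * q); split; first exact: (nform_standard I1_0 I1_lin).
have -> : nform I1 (- s) = - (s + a1 * q).
  by rewrite -qE opprD opprB addrA addrAC addrC opprK addNr addr0.
by apply: etrans (koszul_quo_alg a1 a2 r s 0 q) _; rewrite mul0r addr0 pE.
Qed.

Let sec_uniq p uv uv' : sec_spec p uv -> sec_spec p uv' -> uv = uv'.
Proof.
case: uv uv' => [u v] [u' v'] [/= su <-] [/= su' E].
have [|x [ux vx]] := syzygy (u := u - u') (v := v - v').
  exact: koszul_diff_alg E.
have u0 : u - u' = 0.
  apply: (standard_eq0 (I := I1)); last by exists x.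
  by rewrite addrC -scaleN1r; exact: standard_lin.
have x0 : x = 0.
  by have /eqP := u0; rewrite ux mulf_eq0 (negPf a1_neq0) => /eqP.
by rewrite (subr0_eq u0); congr pair; apply: subr0_eq; rewrite vx x0 mulr0.
Qed.

Let sec_lin c p q : p \in ideal2 a1 a2 -> q \in ideal2 a1 a2 ->
  sec (constQ V c * p + q) =
    (constQ V c * (sec p).1 + (sec q).1, constQ V c * (sec p).2 + (sec q).2).
Proof.
move=> hp hq; have [sp pE] := secP hp; have [sq qE] := secP hq.
apply: (@sec_uniq (constQ V c * p + q)).
  by apply: secP; apply: rpredD hq; apply: ideal2M.
split; first by rewrite /= scaleE; exact: standard_lin.
by rewrite -[in RHS]pE -[in RHS]qE; exact: koszul_lin_alg.
Qed.

(* A contracting homotopy of the resolution [S -> S^2 -> S] of [S / (a1, a2)], linear over Q. *)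
Definition htpy0 (w : polyQ V) : polyQ V * polyQ V := sec (nf w - w).

Lemma htpy0P w : a1 * (htpy0 w).2 - a2 * (htpy0 w).1 = nf w - w.
Proof.
have [//|_ E] := @secP (nf w - w); last exact: E.
by rewrite -opprB rpredN; exact: nfP.
Qed.

Lemma htpy0_lin c p q :
  (htpy0 (constQ V c * p + q)).1 = constQ V c * (htpy0 p).1 + (htpy0 q).1 /\
  (htpy0 (constQ V c * p + q)).2 = constQ V c * (htpy0 p).2 + (htpy0 q).2.
Proof.
have H w : nf w - w \in ideal2 a1 a2 by rewrite -opprB rpredN; exact: nfP.
have -> : htpy0 (constQ V c * p + q) = sec (constQ V c * (nf p - p) + (nf q - q)).
  by rewrite /htpy0 nf_lin mulrBr opprD addrACA.
by rewrite sec_lin.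
Qed.

(** The boundary a1 v - a2 u lies in the ideal, so its normal form is zero, and adding [htpy0] of it
    to (u, v) gives a syzygy. By exactness this is a multiple of (a1, a2); the homotopy is minus the
    multiplier. *)
Let htpy1_spec (u v x : polyQ V) :=
  a1 * x = - (u + (htpy0 (a1 * v - a2 * u)).1) /\
  a2 * x = - (v + (htpy0 (a1 * v - a2 * u)).2).

Definition htpy1 (u v : polyQ V) : polyQ V := epsilon (inhabits 0) (htpy1_spec u v).

Lemma htpy1P u v :
  a1 * htpy1 u v = - (u + (htpy0 (a1 * v - a2 * u)).1) /\
  a2 * htpy1 u v = - (v + (htpy0 (a1 * v - a2 * u)).2).
Proof.
apply: (epsilon_spec (inhabits 0) (htpy1_spec u v)).
set p := a1 * v - a2 * u; have := htpy0P p.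
have -> : nf p = 0.
  apply: nf_eq0; apply/ideal2P; exists v, (- u).
  by rewrite mulNr [v * _]mulrC [u * _]mulrC.
rewrite sub0r => /koszul_split_alg/syzygy[x [ux vx]].
by exists (- x); rewrite /htpy1_spec -/p !mulrN -ux -vx.
Qed.

Lemma htpy1_uniq u v x : a1 * x = - (u + (htpy0 (a1 * v - a2 * u)).1) -> htpy1 u v = x.
Proof. by move=> E; apply: (mulfI a1_neq0); rewrite E; case: (htpy1P u v). Qed.

Lemma htpy1_lin c u v u' v' :
  htpy1 (constQ V c * u + u') (constQ V c * v + v') = constQ V c * htpy1 u v + htpy1 u' v'.
Proof.
apply: htpy1_uniq; have [E _] := htpy1P u v; have [E' _] := htpy1P u' v'.
apply: etrans (lin_alg2 _ _ _ _) _; rewrite E E' koszul_lin_alg.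
have [-> _] := htpy0_lin c (a1 * v - a2 * u) (a1 * v' - a2 * u').
exact: lin_opp_alg.
Qed.

Lemma htpy1_bound x : htpy1 (a1 * x) (a2 * x) = - x.
Proof.
apply: htpy1_uniq; have -> : a1 * (a2 * x) - a2 * (a1 * x) = 0 by rewrite mulrCA subrr.
have [+ _] := htpy0_lin 1 0 0; rewrite rmorph1 !mul1r addr0.
by move/eqP; rewrite -subr_eq subrr eq_sym => /eqP ->; rewrite addr0 mulrN.
Qed.

Let pi : polyQ V -> quot2 a1 a2 := @quot2_pi _ a1 a2.

Definition quot_gmod : gmod (polyQ V) :=
  @Gmod (polyQ V) (quot2 a1 a2) (fun d x => exists p, homogeneous d p /\ x = pi p).

(** The normal form does not depend on the representative, so this is a section of the projection
    that is linear over the rationals and preserves degrees. *)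
Definition nf_lift (x : quot2 a1 a2) : polyQ V := nf (epsilon (inhabits 0) (fun p => x = pi p)).

Let nf_congr p q : pi p = pi q -> nf p = nf q.
Proof.
move=> /quot2_piP pq; apply: (nform_uniq I2_0 I2_lin).
  exact: (nform_standard I2_0 I2_lin).
have := rpredD pq (nfP q); by rewrite addrA subrK.
Qed.

Lemma nf_liftE p : nf_lift (pi p) = nf p.
Proof.
apply/esym/nf_congr; apply: (epsilon_spec (inhabits 0) (fun q => pi p = pi q)).
by exists p.
Qed.

Let pi_nf p : pi (nf p) = pi p.
Proof. by apply: esym; apply/quot2_piP; exact: nfP. Qed.

Let pi_scale c p : (c *: (pi p : restrict (constQ V) (quot2 a1 a2))) = pi (constQ V c * p).
Proof. exact: quot2_scaleE. Qed.

Let pi_lin c p q :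
  pi (constQ V c * p + q) = c *: (pi p : restrict (constQ V) (quot2 a1 a2)) + pi q.
Proof. by rewrite pi_scale; exact: quot2_piD. Qed.

Let pi0 : pi 0 = 0.
Proof. by apply: (@addrI _ (pi 0)); rewrite addr0 -[LHS]quot2_piD addr0. Qed.

Let pi_sum (T : Type) (s : seq T) (F : T -> polyQ V) :
  pi (\sum_(i <- s) F i) = \sum_(i <- s) pi (F i).
Proof.
exact: (big_morph pi (@quot2_piD _ a1 a2) pi0).
Qed.

Let stdm (m : 'X_{1..k}) : bool :=
  if excluded_middle_informative (leading I2 m) then false else true.

Let stdmP m : reflect (~ leading I2 m) (stdm m).
Proof. by rewrite /stdm; case: excluded_middle_informative => h; constructor; tauto. Qed.

(** The classes of the standard monomials are a basis: normal forms span, and a combination of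
    standard monomials lying in the ideal vanishes. *)
Lemma graded_free_quot m : graded_free (gmod_over (constQ V) (gmod_shift m quot_gmod)).
Proof.
pose b (i : {i | stdm i}) : restrict (constQ V) (quot2 a1 a2) := pi 'X_[val i].
pose comb (s : seq {i | stdm i}) (c : {i | stdm i} -> rat) : mpoly k rat :=
  \sum_(i <- s) c i *: 'X_[val i].
have combE (s : seq {i | stdm i}) (c : {i | stdm i} -> rat) :
    \sum_(i <- s) c i *: b i = pi (comb s c).
  rewrite [RHS]pi_sum; apply: eq_bigr => i _.
  by apply: etrans (pi_scale _ _) _; rewrite scaleE.
have nfE p : nf p = comb (pmap insub (msupp (nf p))) (fun i => (nf p)@_(val i)).
  rewrite {1}[nf p]mpolyE /comb -(big_map val xpredT (fun i => (nf p)@_i *: 'X_[i])).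
  rewrite pmap_filter; last exact: insubK.
  congr (\sum_(i <- _) _); apply/esym/all_filterP/allP => i ip.
  rewrite /= isSome_insub; apply/stdmP.
  exact: (nform_standard I2_0 I2_lin) ip.
exists {i | stdm i}, b, (fun i => (wtm (val i))%:Z + m); split.
- move=> x; have [p ->] := quot2_piE x.
  exists (pmap insub (msupp (nf p))), (fun i => (nf p)@_(val i)).
  by rewrite combE -nfE; apply: esym; exact: pi_nf.
- move=> s c us; rewrite combE => E i si.
  have c0 : comb s c = 0.
    apply: (standard_eq0 (I := I2)) => [j|].
      move=> /msupp_sum_le /flatten_mapP[l _ /msuppZ_le].
      by rewrite msuppX inE => /eqP ->; apply/stdmP/(valP l).
    by rewrite -[comb s c]subr0; apply/quot2_piP; apply: etrans E (esym pi0).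
  have := congr1 (mcoeff (val i)) c0.
  rewrite raddf_sum mcoeff0 (bigD1_seq i) //= big1 => [|l /negPf Nl].
    by rewrite mcoeffZ mcoeffX eqxx mulr1 addr0.
  by rewrite mcoeffZ mcoeffX (inj_eq val_inj) Nl mulr0.
- move=> d x; split=> [[p [hp ->]]|[s [c [hc ->]]]].
    exists (pmap insub (msupp (nf p))), (fun i => (nf p)@_(val i)).
    split=> [i|]; last by rewrite combE -nfE; apply: esym; exact: pi_nf.
    have [/(nf_homog hp) E|/memN_msupp_eq0 ->] := boolP (val i \in msupp (nf p)); last by left.
    by right; rewrite E opprD addrA addrAC subrr.
  exists (comb s c); split; last exact: combE.
  apply: homog_sum => i _; rewrite -scaleE; have [->|dm] := hc i.
    by rewrite raddf0 mul0r; apply: homog0.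
  have -> : d - m = 0 + (wtm (val i))%:Z.
    by rewrite add0r; apply/eqP; rewrite -subr_eq0 -dm opprD addrA addrAC.
  apply: (homogM (homogC _)); apply/homogeneousP; right.
  by exists (wtm (val i)); rewrite // dhomogX.
Qed.

Variables k1 k2 : int.

Local Notation M := (kos k1 a1 0 \boxt kos k2 a2 0).
Local Notation U := (restrict (constQ V) 'cV[polyQ V]_(1 * 1 + 1 * 1)).

Let vec2 (x y : polyQ V) : U := \col_i (if i == j0 then x else y).

Let vec2_0 x y : vec2 x y j0 0 = x. Proof. by rewrite mxE eqxx. Qed.
Let vec2_1 x y : vec2 x y j1 0 = y. Proof. by rewrite mxE. Qed.

Let colP2 (u v : U) : u j0 0 = v j0 0 -> u j1 0 = v j1 0 -> u = v.
Proof. by move=> E0 E1; apply/colP => i; case: (j01P i) => ->. Qed.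

Let mulE (A : 'M[polyQ V]_(1 * 1 + 1 * 1)) (v : 'cV_(1 * 1 + 1 * 1)) i :
  (A *m v) i 0 = A i j0 * v j0 0 + A i j1 * v j1 0.
Proof. by rewrite mxE sum_j01. Qed.

Let d0E (v : U) : (mx0 M *m v) j0 0 = a1 * (v : 'cV_(1 * 1 + 1 * 1)) j0 0 /\
  (mx0 M *m v) j1 0 = a2 * (v : 'cV_(1 * 1 + 1 * 1)) j0 0.
Proof.
have [E00 E01 E10 E11] := kos2_mx0 k1 a1 0 k2 a2 0.
by rewrite !mulE E00 E01 E10 E11 oppr0 !mul0r !addr0.
Qed.

Let d1E (v : U) : (mx1 M *m v) j0 0 = 0 /\
  (mx1 M *m v) j1 0 = a1 * (v : 'cV_(1 * 1 + 1 * 1)) j1 0 - a2 * (v : 'cV_(1 * 1 + 1 * 1)) j0 0.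
Proof.
have [E00 E01 E10 E11] := kos2_mx1 k1 a1 0 k2 a2 0.
by rewrite !mulE E00 E01 E10 E11 !mul0r addr0 mulNr addrC.
Qed.

Let combE c (u v : U) i : (c *: u + v) i 0 = constQ V c * u i 0 + v i 0.
Proof. by rewrite !mxE. Qed.

Let N : mf ratG := over_Q (mf_even (gmod_shift (k1 + k2) quot_gmod)).

Let f0 (v : U) : mod0 N := pi (v j1 0).
Let f0_lin : linear f0.
Proof. by move=> c u v; rewrite /f0 combE; exact: pi_lin. Qed.

Let g0 (x : mod0 N) : U := vec2 0 (nf_lift x).
Let g0_lin : linear g0.
Proof.
move=> c x y; have [p ->] := quot2_piE x; have [q ->] := quot2_piE y.
rewrite /g0 -[X in nf_lift X]pi_lin !nf_liftE nf_lin.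
by apply: colP2; rewrite combE ?vec2_0 ?vec2_1 // mulr0 addr0.
Qed.

Let h0 (v : U) : U := vec2 (htpy0 (v j1 0)).1 (htpy0 (v j1 0)).2.
Let h0_lin : linear h0.
Proof.
move=> c u v; have [E0 E1] := htpy0_lin c (u j1 0) (v j1 0).
by apply: colP2; rewrite combE ?vec2_0 ?vec2_1 combE.
Qed.

Let h1 (v : U) : U := vec2 (htpy1 (v j0 0) (v j1 0)) 0.
Let h1_lin : linear h1.
Proof.
move=> c u v; apply: colP2; rewrite combE ?vec2_0 ?vec2_1.
  by rewrite !combE htpy1_lin.
by rewrite mulr0 addr0.
Qed.

Let pi_bd (v : U) : pi ((mx1 M *m v) j1 0) = 0.
Proof.
rewrite (d1E v).2 -pi_nf nf_eq0 ?pi0 //; apply/ideal2P.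
exists ((v : 'cV_(1 * 1 + 1 * 1)) j1 0), (- (v : 'cV_(1 * 1 + 1 * 1)) j0 0).
by rewrite mulNr [_ * a1]mulrC [_ * a2]mulrC.
Qed.

Let dg_j1 : @dg0 V M j1 = k1 + k2.
Proof. exact: dg_sum_rshift. Qed.

Let gf_htpy0 (v : U) : g0 (f0 v) - v = h1 (mx0 M *m v) + (mx1 M *m h0 v : U).
Proof.
have [E0 E1] := d0E v; have [F0 F1] := d1E (h0 v).
apply: colP2; apply: etrans (mxE _ _ _ _) _; rewrite [(- v) _ _]mxE; apply: esym;
  apply: etrans (mxE _ _ _ _) _.
  by rewrite F0 addr0 !vec2_0 E0 E1 htpy1_bound add0r.
by rewrite F1 !vec2_1 !vec2_0 nf_liftE add0r htpy0P.
Qed.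

Let gf_htpy1 (v : U) : 0 - v = h0 (mx1 M *m v) + (mx0 M *m h1 v : U).
Proof.
have [E0 E1] := d1E v; have [F0 F1] := d0E (h1 v).
have [H0 H1] := htpy1P ((v : 'cV_(1 * 1 + 1 * 1)) j0 0) ((v : 'cV_(1 * 1 + 1 * 1)) j1 0).
rewrite sub0r; apply: colP2; apply: etrans (mxE _ _ _ _) _; apply: esym;
  apply: etrans (mxE _ _ _ _) _.
  by rewrite F0 !vec2_0 E1 H0 opprD addrCA subrr addr0.
by rewrite F1 vec2_1 vec2_0 E1 H1 opprD addrCA subrr addr0.
Qed.

Let fg_htpy (x : mod0 N) : f0 (g0 x) - x = 0.
Proof.
have [p ->] := quot2_piE x; apply/eqP; rewrite subr_eq0; apply/eqP.
by apply: etrans (f_equal pi (vec2_1 _ _)) _; rewrite nf_liftE; exact: pi_nf.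
Qed.

(** With both [b] entries zero, the factorization is the complex S -> S^2 -> S folded by parity,
    running from [j0] through the odd part to [j1]. The quotient is the cokernel at [j1], whose
    degree k1 + k2 is the shift; [htpy0] and [htpy1] contract the rest. *)
Lemma koszul_quot : heq (mfo (constQ V) M) N.
Proof.
unshelve eexists.
  exists (lin_of f0_lin) \0 => /= [d v hv|d v hv|v|v].
  - exists (v j1 0); split=> //; rewrite -dg_j1; exact: hv j1.
  - by [].
  - by apply/colP => -[].
  - exact: esym (pi_bd v).
unshelve eexists.
  exists (lin_of g0_lin) \0 => /= [d x [p [hp ->]] i|d v hv i|v|v].
  - rewrite /g0; case: (j01P i) => ->; rewrite ?vec2_0 ?vec2_1.
      exact: homog0.
    by rewrite nf_liftE -[dg_sum _ _ _]/(@dg0 V M j1) dg_j1; apply: nf_homog.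
  - rewrite mxE; exact: homog0.
  - have [E0 E1] := d0E (g0 v).
    apply: colP2; [apply: etrans E0 _|apply: etrans E1 _];
      by rewrite [g0 v j0 0]vec2_0 mulr0 mxE.
  - apply: etrans (mulmx0 _ _) _; apply: esym; rewrite -[X in g0 X]pi0.
    by apply: colP2; rewrite ?vec2_0 ?vec2_1 ?nf_liftE ?nf_eq0 ?rpred0 // mxE.
split.
  exists (lin_of h0_lin), (lin_of h1_lin); split; [exact: gf_htpy0 | exact: gf_htpy1].
exists \0, \0; split=> v; last by apply/colP => -[].
by apply: etrans (fg_htpy v) _; rewrite [RHS]addr0.
Qed.
End KoszulHomology.

(** The left side is the degree of the basis element [j1] of a double line, the place where the
    Jacobian ring appears. *)
Lemma closed_shiftE n : (2 - n.+1%:Z) + (4 - n.+1%:Z) = 4 - 2 * n%:Z :> int.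
Proof. by lia. Qed.

Section ClosedLine.
Variables (n : nat) (f : {mpoly rat[2]}).
Hypothesis n_ge : (1 <= n)%N.
Hypothesis fE : f = pw ('X_ord0 : {mpoly rat[2]}) 'X_ord_max n.+1.

Let s : polyQ double_var := X yvar.
Let t : polyQ double_var := X zvar.
Let a1 : polyQ double_var := dpw0 s s t n.+1.
Let a2 : polyQ double_var := dpw1 s t t n.+1.

Lemma jacobianE : jacobian f = quot_gmod a1 a2.
Proof.
have [E0 E1] := mderiv_pw n.+1.
apply: (f_equal2 (@quot_gmod double_var)); rewrite fE ?E0 ?E1.
  by rewrite [LHS](dpw0_rmorph (comp_mpoly [tuple s; t])) /= !comp_mpolyXU.
by rewrite [LHS](dpw1_rmorph (comp_mpoly [tuple s; t])) /= !comp_mpolyXU.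
Qed.

Let phi (v : double_var) : polyQ single_var := if v then 0 else X xvar.
Let inc (v : single_var) : double_var := yvar.

(** Setting z = 0 is the reduction modulo t required for the syzygies; its kernel is generated by
    z. *)
Let E : elim (subst phi) (rename inc) t 4.
Proof.
apply: (@elim_var double_var single_var inc phi zvar).
- by case.
- by case.
- exact: homog0.
- by case; [left | right; exists tt].
- by case.
- by left; rewrite [rename inc _](rmorph0 (rename inc)) subr0.
Qed.

Let gs_neq0 : subst phi s != 0.
Proof.
rewrite substX; apply/eqP => /(congr1 (mcoeff U_(enum_rank xvar)%MM)).
by rewrite mcoeffX eqxx mcoeff0.
Qed.

Let ker_g p : subst phi p = 0 -> exists q, p = t * q.
Proof.
move=> p0; have [u uE] := elim_div E p; exists u.
by apply: etrans uE _; rewrite p0 (rmorph0 (rename inc)) addr0.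
Qed.

Let natr_unit k : (k.+1%:R : mpoly #|double_var| rat) \is a GRing.unit.
Proof. rewrite -(rmorph_nat (@constQ double_var)).
by apply: (rmorph_unit (@constQ double_var)); rewrite unitfE Num.Theory.pnatr_eq0. Qed.

Let syzygy u v : a2 * u = a1 * v -> exists x, u = a1 * x /\ v = a2 * x.
Proof.
have := @dpw_syzygy (mpoly #|double_var| rat) (mpoly #|single_var| rat) (subst phi) s t
  (elim_neq0 E) (elim_ev E) gs_neq0 ker_g n.-1 u v (natr_unit _).
by rewrite /a1 /a2 -(prednK n_ge).
Qed.

(** At z = 0 this derivative is (n+1) y^n. *)
Let a1_neq0 : a1 != 0.
Proof.
have [E0 _] := dpw_hs s t n.-1; rewrite prednK // in E0.
rewrite /a1 E0; apply/eqP => /(congr1 (subst phi)).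
rewrite (rmorphM (subst phi)) (hs_rmorph (subst phi)) (elim_ev E) hs_exp.
rewrite (rmorph_nat (subst phi)) (rmorph0 (subst phi)); apply/eqP.
apply: (@mulf_neq0 (mpoly #|single_var| rat)); last exact: expf_neq0.
have := @rmorph_unit (mpoly #|double_var| rat) (mpoly #|single_var| rat) (subst phi) _
  (natr_unit n).
rewrite (rmorph_nat (subst phi)) => /unitrP[x [xE _]].
by apply: contra_eqN (esym xE) => /eqP->; rewrite mulr0 oner_neq0.
Qed.

Lemma closed_line : HMF_iso (R := ratG) 0
  (over_Q (mf_of (fmf_rename (@identify double_var)
     (mfL f (bv double_var yvar) (bv double_var zvar) (iv double_var yvar) (iv double_var zvar)))))
  (over_Q (mf_even (gmod_shift (4 - 2 * n%:Z) (jacobian f)))).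
Proof.
have [|||||-> [N1 N2]] := @mfL_line n f _ n_ge fE (bv double_var yvar) (bv double_var zvar)
  (iv double_var yvar) (iv double_var zvar) => //.
have hx (W : gvars) (v : W) k : wt v = k -> homogeneous k%:Z (X v).
  by move=> <-; apply: homogX.
have LE : fmf_rename (@identify double_var) (line n (X (bv double_var yvar))
    (X (iv double_var yvar)) (X (bv double_var zvar)) (X (iv double_var zvar)))
  = kos (2 - n.+1%:Z) a1 0 \boxt kos (4 - n.+1%:Z) a2 0.
  rewrite -[LHS]/(fmf_map (rename (@identify double_var)) _) line_map !renameX.
  by rewrite /line !subrr.
rewrite LE jacobianE -closed_shiftE.
have Lp : fmf_pot (kos (2 - n.+1%:Z) a1 0 \boxt kos (4 - n.+1%:Z) a2 0) (constQ double_var 0).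
  have := line_pot n s s t t; rewrite /line !subrr; by rewrite (rmorph0 (constQ _)).
(* Since u - v vanishes for identified ends, the degree is first found for distinct ends and then
   carried over by the identification, which preserves degrees. *)
have a1H : homogeneous ((2 * n.+1)%N%:Z - 2) a1.
  have := homog_dpw0 (k := n.+1) N1 (hx _ (bv double_var yvar) _ erefl)
     (hx _ (iv double_var yvar) _ erefl) (hx _ (bv double_var zvar) _ erefl).
  move=> /(homog_rename (s := @identify double_var)).
  rewrite (dpw0_rmorph (rename (@identify double_var))) !renameX; apply.
  by case.
have a2H : homogeneous ((2 * n.+1)%N%:Z - 4) a2.
  have := homog_dpw1 (k := n.+1) N2 (hx _ (bv double_var yvar) _ erefl)
     (hx _ (bv double_var zvar) _ erefl) (hx _ (iv double_var zvar) _ erefl).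
  move=> /(homog_rename (s := @identify double_var)).
  rewrite (dpw1_rmorph (rename (@identify double_var))) !renameX; apply.
  by case.
split.
- exact: is_mf_mfo (gbasis_constQ _) Lp.
- split.
  + exact: graded_free_quot a1H a2H _.
  + exists void, (@of_void _), (@of_void _).
    split=> [v|? ? ? ? []|d v]; last (split=> // _).
      by exists [::], (@of_void _); rewrite big_nil; apply/colP => -[].
    exists [::], (@of_void _); split=> [[]|].
    by rewrite big_nil; apply/colP => -[].
  + by move=> v; rewrite scale0r.
  + by move=> v; rewrite scale0r.
- exact: (koszul_quot a1_neq0 syzygy a1H a2H (2 - n.+1%:Z) (4 - n.+1%:Z)).
Qed.
End ClosedLine.

Theorem proposition3p5 (n : nat) (f : {mpoly rat[2]}) (hn : (3 <= n)%N)
  (hf : f \mPo [tuple 'X_ord0 + 'X_ord_max; 'X_ord0 * 'X_ord_max]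
        = 'X_ord0 ^+ n.+1 + 'X_ord_max ^+ n.+1 :> {mpoly rat[2]}) :
  (forall (a b c d : nat) (D : diagram a b c.+1 d) (o : 'I_c.+1)
      (w : polyQ (bvars a b c d)),
    let y := dout o yvar : bvars a b c.+1 d in
    let z := dout o zvar : bvars a b c.+1 d in
    let y' := iv _ (iv (ivars (Cfac n f D)) yvar) in
    let z' := iv _ (iv (ivars (Cfac n f D)) zvar) in
    let W := feval f (X y) (X z) - rename (skip_dout o) w in
    potential a b c.+1 d n f = W ->
    HMF_iso W
      (over_boundary
         (fmf_rename (prime_dout o (I := _)) (ifac (Cfac n f D)) \boxt
          mfL f (bv _ y) (bv _ z) y' z'))
      (over_boundary (ifac (Cfac n f D)))) /\
  (forall (a b c d : nat) (D : diagram a b c d.+1) (i : 'I_d.+1)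
      (w : polyQ (bvars a b c d)),
    let y := din i yvar : bvars a b c d.+1 in
    let z := din i zvar : bvars a b c d.+1 in
    let y' := iv _ (iv (ivars (Cfac n f D)) yvar) in
    let z' := iv _ (iv (ivars (Cfac n f D)) zvar) in
    let W := rename (skip_din i) w - feval f (X y) (X z) in
    potential a b c d.+1 n f = W ->
    HMF_iso W
      (over_boundary
         (fmf_rename (prime_din i (I := _)) (ifac (Cfac n f D)) \boxt
          mfL f y' z' (bv _ y) (bv _ z)))
      (over_boundary (ifac (Cfac n f D)))) /\
  (let y1 := bv double_var yvar in let z1 := bv double_var zvar in
   let y2 := iv double_var yvar in let z2 := iv double_var zvar in
   HMF_iso (R := ratG) 0
     (over_Q (mf_of (fmf_rename (@identify double_var) (mfL f y1 z1 y2 z2))))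
     (over_Q (mf_even (gmod_shift (4 - 2 * n%:Z) (jacobian f))))) /\
  (let B := gvars_sum double_var double_var in
   let I := gvars_sum single_var single_var in
   let y1 : B := bv double_var yvar in let z1 : B := bv double_var zvar in
   let y2 : B := iv double_var yvar in let z2 : B := iv double_var zvar in
   let x3 : I := bv single_var xvar in let x4 : I := iv single_var xvar in
   HMF_iso (feval f (X y1) (X z1) - feval f (X y2) (X z2))
     (over_boundary
        (mfVin f (bv I y1) (bv I z1) (iv B x3) (iv B x4) \boxt
         mfVout f (iv B x3) (iv B x4) (bv I y2) (bv I z2)))
     (mf_of (mfL f y1 z1 y2 z2 {{ -1 }} \oplus mfL f y1 z1 y2 z2 {{ 1 }}))) /\
  (let B := gvars_sum (gvars_sum single_var single_var)
                      (gvars_sum single_var single_var) in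
   let I := double_var in
   let x1 : B := bv _ (bv single_var xvar) in
   let x2 : B := bv _ (iv single_var xvar) in
   let x3 : B := iv _ (bv single_var xvar) in
   let x4 : B := iv _ (iv single_var xvar) in
   let y5 : I := yvar in let z5 : I := zvar in
   HMF_iso (X x1 ^+ n.+1 + X x2 ^+ n.+1 - X x3 ^+ n.+1 - X x4 ^+ n.+1)
     (over_boundary
        (mfVout f (bv I x1) (bv I x2) (iv B y5) (iv B z5) \boxt
         mfVin f (iv B y5) (iv B z5) (bv I x3) (bv I x4)))
     (mf_of (mfW f x1 x2 x3 x4))).
Proof.
have fE := power_sum_poly hf.
have n_ge : (1 <= n)%N by apply: leq_trans hn.
split; last split; last split; last split.
- move=> a b c d D o w y z y' z' W <-.
  exact: (unprime_dout n_ge fE D o).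
- move=> a b c d D i w y z y' z' W <-.
  exact: (unprime_din n_ge fE D i).
- exact: (closed_line n_ge fE).
- move=> B I y1 z1 y2 z2 x3 x4.
  by rewrite !(fevalE fE); apply: (digon n_ge fE).
- move=> B I x1 x2 x3 x4 y5 z5.
  by apply: (four_valent n_ge fE).
Qed.
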